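(* Let $\nu>0$ and $\alpha\in(-1,0)$. Let $f\in H^\alpha(\mathbb{T}^2)$ be independent of time and let $u_0\in H^{\alpha+2}(\mathbb{T}^2)$ with $\nabla\cdot u_0=0$. Then there exists a solution $u(t)$, $t\ge 0$, of the two-dimensional Navier–Stokes equations $$u_t+(u\cdot\nabla)u-\nu\Delta u+\nabla p=f,\qquad \nabla\cdot u=0\quad\text{on }\mathbb{T}^2,$$ with $u(0)=u_0$, such that $u\in L^\infty([0,\infty),H^{\alpha+2}(\mathbb{T}^2))$.
   Context: $\mathbb{T}^2=(\mathbb{R}/2\pi\mathbb{Z})^2$ is the two-dimensional torus, and $\nu>0$ is the fixed viscosity. All functions and distributions (velocity fields and forces) are $\mathbb{R}^2$-valued with zero spatial mean. For $s\in\mathbb{R}$, $H^s(\mathbb{T}^2)$ is the Sobolev space of zero-mean vector-valued distributions on $\mathbb{T}^2$ with finite norm $\|u\|_{H^s}=\big(\sum_{n\in\mathbb{Z}^2\setminus\{0\}}|n|^{2s}|\hat u(n)|^2\big)^{1/2}$, where $\hat u(n)$ is the $n$-th Fourier coefficient. A solution is understood in the Leray sense: a divergence-free $u$ with $u\in C([0,\tau],L^2)\cap L^2([0,\tau],H^1)$ for every $\tau>0$ that satisfies $u(0)=u_0$ and the equations in the sense of distributions (for some pressure $p$). *)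

(* Defs.v *)
From HB Require Import structures.
From mathcomp Require Import all_boot all_order all_algebra.
From mathcomp Require Import all_classical all_reals all_analysis.
From mathcomp Require Import complex.
Set Implicit Arguments.
Unset Strict Implicit.
Unset Printing Implicit Defensive.
Import Order.TTheory GRing.Theory Num.Theory.
Import numFieldNormedType.Exports.
Local Open Scope classical_set_scope.
Local Open Scope ring_scope.

(* The torus is R^2 modulo (2 pi Z)^2: functions on it are 2pi-periodic
   functions on R * R, integrated over the cell [0, 2pi[^2. *)

Section smooth_functions.
Context {R : realType} {V : normedModType R}.
Implicit Types (g : V -> R) (s : seq V).

Definition iter_derive s g : V -> R := foldr (fun v h => 'D_v h) g s.

Definition smooth g := forall s x, differentiable (iter_derive s g) x.

(* All partial derivatives of g of order at most N, in the directions
   listed in E, are bounded by M. *)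
Definition derivatives_le (E : set V) (N : nat) (M : R) g :=
  forall s, (size s <= N)%N -> (forall v, v \in s -> E v) ->
  forall x, `|iter_derive s g x| <= M.

Definition linear_on (D : set (V -> R)) (T : (V -> R) -> R) :=
  forall (a : R) g h, D g -> D h -> T (fun x => a * g x + h x) = a * T g + T h.

Definition finite_order_on (E : set V) (D : set (V -> R))
    (T : (V -> R) -> R) :=
  exists (N : nat) (C : R), forall g M,
    D g -> derivatives_le E N M g -> `|T g| <= C * M.

End smooth_functions.

Section torus.
Context {R : realType}.
Implicit Types (x : R * R) (j : 'I_2).

Definition torus_basis j : R * R := ((j == 0 :> nat)%:R, (j == 1 :> nat)%:R).

Definition torus_periodic {A : Type} (g : R * R -> A) :=
  forall j x, g (x + (2 * pi) *: torus_basis j) = g x.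

Definition cell : set (R * R) := `[0, 2 * pi[ `*` `[0, 2 * pi[.

Definition lebesgue2 := ((@lebesgue_measure R) \x (@lebesgue_measure R))%E.

Definition torus_int (g : R * R -> R) : R := \int[lebesgue2]_(x in cell) g x.

Definition torus_test : set (R * R -> R) :=
  [set g | smooth g /\ torus_periodic g].

(* The value of a functional outside the test functions is irrelevant. *)
Definition torus_distribution (T : (R * R -> R) -> R) :=
  linear_on torus_test T /\
  finite_order_on (range torus_basis) torus_test T.

Definition vector_field := R * R -> 'I_2 -> R.

(* A vector-valued distribution, given by its two components. *)
Definition vector_dist := 'I_2 -> (R * R -> R) -> R.

Definition dist_of (v : vector_field) : vector_dist :=
  fun i g => torus_int (fun x => v x i * g x).

Definition phase (n : int * int) x : R := n.1%:~R * x.1 + n.2%:~R * x.2.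

Definition freq_norm (n : int * int) : R :=
  Num.sqrt (n.1%:~R ^+ 2 + n.2%:~R ^+ 2).

(* (2 pi)^-2 <T_i, exp(- i n . x)>, T being extended complex-linearly *)
Definition fourier_coeff (T : vector_dist) (n : int * int) (i : 'I_2) : R[i] :=
  Complex ((2 * pi) ^- 2 * T i (fun x => cos (phase n x)))
          (- ((2 * pi) ^- 2 * T i (fun x => sin (phase n x)))).

Definition sobolev_norm (s : R) (T : vector_dist) : \bar R :=
  let term (n : int * int) : R := freq_norm n `^ (2 * s) *
    \sum_(i < 2) ComplexField.Normc.normc (fourier_coeff T n i) ^+ 2 in
  (\esum_(n in [set n | n != 0]) (term n)%:E) `^ 2^-1.

Definition sobolev (s : R) (T : vector_dist) :=
  [/\ forall i, torus_distribution (T i),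
      forall i, T i (fun=> 1) = 0 &
      (sobolev_norm s T < +oo)%E].

Definition divergence_free (T : vector_dist) :=
  forall g, torus_test g -> \sum_(j < 2) T j ('D_(torus_basis j) g) = 0.

(* Weak measurability; since every H^s is separable, Pettis' theorem makes
   it equivalent to strong measurability for H^s-valued curves. *)
Definition measurable_curve (I : set R) (U : R -> vector_dist) :=
  forall i g, torus_test g -> measurable_fun I (fun t => U t i g).

Definition Linfty_sobolev (I : set R) (s : R) (U : R -> vector_dist) :=
  measurable_curve I U /\
  exists M : R, {ae (@lebesgue_measure R), forall t, I t ->
    sobolev s (U t) /\ (sobolev_norm s (U t) <= M%:E)%E}.

Definition L2_sobolev (I : set R) (s : R) (U : R -> vector_dist) :=
  [/\ measurable_curve I U,
      {ae (@lebesgue_measure R), forall t, I t -> sobolev s (U t)} &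
      (\int[@lebesgue_measure R]_(t in I) (sobolev_norm s (U t) `^ 2) < +oo)%E].

Definition L2_norm (v : vector_field) : \bar R :=
  ((\int[lebesgue2]_(x in cell) (\sum_(i < 2) v x i ^+ 2)%:E) `^ 2^-1)%E.

Definition L2_field (v : vector_field) :=
  [/\ forall i, measurable_fun [set: R * R] (fun x => v x i),
      torus_periodic v,
      (L2_norm v < +oo)%E &
      forall i, torus_int (fun x => v x i) = 0].

Definition continuous_L2 (I : set R) (u : R -> vector_field) :=
  (forall t, I t -> L2_field (u t)) /\
  forall t0, I t0 ->
    L2_norm (fun x i => u t x i - u t0 x i) @[t --> within I (nbhs t0)]
      --> 0%E.

End torus.

Section navier_stokes.
Context {R : realType}.
Implicit Types (phi : R * (R * R) -> R) (j : 'I_2).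

Definition time_dir : R * (R * R) := (1, 0).
Definition space_dir j : R * (R * R) := (0, torus_basis j).

(* Smooth functions on R x torus supported in times [a, b]. *)
Definition spacetime_test (a b : R) : set (R * (R * R) -> R) :=
  [set phi | [/\ smooth phi, forall t, torus_periodic (fun x => phi (t, x)) &
                 forall t x, ~ (a <= t <= b) -> phi (t, x) = 0]].

(* Smooth compactly supported functions on ]0, +oo[ x torus. *)
Definition positive_time_test : set (R * (R * R) -> R) :=
  [set phi | exists a b : R, 0 < a /\ spacetime_test a b phi].

Definition spacetime_distribution (p : (R * (R * R) -> R) -> R) :=
  linear_on positive_time_test p /\
  forall a b : R, 0 < a ->
    finite_order_on (time_dir |` range space_dir) (spacetime_test a b) p.

Definition time_int (h : R -> R) : R :=
  \int[@lebesgue_measure R]_(t in `]0, +oo[) h t.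

(* u_t + (u . grad) u - nu Laplacian u + grad p = f in the sense of
   distributions on ]0, +oo[ x torus. As usual for divergence-free u, the
   i-th component of (u . grad) u is sum_j d_j (u_j u_i). *)
Definition momentum_equation (nu : R) (f : vector_dist) (u : R -> vector_field)
    (p : (R * (R * R) -> R) -> R) :=
  forall i phi, positive_time_test phi ->
    time_int (fun t => torus_int (fun x =>
      - (u t x i * 'D_time_dir phi (t, x))
      - \sum_(j < 2) u t x j * u t x i * 'D_(space_dir j) phi (t, x)
      - nu * (u t x i *
          \sum_(j < 2) 'D_(space_dir j) ('D_(space_dir j) phi) (t, x))))
    - p ('D_(space_dir i) phi)
    = time_int (fun t => f i (fun x => phi (t, x))).

Definition leray_solution (nu : R) (f u0 : vector_dist)
    (u : R -> vector_field) :=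
  [/\ forall tau : R, 0 < tau ->
        continuous_L2 `[0, tau] u /\
        L2_sobolev `[0, tau] 1 (fun t => dist_of (u t)),
      forall t, 0 <= t -> divergence_free (dist_of (u t)),
      forall i g, torus_test g -> dist_of (u 0) i g = u0 i g &
      exists p, spacetime_distribution p /\ momentum_equation nu f u p].

End navier_stokes.

(* Main.v *)
(** Write [u = sum_n n^perp psi_n e^{in.x}]. Galerkin truncation and explicit
    Euler steps give finitely many polynomial recursions for [psi], and every
    bound is uniform in the truncation and, for small steps, in the
    number of steps, so that no ODE theory is needed.

    Let [r_n = |n|], [d_n = r_n^(alpha+1)], and let [w_n = g_n / (nu r_n^2)] be the
    Stokes solution driven by the projected force. As [u] transports vorticity,
    [u] drops out of its own energy balance and the self-interaction of
    [eta = psi - w] drops out of the balance of the enstrophy [sum r^4 |eta|^2]. The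
    interaction with [w], which lies in [H^(alpha+2)], costs
    [(sum r |psi|)^2 sum r^4 |w|^2 / nu]. Since [sum (r d)^(-2)] converges, [(sum r |psi|)^2]
    is at most [eps sum r^4 d^2 |psi|^2] plus a multiple of the energy, so the dissipation
    absorbs it. The same scheme with weights [r^4 d^2] and the interpolation
    [(sum r^4 d^2 |eta|^2)^2 <= (sum r^4 |eta|^2) (sum r^6 d^2 |eta|^2)] bounds [u] in
    [H^(alpha+2)] for all times.

    A limit along a free ultrafilter then gives [psi], hence a bounded velocity,
    uniformly continuous in time, that solves the projected equations mode by
    mode. Test functions have absolutely and uniformly convergent Fourier
    series, so the momentum equation is recovered by summing the modes, and the
    pressure is defined by its Fourier coefficients, which are bounded. *)
Require Import Defs.
From HB Require Import structures.
From mathcomp Require Import all_boot all_order all_algebra.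
From mathcomp Require Import all_classical all_reals all_analysis.
From mathcomp Require Import measurable_realfun complex ring lra.
Set Implicit Arguments.
Unset Strict Implicit.
Unset Printing Implicit Defensive.
Import Order.TTheory GRing.Theory Num.Theory.
Import numFieldNormedType.Exports.
Local Open Scope classical_set_scope.
Local Open Scope ring_scope.

(** The obstacle is the roughness of the force. For [alpha < 0] the field [f] need not be in L^2,
    and the enstrophy balance of [psi] itself would pair [r^4 psi] with [g] against the dissipation
    [r^6 |psi|^2], which asks for [sum r^2 |g|^2], that is, for [f] in L^2. Once [w] is subtracted,
    the force is gone from the linear part and returns only through the vorticity of [w]. The sum of
    [(r d)^(-2)] converges because [alpha > -1], while [d <= r], on which the interpolation rests,
    expresses [alpha <= 0]. An explicit Euler step respects the cancellations only up to the
    quadratic remainder [h^2 |F|^2]. The truncation is fixed before the step, so this remainder can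
    be made smaller than [h]; it merely adds 1 to the source term of each balance. The flux at the
    top order has no cancellation and is quadratic in the energy to be bounded: it closes only
    because the enstrophy is bounded beforehand. A single ultrafilter serves all times, points and
    modes, so limits are taken pointwise and no subsequence is extracted. *)

Local Notation Z2 := (int * int)%type.
Local Notation Re := complex.Re.
Local Notation Im := complex.Im.
Local Notation normc := ComplexField.Normc.normc.

(** * Sums and complex numbers *)

Section FiniteSums.
Context {R : rcfType} {T : eqType}.
Implicit Types (s : seq T) (f g : T -> R).

Lemma ler_sum_mem s f g : (forall i, i \in s -> f i <= g i) ->
  \sum_(i <- s) f i <= \sum_(i <- s) g i.
Proof. by move=> fg; rewrite big_seq [leRHS]big_seq; apply: ler_sum. Qed.

Lemma sumr_ge0_mem s f : (forall i, i \in s -> 0 <= f i) ->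
  0 <= \sum_(i <- s) f i.
Proof. by move=> f0; rewrite big_seq; apply: sumr_ge0. Qed.

Lemma ler_term_sum s f n : n \in s -> (forall i, i \in s -> 0 <= f i) ->
  f n <= \sum_(i <- s) f i.
Proof.
move=> ns f0; rewrite (big_rem n) //= lerDl.
by apply: sumr_ge0_mem => i /mem_rem; apply: f0.
Qed.

Lemma sum_pick_le s (c : R) m : uniq s -> 0 <= c ->
  \sum_(l <- s | l == m) c <= c.
Proof.
move=> us c0; rewrite big_const_seq iter_addr_0 (count_uniq_mem m us).
by case: (m \in s) => /=; rewrite ?mulr1n // mulr0n.
Qed.

Lemma sum_CauchySchwarz s f g :
  (\sum_(i <- s) f i * g i) ^+ 2 <=
  (\sum_(i <- s) f i ^+ 2) * (\sum_(i <- s) g i ^+ 2).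
Proof.
elim: s => [|i s IH]; first by rewrite !big_nil expr0n mul0r.
rewrite !big_cons.
set S := \sum_(j <- s) _ in IH *; set A := \sum_(j <- s) _ in IH *.
set B := \sum_(j <- s) _ in IH *.
have A0 : 0 <= A by apply: sumr_ge0 => j _; apply: sqr_ge0.
have B0 : 0 <= B by apply: sumr_ge0 => j _; apply: sqr_ge0.
set a := f i; set b := g i.
(* The arithmetic-geometric inequality in squared form: [S ^+ 2 <= A * B] by induction, and
   [4 a^2 b^2 A B] is at most [(a^2 B + b^2 A)^2]. *)
suff H : 2 * (a * b * S) <= a ^+ 2 * B + b ^+ 2 * A.
  have -> : (a * b + S) ^+ 2 = a ^+ 2 * b ^+ 2 + 2 * (a * b * S) + S ^+ 2.
    by ring.
  have -> : (a ^+ 2 + A) * (b ^+ 2 + B) =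
            a ^+ 2 * b ^+ 2 + (a ^+ 2 * B + b ^+ 2 * A) + A * B by ring.
  by rewrite lerD // lerD2l.
set X := leRHS; set Y := leLHS.
have X0 : 0 <= X by rewrite addr_ge0 // mulr_ge0 ?sqr_ge0.
rewrite leNgt; apply/negP => XY.
have XY2 : X ^+ 2 < Y ^+ 2.
  by rewrite ltr_pXn2r ?nnegrE // ltW // (le_lt_trans X0).
suff : Y ^+ 2 <= X ^+ 2 by rewrite leNgt XY2.
have -> : Y ^+ 2 = 4 * (a ^+ 2 * b ^+ 2) * S ^+ 2 by rewrite /Y; ring.
apply: (@le_trans _ _ (4 * (a ^+ 2 * b ^+ 2) * (A * B))).
  by apply: ler_wpM2l => //; apply: mulr_ge0 => //; apply: mulr_ge0; apply: sqr_ge0.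
rewrite -subr_ge0.
have -> : X ^+ 2 - 4 * (a ^+ 2 * b ^+ 2) * (A * B) = (a ^+ 2 * B - b ^+ 2 * A) ^+ 2.
  by rewrite /X; ring.
exact: sqr_ge0.
Qed.

End FiniteSums.

(** Discrete Gronwall inequality: [(1 - c h) e + h C] does not exceed [K] when [e] does not, because
    [C <= c K]. The bound is free of the number of steps, hence good for all times. The recursion is
    only required while [e j <= K], so that the smallness of a step may itself be deduced from the
    bound. *)
Lemma contraction_step_bound {R : rcfType} (e : nat -> R) (c h C K : R) :
  0 <= h -> c * h <= 1 -> C <= c * K -> e 0%N <= K ->
  (forall j, e j <= K -> e j.+1 <= (1 - c * h) * e j + h * C) ->
  forall j, e j <= K.
Proof.
move=> h0 ch CK e0 eS; elim=> // j IH.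
apply: (le_trans (eS j IH)).
have H1 : (1 - c * h) * e j <= (1 - c * h) * K by rewrite ler_wpM2l // subr_ge0.
have H2 : h * C <= h * (c * K) by rewrite ler_wpM2l.
by rewrite (le_trans (lerD H1 H2)) // le_eqVlt; apply/orP; left; apply/eqP; ring.
Qed.

Section ComplexReal.
Context {R : rcfType}.
Local Notation C := R[i].
Implicit Types (z w : C).
Local Notation Re := complex.Re.
Local Notation Im := complex.Im.
Local Notation normc := ComplexField.Normc.normc.

(** The real inner product and the squared modulus of [R[i]] seen as a plane over [R]; both take
    values in [R], where the energies live. *)
Definition dotc z w : R := Re z * Re w + Im z * Im w.
Definition nsq z : R := Re z ^+ 2 + Im z ^+ 2.

Lemma ReD z w : Re (z + w) = Re z + Re w. Proof. by case: z; case: w. Qed.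
Lemma ImD z w : Im (z + w) = Im z + Im w. Proof. by case: z; case: w. Qed.
Lemma ReN z : Re (- z) = - Re z. Proof. by case: z. Qed.
Lemma ImN z : Im (- z) = - Im z. Proof. by case: z. Qed.
Lemma ReM z w : Re (z * w) = Re z * Re w - Im z * Im w.
Proof. by case: z; case: w. Qed.
Lemma ImM z w : Im (z * w) = Re z * Im w + Im z * Re w.
Proof. by case: z => a b; case: w => c e. Qed.
Lemma Re_conj z : Re (conjc z) = Re z. Proof. by case: z. Qed.
Lemma Im_conj z : Im (conjc z) = - Im z. Proof. by case: z. Qed.

Lemma Re_sum (I : Type) (s : seq I) (P : pred I) (F : I -> C) :
  Re (\sum_(i <- s | P i) F i) = \sum_(i <- s | P i) Re (F i).
Proof. by elim/big_rec2: _ => // i y z _ <-; rewrite ReD. Qed.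
Lemma Im_sum (I : Type) (s : seq I) (P : pred I) (F : I -> C) :
  Im (\sum_(i <- s | P i) F i) = \sum_(i <- s | P i) Im (F i).
Proof. by elim/big_rec2: _ => // i y z _ <-; rewrite ImD. Qed.

Lemma complex_ext z w : Re z = Re w -> Im z = Im w -> z = w.
Proof. by case: z => a b; case: w => c e /= -> ->. Qed.

Definition cE := (ReD, ImD, ReN, ImN, ReM, ImM, Re_conj, Im_conj).

Lemma dotcE z w : dotc z w = Re (conjc z * w).
Proof. by rewrite /dotc !cE; ring. Qed.

Lemma nsq_ge0 z : 0 <= nsq z.
Proof. by rewrite addr_ge0 ?sqr_ge0. Qed.

Lemma normcE z : normc z = Num.sqrt (nsq z).
Proof. by case: z. Qed.

Lemma normc_sqr z : normc z ^+ 2 = nsq z.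
Proof. by rewrite normcE sqr_sqrtr // nsq_ge0. Qed.

Lemma normc_ge0 z : 0 <= normc z.
Proof. by rewrite normcE sqrtr_ge0. Qed.

Lemma normc_conj z : normc (conjc z) = normc z.
Proof. by rewrite !normcE /nsq !cE sqrrN. Qed.

Lemma normc_real (x : R) : normc (x%:C)%C = `|x|.
Proof. by rewrite normcE /nsq /= expr0n addr0 sqrtr_sqr. Qed.

Lemma normc_i : normc ('i%C : C) = 1.
Proof. by rewrite normcE /nsq /= expr0n add0r expr1n sqrtr1. Qed.

Lemma normr_Re_le z : `|Re z| <= normc z.
Proof. by rewrite normcE -sqrtr_sqr ler_wsqrtr // lerDl sqr_ge0. Qed.
Lemma normr_Im_le z : `|Im z| <= normc z.
Proof. by rewrite normcE -sqrtr_sqr ler_wsqrtr // lerDr sqr_ge0. Qed.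

Lemma normc_le_ReIm z : normc z <= `|Re z| + `|Im z|.
Proof.
rewrite normcE -(@ler_pXn2r _ 2) ?nnegrE ?sqrtr_ge0 ?addr_ge0 //.
rewrite sqr_sqrtr ?nsq_ge0 // -subr_ge0 /nsq.
rewrite -(real_normK (num_real (Re z))) -(real_normK (num_real (Im z))).
set a := `|Re z|; set b := `|Im z|.
have -> : (a + b) ^+ 2 - (a ^+ 2 + b ^+ 2) = 2 * (a * b) by ring.
by rewrite mulr_ge0 // mulr_ge0 // normr_ge0.
Qed.

Lemma normr_dotc_le z w : `|dotc z w| <= normc z * normc w.
Proof.
by rewrite dotcE (le_trans (normr_Re_le _)) // ComplexField.Normc.normcM normc_conj.
Qed.

Lemma normc_sum_le (I : Type) (s : seq I) (P : pred I) (F : I -> C) :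
  normc (\sum_(i <- s | P i) F i) <= \sum_(i <- s | P i) normc (F i).
Proof.
elim/big_rec2: _ => [|i y z _ H]; first by rewrite ComplexField.Normc.normc0.
by apply: (le_trans (le_normcD _ _)); rewrite lerD2l.
Qed.

Lemma nsqD_scaled z w (h : R) :
  nsq (z + (h%:C)%C * w) = nsq z + 2 * h * dotc z w + h ^+ 2 * nsq w.
Proof. by rewrite /nsq /dotc !cE /=; ring. Qed.

Lemma nsqD_le z w : nsq (z + w) <= 2 * nsq z + 2 * nsq w.
Proof.
rewrite -subr_ge0; set x := (X in 0 <= X).
have -> : x = (Re z - Re w) ^+ 2 + (Im z - Im w) ^+ 2.
  by rewrite /x /nsq !cE; ring.
by rewrite addr_ge0 ?sqr_ge0.
Qed.

Lemma nsqM z w : nsq (z * w) = nsq z * nsq w.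
Proof. by rewrite /nsq !cE; ring. Qed.
Lemma nsqN z : nsq (- z) = nsq z.
Proof. by rewrite /nsq !cE !sqrrN. Qed.
Lemma nsq_real (x : R) : nsq (x%:C)%C = x ^+ 2.
Proof. by rewrite /nsq /= expr0n addr0. Qed.

Lemma dotcDr z w1 w2 : dotc z (w1 + w2) = dotc z w1 + dotc z w2.
Proof. by rewrite /dotc !cE; ring. Qed.
Lemma dotc_scaler z w (x : R) : dotc z ((x%:C)%C * w) = x * dotc z w.
Proof. by rewrite /dotc !cE /=; ring. Qed.
Lemma dotc_diag z : dotc z z = nsq z.
Proof. by rewrite /dotc /nsq !expr2. Qed.

End ComplexReal.

(** * Truncated Fourier modes *)

Section Modes.
Context {R : rcfType}.
Implicit Types (k l m n : Z2).

Definition freq2 n : R := n.1%:~R ^+ 2 + n.2%:~R ^+ 2.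
Definition freq n : R := Num.sqrt (freq2 n).
(** [crs k l] is [k^perp . l]: up to a factor i, the symbol of the transport of mode [l] by the
    velocity of the stream mode [k]. *)
Definition crs k l : R := k.1%:~R * l.2%:~R - k.2%:~R * l.1%:~R.
Definition dt k l : R := k.1%:~R * l.1%:~R + k.2%:~R * l.2%:~R.

Lemma freq2_ge0 n : 0 <= freq2 n. Proof. by rewrite addr_ge0 ?sqr_ge0. Qed.
Lemma freq_ge0 n : 0 <= freq n. Proof. exact: sqrtr_ge0. Qed.
Lemma freq_sqr n : freq n ^+ 2 = freq2 n. Proof. by rewrite sqr_sqrtr ?freq2_ge0. Qed.

Lemma freq2_ge1 n : n != 0 -> 1 <= freq2 n.
Proof.
move=> n0; rewrite /freq2 -!rmorphXn -intrD ler1z -[1]add0r lezD1.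
rewrite lt_neqAle addr_ge0 ?sqr_ge0 // andbT eq_sym paddr_eq0 ?sqr_ge0 //.
rewrite !sqrf_eq0; apply: contra n0 => /andP[/eqP h1 /eqP h2].
by apply/eqP; case: n h1 h2 => a b /= -> ->.
Qed.

Lemma freq_ge1 n : n != 0 -> 1 <= freq n.
Proof. by move=> n0; rewrite -sqrtr1 ler_wsqrtr // freq2_ge1. Qed.
Lemma freq2_gt0 n : n != 0 -> 0 < freq2 n.
Proof. by move=> /freq2_ge1; apply: lt_le_trans. Qed.
Lemma freq2N n : freq2 (- n) = freq2 n.
Proof. by rewrite /freq2 /= !mulrNz !sqrrN. Qed.
Lemma crs_dt_sqr k l : crs k l ^+ 2 + dt k l ^+ 2 = freq2 k * freq2 l.
Proof. by rewrite /crs /dt /freq2; ring. Qed.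

Lemma normr_crs_le k l : `|crs k l| <= freq k * freq l.
Proof.
rewrite -sqrtrM ?freq2_ge0 // -crs_dt_sqr -sqrtr_sqr ler_wsqrtr //.
by rewrite lerDl sqr_ge0.
Qed.
Lemma normr_dt_le k l : `|dt k l| <= freq k * freq l.
Proof.
rewrite -sqrtrM ?freq2_ge0 // -crs_dt_sqr -sqrtr_sqr ler_wsqrtr //.
by rewrite lerDr sqr_ge0.
Qed.

Lemma crsDr k l m : crs k (l + m) = crs k l + crs k m.
Proof. by rewrite /crs /= !mulrzDr; ring. Qed.
Lemma crsC k l : crs l k = - crs k l.
Proof. by rewrite /crs; ring. Qed.
Lemma crsxx k : crs k k = 0. Proof. by rewrite /crs; ring. Qed.
Lemma crsNr k l : crs k (- l) = - crs k l.
Proof. by rewrite /crs /= !mulrNz; ring. Qed.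
Lemma crs_sum k l : crs k (k + l) = crs k l.
Proof. by rewrite crsDr crsxx add0r. Qed.
Lemma dtDl k l m : dt (k + l) m = dt k m + dt l m.
Proof. by rewrite /dt /= !mulrzDr; ring. Qed.
Lemma dtC k l : dt k l = dt l k.
Proof. by rewrite /dt; ring. Qed.
Lemma dtxx k : dt k k = freq2 k.
Proof. by rewrite /dt /freq2; ring. Qed.

Variable L : seq Z2.
Implicit Types (x y z : Z2 -> R[i]).

(** Reality of the velocity ties the modes [n] and [- n], so a truncation has to be symmetric; the
    permutation is what reindexes sums by [n -> - n]. The mode 0 would carry the mean. *)
Definition modes := [/\ uniq L, forall n, n \in L -> n != 0 &
  perm_eq [seq - n | n <- L] L].

(* The velocity [sum_n n^perp x_n e^{in.x}] is then real, as [n^perp] is odd in [n]. *)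
Definition hermitian x := forall n, x (- n) = - conjc (x n).

(** The stream coefficients [y] have vorticity coefficients [i |l|^2 y_l], so this is minus the
    [n]-th coefficient of [u . grad omega], with [u] built from [x] and [omega] from [y]. The
    cancellations are visible in this form, the weak equation in that of [stream_flux]. *)
Definition vorticity_flux x y n : R[i] := \sum_(k <- L) \sum_(l <- L | k + l == n)
  ((crs k l * freq2 l)%:C)%C * (x k * y l).
(* With [u = sum_n n^perp x_n e^{in.x}], this is [n^perp . sum_j n_j (u_j u)_n], the subscript
   denoting Fourier coefficients: see [stream_flux_velocity]. *)
Definition stream_flux x n : R[i] := \sum_(k <- L) \sum_(l <- L | k + l == n)
  ((crs k l * dt n l)%:C)%C * (x k * x l).

Lemma eq_opp0 (a : R[i]) : a = - a -> a = 0.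
Proof.
move=> h; have : a + a = 0 by rewrite {1}h addNr.
by rewrite -mulr2n => /eqP; rewrite mulrn_eq0 /= => /eqP.
Qed.

(** Exchanging the two indices preserves [k + l = n] and turns the sum into its opposite. The next
    two lemmas use symmetries of [k + l + m = 0] in the same way. *)
Lemma sum2_antisym (f : Z2 -> Z2 -> R[i]) n :
  (forall k l, k + l = n -> f k l = - f l k) ->
  \sum_(k <- L) \sum_(l <- L | k + l == n) f k l = 0.
Proof.
move=> fA; apply: eq_opp0.
under eq_bigr do rewrite big_mkcond; rewrite {1}exchange_big /= -sumrN.
apply: eq_bigr => l _; rewrite -sumrN; apply: eq_bigr => k _.
by rewrite addrC; case: eqP => [/fA ->|]; rewrite ?opprK ?oppr0 //.
Qed.

Lemma sum3_antisym13 (f : Z2 -> Z2 -> Z2 -> R[i]) :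
  (forall k l m, k + l + m = 0 -> f k l m = - f m l k) ->
  \sum_(m <- L) \sum_(k <- L) \sum_(l <- L | k + l + m == 0) f k l m = 0.
Proof.
move=> fA; apply: eq_opp0; rewrite {1}exchange_big -sumrN /=.
apply: eq_bigr => m _; rewrite -sumrN; apply: eq_bigr => k _.
rewrite -sumrN; apply: eq_big => l; first by rewrite (addrC (m + l)) (addrC m) addrA.
by rewrite (addrC (m + l)) (addrC m) addrA => /eqP /fA ->; rewrite opprK.
Qed.

Lemma sum3_antisym23 (f : Z2 -> Z2 -> Z2 -> R[i]) :
  (forall k l m, k + l + m = 0 -> f k l m = - f k m l) ->
  \sum_(m <- L) \sum_(k <- L) \sum_(l <- L | k + l + m == 0) f k l m = 0.
Proof.
move=> fA; rewrite exchange_big big1 // => k _; apply: eq_opp0.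
under eq_bigr do rewrite big_mkcond; rewrite {1}exchange_big /= -sumrN.
apply: eq_bigr => l _; rewrite -sumrN; apply: eq_bigr => m _.
by rewrite addrAC; case: eqP => [/fA ->|]; rewrite ?opprK ?oppr0.
Qed.

(** For [n = k + l] one has [n . l - |l|^2 = k . l], which is symmetric in [k] and [l], while [crs]
    is antisymmetric. *)
Lemma stream_flux_vorticity x n : stream_flux x n = vorticity_flux x x n.
Proof.
apply/eqP; rewrite -subr_eq0 -sumrB; apply/eqP.
under eq_bigr do rewrite -sumrB.
apply: (sum2_antisym (f := fun k l =>
  ((crs k l * dt n l)%:C)%C * (x k * x l) - ((crs k l * freq2 l)%:C)%C * (x k * x l))).
move=> k l <-; rewrite !dtDl !dtxx (dtC l k) (crsC k l).
by apply: complex_ext; rewrite !cE /=; ring.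
Qed.

(** With [m = - n] the conjugate becomes [- x m], and the pairing is a sum over triads
    [k + l + m = 0], on which the permutations of the three frequencies act. *)
Lemma triad_form (wt : Z2 -> R) x y z : modes -> hermitian x ->
  (forall n, wt (- n) = wt n) ->
  \sum_(n <- L) ((wt n)%:C)%C * (conjc (x n) * vorticity_flux y z n) =
  - \sum_(m <- L) \sum_(k <- L) \sum_(l <- L | k + l + m == 0)
     ((wt m * (crs k l * freq2 l))%:C)%C * (y k * z l * x m).
Proof.
move=> [_ _ LN] xH wN; rewrite -(perm_big _ LN) big_map -sumrN.
apply: eq_bigr => m _; rewrite wN xH.
have -> : conjc (- conjc (x m)) = - x m.
  by apply: complex_ext; rewrite !cE ?opprK.
rewrite /vorticity_flux mulr_sumr mulr_sumr -sumrN; apply: eq_bigr => k _.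
rewrite mulr_sumr mulr_sumr -sumrN; apply: eq_big => l.
  by rewrite -addr_eq0.
by move=> _; apply: complex_ext; rewrite !cE /=; ring.
Qed.

(** On a triad [crs m l = - crs k l], so exchanging [k] and [m], which fixes [|l|^2 x_k x_l x_m],
    changes the sign. *)
Lemma energy_cancel x : modes -> hermitian x ->
  \sum_(n <- L) conjc (x n) * vorticity_flux x x n = 0.
Proof.
move=> LM xH; transitivity
  (\sum_(n <- L) ((1 : R)%:C)%C * (conjc (x n) * vorticity_flux x x n)).
  by apply: eq_bigr => n _; rewrite mul1r.
rewrite triad_form // sum3_antisym13 ?oppr0 // => k l m klm.
have -> : k = - (l + m) by apply/eqP; rewrite -addr_eq0 addrA klm.
rewrite (crsC l) crsNr crsDr crsxx (crsC m l).
have -> : crs m l = - crs l m by rewrite crsC.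
by apply: complex_ext; rewrite !cE /=; ring.
Qed.

(** On a triad [crs k m = - crs k l], while the weight [|m|^2 |l|^2] is symmetric in [l] and [m].
    This is the discrete form of the vanishing of the integral of [omega (u . grad omega)]. *)
Lemma enstrophy_cancel x y : modes -> hermitian x ->
  \sum_(n <- L) ((freq2 n)%:C)%C * (conjc (x n) * vorticity_flux y x n) = 0.
Proof.
move=> LM xH; rewrite triad_form //; last exact: freq2N.
rewrite sum3_antisym23 ?oppr0 // => k l m klm.
have -> : m = - (k + l) by apply/eqP; rewrite -addr_eq0 addrC klm.
rewrite crsNr crs_sum.
by apply: complex_ext; rewrite !cE /=; ring.
Qed.

Lemma vorticity_fluxDr x y z n : vorticity_flux x (fun l => y l + z l) n = vorticity_flux x y n + vorticity_flux x z n.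
Proof.
rewrite /vorticity_flux -big_split /=; apply: eq_bigr => k _; rewrite -big_split /=.
by apply: eq_bigr => l _; rewrite !mulrDr.
Qed.

(** Young's convolution inequality, an [l^1] factor against two [l^2] factors. For fixed [k] the
    indices [n] and [l] determine each other, so each square is counted at most once; [lam] weighs
    the two squares against each other. *)
Lemma trilinear_le (a b c : Z2 -> R) (lam : R) : uniq L -> 0 < lam ->
  (forall k, 0 <= a k) ->
  \sum_(n <- L) \sum_(k <- L) \sum_(l <- L | k + l == n) c n * (a k * b l) <=
  (\sum_(k <- L) a k) * (lam / 2 * \sum_(n <- L) c n ^+ 2 +
                         (2 * lam)^-1 * \sum_(n <- L) b n ^+ 2).
Proof.
move=> uL l0 a0; rewrite exchange_big /= mulr_suml; apply: ler_sum => k _.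
apply: (@le_trans _ _ (\sum_(n <- L) \sum_(l <- L | k + l == n)
    a k * (lam / 2 * c n ^+ 2 + (2 * lam)^-1 * b l ^+ 2))).
  apply: ler_sum => n _; apply: ler_sum => l _.
  rewrite mulrCA ler_wpM2l // -subr_ge0.
  have -> : lam / 2 * c n ^+ 2 + (2 * lam)^-1 * b l ^+ 2 - c n * b l =
    (2 * lam)^-1 * (lam * c n - b l) ^+ 2 by field; rewrite gt_eqF.
  by rewrite mulr_ge0 ?sqr_ge0 // invr_ge0 mulr_ge0 // ltW.
rewrite (eq_bigr (fun n => a k * (\sum_(l <- L | k + l == n) lam / 2 * c n ^+ 2 +
    \sum_(l <- L | k + l == n) (2 * lam)^-1 * b l ^+ 2))); last first.
  by move=> n _; rewrite -big_split /= mulr_sumr.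
rewrite -mulr_sumr big_split /= ler_wpM2l //; apply: lerD.
  rewrite mulr_sumr; apply: ler_sum => n _.
  have -> : \sum_(l <- L | k + l == n) lam / 2 * c n ^+ 2 =
            \sum_(l <- L | l == n - k) lam / 2 * c n ^+ 2.
    by apply: eq_bigl => l; rewrite [RHS]eq_sym subr_eq [LHS]eq_sym addrC.
  by rewrite sum_pick_le // mulr_ge0 ?sqr_ge0 // divr_ge0 // ltW.
rewrite (exchange_big_dep predT) //= mulr_sumr; apply: ler_sum => l _.
under eq_bigl do rewrite eq_sym.
by rewrite sum_pick_le // mulr_ge0 ?sqr_ge0 // invr_ge0 mulr_ge0 // ltW.
Qed.

End Modes.

(** * Weighted energies and absolutely summable velocities *)

Section Energies.
Context {R : rcfType}.
Implicit Types (L : seq Z2) (wt a b c : Z2 -> R) (x y z : Z2 -> R[i]).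

Definition energy wt L x : R := \sum_(n <- L) wt n * nsq (x n).
(** The [l^1] norm of the Fourier coefficients [n^perp x_n] of the velocity, hence a bound for its
    sup norm. *)
Definition wiener L x : R := \sum_(n <- L) freq n * normc (x n).

Lemma energy_ge0 wt L x : (forall n, n \in L -> 0 <= wt n) -> 0 <= energy wt L x.
Proof.
by move=> w0; apply: sumr_ge0_mem => n nL; rewrite mulr_ge0 ?w0 ?nsq_ge0.
Qed.

Lemma energy_le wt wt' L x : (forall n, n \in L -> wt n <= wt' n) ->
  energy wt L x <= energy wt' L x.
Proof.
by move=> ww; apply: ler_sum_mem => n nL; rewrite ler_wpM2r ?nsq_ge0 ?ww.
Qed.

Lemma energy_add_le wt L x y : (forall n, n \in L -> 0 <= wt n) ->
  energy wt L (fun n => x n + y n) <= 2 * energy wt L x + 2 * energy wt L y.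
Proof.
move=> w0; rewrite /energy !mulr_sumr -big_split; apply: ler_sum_mem => n nL /=.
rewrite !(mulrCA 2) -mulrDr ler_wpM2l ?w0 //; exact: nsqD_le.
Qed.

Lemma energy_opp wt L x : energy wt L (fun n => - x n) = energy wt L x.
Proof. by apply: eq_bigr => n _; rewrite nsqN. Qed.

Lemma energy_sub_le wt L x y : (forall n, n \in L -> 0 <= wt n) ->
  energy wt L (fun n => x n - y n) <= 2 * energy wt L x + 2 * energy wt L y.
Proof. by move=> w0; rewrite -(energy_opp _ _ y) energy_add_le. Qed.

Lemma energy_step wt L x y (h : R) :
  energy wt L (fun n => x n + (h%:C)%C * y n) =
  energy wt L x + 2 * h * (\sum_(n <- L) wt n * dotc (x n) (y n))
  + h ^+ 2 * energy wt L y.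
Proof.
rewrite /energy !mulr_sumr -!big_split; apply: eq_bigr => n _ /=.
by rewrite nsqD_scaled; ring.
Qed.

Lemma wiener_ge0 L x : 0 <= wiener L x.
Proof. by apply: sumr_ge0 => n _; rewrite mulr_ge0 ?freq_ge0 ?normc_ge0. Qed.

Lemma wiener_add L x y :
  wiener L (fun n => x n + y n) <= wiener L x + wiener L y.
Proof.
rewrite /wiener -big_split; apply: ler_sum => n _ /=.
by rewrite -mulrDr ler_wpM2l ?freq_ge0 // le_normcD.
Qed.

(** As [crs k l = crs k n] on [k + l = n], one derivative falls on the tested mode [n] instead of
    the transported mode [l]; there the dissipation can absorb it. *)
Lemma normr_dotc_vorticity_flux_le L x y (z : R[i]) n :
  `|dotc z ('i%C * vorticity_flux L x y n)| <= normc z * \sum_(k <- L)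
     \sum_(l <- L | k + l == n) freq n * (freq k * normc (x k) * (freq2 l * normc (y l))).
Proof.
apply: (le_trans (normr_dotc_le _ _)); rewrite ler_wpM2l ?normc_ge0 //.
rewrite ComplexField.Normc.normcM normc_i mul1r.
apply: (le_trans (normc_sum_le _ _ _)); apply: ler_sum => k _.
apply: (le_trans (normc_sum_le _ _ _)); apply: ler_sum => l /eqP kl.
rewrite !ComplexField.Normc.normcM normc_real normrM (ger0_norm (freq2_ge0 l)).
have : `|crs k l| <= freq k * freq n :> R by rewrite -crs_sum kl; exact: normr_crs_le.
move=> /(ler_wpM2r (mulr_ge0 (freq2_ge0 l) (mulr_ge0 (normc_ge0 (x k)) (normc_ge0 (y l))))).
by rewrite !mulrA => /le_trans; apply; rewrite le_eqVlt; apply/orP; left; apply/eqP; ring.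
Qed.

Lemma sum_dotc_i L (wt : Z2 -> R) x y :
  \sum_(n <- L) wt n * dotc (x n) ('i%C * y n) =
  Re ('i%C * \sum_(n <- L) ((wt n)%:C)%C * (conjc (x n) * y n)).
Proof.
rewrite mulr_sumr Re_sum; apply: eq_bigr => n _.
by rewrite /dotc !cE /=; ring.
Qed.

(** The choice [lam = m / (A + 1)] in [trilinear_le]: the first term is then at most [m / 2 * X]
    whatever [A] is, and [A (A + 1) / 2 <= A^2 + 1] bounds the second. *)
Lemma absorb_le (A m X Y : R) : 0 <= A -> 0 < m -> 0 <= X -> 0 <= Y ->
  A * (m / (A + 1) / 2 * X + (2 * (m / (A + 1)))^-1 * Y) <=
  m / 2 * X + (A ^+ 2 + 1) / m * Y.
Proof.
move=> A0 m0 X0 Y0; have A1 : 0 < A + 1 by rewrite ltr_wpDl.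
rewrite mulrDr; apply: lerD.
  have -> : A * (m / (A + 1) / 2 * X) = A / (A + 1) * (m / 2 * X).
    by field; rewrite gt_eqF.
  rewrite ler_piMl //; first by rewrite mulr_ge0 // divr_ge0 // ltW.
  by rewrite ler_pdivrMr // mul1r lerDl.
rewrite [A * (_ * Y)]mulrA ler_wpM2r //.
have -> : A * (2 * (m / (A + 1)))^-1 = (A * (A + 1) / 2) / m.
  by field; rewrite !gt_eqF.
rewrite ler_wpM2r ?invr_ge0 ?(ltW m0) // ler_pdivrMr // -subr_ge0.
have -> : (A ^+ 2 + 1) * 2 - A * (A + 1) = (A - 1 / 2) ^+ 2 + 7 / 4 by field.
by rewrite addr_ge0 ?sqr_ge0 // divr_ge0.
Qed.

End Energies.

(** * A priori bounds for Euler steps *)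

Section Apriori.
Context {R : rcfType}.
Implicit Types (L : seq Z2) (x y : Z2 -> R[i]) (k l n : Z2).
Variables (nu : R) (d : Z2 -> R) (g x0 : Z2 -> R[i]) (G G0 : R).
(* [d n] stands for [|n| ^ (alpha + 1)]. *)
Hypotheses (nu0 : 0 < nu) (d0 : forall n, 0 <= d n)
  (d1 : forall n : Z2, n != 0 -> 1 <= d n)
  (d2 : forall n : Z2, n != 0 -> d n ^+ 2 <= freq2 n)
  (dD : forall k l : Z2, k != 0 -> l != 0 -> freq2 k <= freq2 l :> R -> d (k + l) <= 2 * d l).
(** Convergence of the lattice sum of [(|n| d n)^-2], in a form uniform over finite sets of
    modes. *)
Hypothesis tail : forall eps : R, 0 < eps -> exists s0 : seq Z2,
  forall s : seq Z2, uniq s -> (forall n : Z2, n \in s -> n != 0 /\ n \notin s0) ->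
  \sum_(n <- s) (freq2 n * d n ^+ 2)^-1 <= eps.
Hypotheses (gH : hermitian g) (x0H : hermitian x0).

(** Applied to stream coefficients, [wd] is the weight of the squared [H^(alpha+2)] norm of the
    velocity and [w2] that of the enstrophy; [wd3] and [w3], with one more factor [|n|^2], belong to
    the corresponding dissipations. *)
Definition wd n : R := freq2 n ^+ 2 * d n ^+ 2.
Definition wd3 n : R := freq2 n ^+ 3 * d n ^+ 2.
Definition w2 n : R := freq2 n ^+ 2.
Definition w3 n : R := freq2 n ^+ 3.

Hypothesis gG : forall s : seq Z2, uniq s -> (forall n : Z2, n \in s -> n != 0) ->
  energy (fun n => d n ^+ 2) s g <= G.
Hypothesis x0G : forall s : seq Z2, uniq s -> (forall n : Z2, n \in s -> n != 0) ->
  energy wd s x0 <= G0.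

(** The momentum equation multiplied by [n^perp / |n|^2], which removes the pressure gradient, a
    multiple of [n]. *)
Definition galerkin_field L (x : Z2 -> R[i]) n : R[i] :=
  ((- (nu * freq2 n))%:C)%C * x n +
  ((- (freq2 n)^-1)%:C)%C * ('i%C * stream_flux L x n) + g n.

Fixpoint euler L (h : R) (j : nat) : Z2 -> R[i] :=
  if j is i.+1 then fun n => euler L h i n + (h%:C)%C * galerkin_field L (euler L h i) n
  else x0.

Definition stokes n : R[i] := (((nu * freq2 n)^-1)%:C)%C * g n.

Lemma stream_flux_conj L x n : modes L -> hermitian x ->
  stream_flux L x (- n) = conjc (stream_flux L x n).
Proof.
move=> [_ _ LN] xH.
have conj_sum (I : Type) (s : seq I) (P : pred I) (f : I -> R[i]) :
    conjc (\sum_(i <- s | P i) f i) = \sum_(i <- s | P i) conjc (f i).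
  by apply: complex_ext; rewrite ?cE ?Re_sum ?Im_sum -?sumrN; apply: eq_bigr => i _; rewrite !cE.
rewrite /stream_flux -(perm_big _ LN) big_map conj_sum; apply: eq_bigr => k _.
rewrite -(perm_big _ LN) big_map conj_sum; apply: eq_big => l.
  by rewrite -opprD eqr_opp.
move=> _; rewrite !xH.
have -> : crs (- k) (- l) = crs k l :> R by rewrite crsNr crsC crsNr (crsC k) !opprK.
have -> : dt (- n) (- l) = dt n l :> R.
  by rewrite /dt /= !mulrNz; ring.
by apply: complex_ext; rewrite !cE /=; ring.
Qed.

Lemma galerkin_field_hermitian L x : modes L -> hermitian x -> hermitian (galerkin_field L x).
Proof.
move=> LM xH n; rewrite /galerkin_field stream_flux_conj // xH gH freq2N.
by apply: complex_ext; rewrite !cE /=; ring.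
Qed.

Lemma euler_hermitian L h j : modes L -> hermitian (euler L h j).
Proof.
move=> LM; elim: j => //= j IH n; rewrite IH galerkin_field_hermitian //.
by apply: complex_ext; rewrite !cE /=; ring.
Qed.

Lemma hermitian_sub x y : hermitian x -> hermitian y ->
  hermitian (fun n => x n - y n : R[i]).
Proof.
by move=> xH yH n; rewrite xH yH; apply: complex_ext; rewrite !cE; ring.
Qed.

Lemma stokes_hermitian : hermitian stokes.
Proof.
by move=> n; rewrite /stokes gH freq2N; apply: complex_ext; rewrite !cE /=; ring.
Qed.

(** [stokes] balances [g] against the viscosity, so the force is absorbed by the linear term, which
    now acts on [x - stokes]. *)
Lemma galerkin_field_split L x n : n != 0 -> galerkin_field L x n =
  ((- (nu * freq2 n))%:C)%C * (x n - stokes n) +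
  ((- (freq2 n)^-1)%:C)%C * ('i%C * vorticity_flux L x x n).
Proof.
move=> n0; rewrite /galerkin_field stream_flux_vorticity addrAC; congr (_ + _).
have rn0 : freq2 n != 0 :> R by rewrite gt_eqF // freq2_gt0.
have nn0 : nu != 0 by rewrite gt_eqF.
rewrite mulrBr; congr (_ + _); rewrite /stokes.
by apply: complex_ext; rewrite !cE /=; field; apply/andP.
Qed.

Section FixedL.
Variable L : seq Z2.
Hypothesis LM : modes L.
Let uL : uniq L. Proof. by case: LM. Qed.
Let L0 : forall n, n \in L -> n != 0. Proof. by case: LM. Qed.

(** The weight [|n|^2] of the kinetic energy undoes the [|n|^-2] in front of the flux, so
    [energy_cancel] applies and only the force opposes the viscosity. Then [|n| >= 1] lowers the
    dissipation to the energy itself and [d n >= 1] raises the force term to [G]. *)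
Lemma energy_dissipation x : hermitian x ->
  2 * \sum_(n <- L) freq2 n * dotc (x n) (galerkin_field L x n) <=
  - nu * energy freq2 L x + G / nu.
Proof.
move=> xH.
have -> : \sum_(n <- L) freq2 n * dotc (x n) (galerkin_field L x n) =
  \sum_(n <- L) (- nu * (freq2 n ^+ 2 * nsq (x n)) + freq2 n * dotc (x n) (g n))
   - \sum_(n <- L) 1 * dotc (x n) ('i%C * vorticity_flux L x x n).
  rewrite -sumrB; apply: eq_big_seq => n nL.
  have rn0 : freq2 n != 0 :> R by rewrite gt_eqF // freq2_gt0 // L0.
  rewrite /galerkin_field stream_flux_vorticity !dotcDr !dotc_scaler dotc_diag.
  by field.
rewrite sum_dotc_i.
have -> : \sum_(n <- L) ((1 : R)%:C)%C * (conjc (x n) * vorticity_flux L x x n) = 0.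
  by rewrite -[RHS](energy_cancel LM xH); apply: eq_bigr => n _; rewrite mul1r.
rewrite mulr0 subr0.
apply: (@le_trans _ _ (\sum_(n <- L) (- nu * (freq2 n * nsq (x n)) + nu^-1 * (d n ^+ 2 * nsq (g n))))).
  rewrite mulr_sumr; apply: ler_sum_mem => n nL.
  have r1 : 1 <= freq2 n :> R by rewrite freq2_ge1 // L0.
  have D1 : 1 <= d n ^+ 2 by rewrite expr_ge1 // d1 // L0.
  apply: (@le_trans _ _ (- nu * (freq2 n ^+ 2 * nsq (x n)) + nu^-1 * nsq (g n))).
    (* Completing the square spends one of the two copies of the dissipation. *)
    rewrite -subr_ge0.
    have -> : - nu * (freq2 n ^+ 2 * nsq (x n)) + nu^-1 * nsq (g n) -
      2 * (- nu * (freq2 n ^+ 2 * nsq (x n)) + freq2 n * dotc (x n) (g n)) =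
      nu^-1 * ((nu * freq2 n * Re (x n) - Re (g n)) ^+ 2
             + (nu * freq2 n * Im (x n) - Im (g n)) ^+ 2).
      by rewrite /nsq /dotc; field; rewrite gt_eqF.
    by rewrite mulr_ge0 ?addr_ge0 ?sqr_ge0 // invr_ge0 ltW.
  apply: lerD.
    rewrite !mulNr lerN2 ler_wpM2l ?(ltW nu0) // ler_wpM2r ?nsq_ge0 //.
    by rewrite expr2 ler_peMl // freq2_ge0.
  by rewrite ler_wpM2l ?invr_ge0 ?(ltW nu0) // ler_peMl ?nsq_ge0.
rewrite big_split /= -!mulr_sumr lerD2l mulrC ler_wpM2r ?invr_ge0 ?(ltW nu0) //.
exact: gG.
Qed.

Lemma wd_ge0 n : 0 <= wd n.
Proof. by rewrite mulr_ge0 ?sqr_ge0. Qed.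
Lemma wd3_ge0 n : 0 <= wd3 n.
Proof. by rewrite mulr_ge0 ?sqr_ge0 // exprn_ge0 // freq2_ge0. Qed.
Lemma w2_ge0 n : 0 <= w2 n.
Proof. exact: sqr_ge0. Qed.
Lemma w3_ge0 n : 0 <= w3 n.
Proof. by rewrite exprn_ge0 // freq2_ge0. Qed.

Lemma freq2_le_w2 n : n != 0 -> freq2 n <= w2 n.
Proof. by move=> n0; rewrite /w2 expr2 ler_peMl ?freq2_ge0 ?freq2_ge1. Qed.
Lemma w2_le_wd n : n != 0 -> w2 n <= wd n.
Proof. by move=> n0; rewrite /wd ler_peMr ?w2_ge0 // expr_ge1 // d1. Qed.
Lemma w2_le_w3 n : n != 0 -> w2 n <= w3 n.
Proof. by move=> n0; rewrite /w3 exprS ler_peMl ?w2_ge0 // freq2_ge1. Qed.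
Lemma wd_le_w3 n : n != 0 -> wd n <= w3 n.
Proof. by move=> n0; rewrite /w3 /wd (exprSr _ 2) ler_wpM2l ?sqr_ge0 // d2. Qed.
Lemma wd_le_wd3 n : n != 0 -> wd n <= wd3 n.
Proof.
by move=> n0; rewrite /wd /wd3 ler_wpM2r ?sqr_ge0 // w2_le_w3.
Qed.

Lemma energy_stokes : energy wd L stokes <= G / nu ^+ 2.
Proof.
apply: (@le_trans _ _ (energy (fun n => d n ^+ 2) L g / nu ^+ 2)); last first.
  by rewrite ler_wpM2r ?invr_ge0 ?sqr_ge0 // gG.
rewrite /energy mulr_suml; apply: ler_sum_mem => n nL.
have rn0 : freq2 n != 0 :> R by rewrite gt_eqF // freq2_gt0 // L0.
rewrite /stokes nsqM nsq_real /wd le_eqVlt; apply/orP; left; apply/eqP; field.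
by rewrite rn0 gt_eqF.
Qed.

Lemma galerkin_field_pairing (wt : Z2 -> R) x :
  \sum_(n <- L) (freq2 n * wt n) * dotc (x n - stokes n) (galerkin_field L x n) =
  - nu * energy (fun n => freq2 n ^+ 2 * wt n) L (fun n => x n - stokes n) -
  \sum_(n <- L) wt n * dotc (x n - stokes n) ('i%C * vorticity_flux L x x n).
Proof.
rewrite /energy mulr_sumr -sumrB; apply: eq_big_seq => n nL.
have rn0 : freq2 n != 0 :> R by rewrite gt_eqF // freq2_gt0 // L0.
by rewrite galerkin_field_split ?L0 // dotcDr !dotc_scaler dotc_diag; field.
Qed.

(** Only the transported vorticity is split into those of [eta] and of [stokes]; the transporting
    field stays [x]. The first part cancels entirely and the second costs [wiener L x]. The
    derivative shifted to the mode [n] gives [eta] the weight [w3] of the dissipation. *)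
Lemma enstrophy_flux x (eta := fun n => x n - stokes n) : hermitian x ->
  - \sum_(n <- L) freq2 n * dotc (eta n) ('i%C * vorticity_flux L x x n) <=
  nu / 2 * energy w3 L eta + (wiener L x ^+ 2 + 1) / nu * energy w2 L stokes.
Proof.
move=> xH.
have Bsplit n : vorticity_flux L x x n = vorticity_flux L x eta n + vorticity_flux L x stokes n.
  rewrite -vorticity_fluxDr; apply: eq_bigr => k _; apply: eq_bigr => l _.
  by rewrite /eta subrK.
have -> : \sum_(n <- L) freq2 n * dotc (eta n) ('i%C * vorticity_flux L x x n) =
  \sum_(n <- L) freq2 n * dotc (eta n) ('i%C * vorticity_flux L x eta n) +
  \sum_(n <- L) freq2 n * dotc (eta n) ('i%C * vorticity_flux L x stokes n).
  by rewrite -big_split; apply: eq_bigr => n _; rewrite /= -mulrDr -dotcDr -mulrDr Bsplit.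
rewrite (sum_dotc_i _ freq2 eta) enstrophy_cancel //; last first.
  exact: hermitian_sub xH stokes_hermitian.
rewrite mulr0 add0r.
apply: (le_trans (ler_norm _)); rewrite normrN.
apply: (le_trans (ler_norm_sum _ _ _)).
set c := fun n => freq2 n * freq n * normc (eta n).
set a := fun n => freq n * normc (x n).
set b := fun n => freq2 n * normc (stokes n).
apply: (@le_trans _ _ (\sum_(n <- L) \sum_(k <- L) \sum_(l <- L | k + l == n)
   c n * (a k * b l))).
  apply: ler_sum => n _; rewrite normrM (ger0_norm (freq2_ge0 n)).
  apply: (le_trans (ler_wpM2l (freq2_ge0 n) (normr_dotc_vorticity_flux_le _ _ _ _ _))).
  rewrite !mulr_sumr; apply: ler_sum => k _; rewrite !mulr_sumr.
  apply: ler_sum => l _; rewrite /c /a /b le_eqVlt; apply/orP; left.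
  by apply/eqP; ring.
have A0 := wiener_ge0 L x.
have A1 : 0 < wiener L x + 1 by rewrite ltr_wpDl.
apply: (le_trans (@trilinear_le _ L a b c (nu / (wiener L x + 1)) uL _ _)).
- by rewrite divr_gt0.
- by move=> k; rewrite mulr_ge0 ?freq_ge0 ?normc_ge0.
have -> : \sum_(n <- L) c n ^+ 2 = energy w3 L eta.
  by apply: eq_bigr => n _; rewrite /c !exprMn normc_sqr freq_sqr /w3; ring.
have -> : \sum_(n <- L) b n ^+ 2 = energy w2 L stokes.
  by apply: eq_bigr => n _; rewrite /b !exprMn normc_sqr.
apply: absorb_le => //; apply: energy_ge0 => n _; [exact: w3_ge0|exact: w2_ge0].
Qed.

(** The weight [d] breaks the cancellation, so the whole flux is estimated. By [dD] the factor [d n]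
    passes to the larger of the two frequencies; if that is [k], then [|k| |l|^2 <= |l| |k|^2]
    exchanges the roles of the two factors. Symmetrising yields [4 * T]; estimating [T] with the
    viscosity share [nu / 4] then produces the constant 16. *)
Lemma regularity_flux x (eta := fun n => x n - stokes n) :
  - \sum_(n <- L) (freq2 n * d n ^+ 2) * dotc (eta n) ('i%C * vorticity_flux L x x n) <=
  nu / 2 * energy wd3 L eta + 16 / nu * (wiener L x ^+ 2 + 1) * energy wd L x.
Proof.
apply: (le_trans (ler_norm _)); rewrite normrN.
apply: (le_trans (ler_norm_sum _ _ _)).
set c := fun n => freq2 n * d n * freq n * normc (eta n).
set a := fun n => freq n * normc (x n).
set b := fun n => freq2 n * d n * normc (x n).
have c0 n : 0 <= c n by rewrite !mulr_ge0 ?freq2_ge0 ?freq_ge0 ?normc_ge0.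
apply: (@le_trans _ _ (\sum_(n <- L) \sum_(k <- L) \sum_(l <- L | k + l == n)
   2 * (c n * (a k * b l) + c n * (a l * b k)))).
  apply: ler_sum => n _; rewrite normrM ger0_norm ?mulr_ge0 ?freq2_ge0 ?sqr_ge0 //.
  apply: (le_trans (ler_wpM2l (mulr_ge0 (freq2_ge0 n) (sqr_ge0 (d n)))
     (normr_dotc_vorticity_flux_le _ _ _ _ _))).
  rewrite !mulr_sumr; apply: ler_sum_mem => k kL; rewrite !mulr_sumr.
  rewrite big_seq_cond [leRHS]big_seq_cond; apply: ler_sum => l /andP[lL /eqP kl].
  have -> : freq2 n * d n ^+ 2 * (normc (eta n) *
     (freq n * (freq k * normc (x k) * (freq2 l * normc (x l))))) =
     c n * ((normc (x k) * normc (x l)) * (d n * (freq k * freq2 l))).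
    by rewrite /c; ring.
  have -> : 2 * (c n * (a k * b l) + c n * (a l * b k)) =
    c n * ((normc (x k) * normc (x l)) * (2 * (freq k * (freq2 l * d l) + freq l * (freq2 k * d k)))).
    by rewrite /a /b; ring.
  rewrite ler_wpM2l // ler_wpM2l ?mulr_ge0 ?normc_ge0 //.
  have k0 := L0 kL; have l0 := L0 lL.
  have [rkl|rlk] := leP (freq2 k : R) (freq2 l).
    have dn : d n <= 2 * d l by rewrite -kl dD.
    apply: (@le_trans _ _ (2 * d l * (freq k * freq2 l))).
      by rewrite ler_wpM2r // mulr_ge0 ?freq_ge0 ?freq2_ge0.
    have -> : 2 * d l * (freq k * freq2 l) = 2 * (freq k * (freq2 l * d l)) by ring.
    rewrite ler_wpM2l // lerDl !mulr_ge0 ?freq_ge0 ?freq2_ge0 //.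
  have dn : d n <= 2 * d k by rewrite -kl addrC dD // ltW.
  have rnlk : freq k * freq2 l <= freq l * freq2 k :> R.
    rewrite -!freq_sqr; have rnlk : freq l <= freq k :> R by rewrite ler_wsqrtr // ltW.
    have -> : freq k * freq l ^+ 2 = (freq k * freq l) * freq l :> R by ring.
    have -> : freq l * freq k ^+ 2 = (freq k * freq l) * freq k :> R by ring.
    by rewrite ler_wpM2l // mulr_ge0 ?freq_ge0.
  apply: (@le_trans _ _ (2 * d k * (freq l * freq2 k))).
    by apply: ler_pM; rewrite ?mulr_ge0 ?freq_ge0 ?freq2_ge0.
  have -> : 2 * d k * (freq l * freq2 k) = 2 * (freq l * (freq2 k * d k)) by ring.
  rewrite ler_wpM2l // lerDr !mulr_ge0 ?freq_ge0 ?freq2_ge0 //.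
set T := \sum_(n <- L) \sum_(k <- L) \sum_(l <- L | k + l == n) c n * (a k * b l).
have -> : \sum_(n <- L) \sum_(k <- L) \sum_(l <- L | k + l == n)
   2 * (c n * (a k * b l) + c n * (a l * b k)) = 4 * T.
  have -> : 4 * T = 2 * (T + T) by ring.
  have TE : T = \sum_(n <- L) \sum_(k <- L) \sum_(l <- L | k + l == n) c n * (a l * b k).
    apply: eq_bigr => n _; under eq_bigr do rewrite big_mkcond.
    rewrite exchange_big /=; apply: eq_bigr => k _; rewrite [RHS]big_mkcond /=.
    by apply: eq_bigr => l _; rewrite addrC.
  rewrite {2}TE /T -big_split mulr_sumr /=; apply: eq_bigr => n _.
  rewrite -big_split mulr_sumr /=; apply: eq_bigr => k _.
  by rewrite -big_split mulr_sumr /=.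
have A0 := wiener_ge0 L x.
have A1 : 0 < wiener L x + 1 by rewrite ltr_wpDl.
have nu4 : 0 < nu / 4 by rewrite divr_gt0.
have H : T <= nu / 4 / 2 * energy wd3 L eta + (wiener L x ^+ 2 + 1) / (nu / 4) * energy wd L x.
  apply: (le_trans (@trilinear_le _ L a b c (nu / 4 / (wiener L x + 1)) uL _ _)).
  - by rewrite divr_gt0.
  - by move=> k; rewrite mulr_ge0 ?freq_ge0 ?normc_ge0.
  have -> : \sum_(n <- L) c n ^+ 2 = energy wd3 L eta.
    by apply: eq_bigr => n _; rewrite /c !exprMn normc_sqr freq_sqr /wd3; ring.
  have -> : \sum_(n <- L) b n ^+ 2 = energy wd L x.
    by apply: eq_bigr => n _; rewrite /b !exprMn normc_sqr.
  by apply: absorb_le => //; apply: energy_ge0 => n _; [exact: wd3_ge0|exact: wd_ge0].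
apply: (le_trans (ler_wpM2l (_ : 0 <= 4) H)) => //.
rewrite le_eqVlt; apply/orP; left; apply/eqP; field; exact: lt0r_neq0.
Qed.

(** Cauchy-Schwarz for [r^2 |x|] and [r^3 d |x|], whose product dominates [r^4 d^2 |x|^2] because
    [d <= r]. *)
Lemma energy_wd_interpolation x : energy wd L x ^+ 2 <= energy w2 L x * energy wd3 L x.
Proof.
have -> : energy w2 L x = \sum_(n <- L) (freq2 n * normc (x n)) ^+ 2.
  by apply: eq_bigr => n _; rewrite exprMn normc_sqr.
have -> : energy wd3 L x = \sum_(n <- L) (freq2 n * freq n * d n * normc (x n)) ^+ 2.
  by apply: eq_bigr => n _; rewrite !exprMn normc_sqr freq_sqr /wd3; ring.
apply: le_trans (sum_CauchySchwarz _ _ _).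
rewrite ler_pXn2r ?nnegrE //; last 2 first.
- by apply: energy_ge0 => n _; exact: wd_ge0.
- by apply: sumr_ge0 => n _; rewrite !mulr_ge0 ?freq2_ge0 ?freq_ge0 ?normc_ge0.
apply: ler_sum_mem => n nL; rewrite -normc_sqr /wd.
have -> : freq2 n * normc (x n) * (freq2 n * freq n * d n * normc (x n)) =
  (freq2 n ^+ 2 * d n * normc (x n) ^+ 2) * freq n by ring.
have -> : freq2 n ^+ 2 * d n ^+ 2 * normc (x n) ^+ 2 =
  (freq2 n ^+ 2 * d n * normc (x n) ^+ 2) * d n by ring.
apply: ler_wpM2l; first by apply: mulr_ge0; rewrite ?sqr_ge0 // mulr_ge0 ?sqr_ge0.
rewrite -(@ler_pXn2r _ 2) ?nnegrE ?freq_ge0 // freq_sqr; exact: d2 (L0 nL).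
Qed.

End FixedL.

(** Cauchy-Schwarz for [r^2 d |x|] and [(r d)^-1]; the latter is small in [l^2] outside a finite set
    that depends neither on the truncation nor on [x]. *)
Lemma wiener_tail_sqr_le (eps : R) : 0 < eps -> exists s0 : seq Z2,
  forall L x, uniq L -> (forall n, n \in L -> n != 0) ->
  (\sum_(n <- L | n \notin s0) freq n * normc (x n)) ^+ 2 <= eps * energy wd L x.
Proof.
move=> e0; have [s0 H0] := tail e0; exists s0 => L x uL L0.
rewrite -(big_filter L); set L2 := [seq n <- L | _]; set b := \sum_(n <- L2) _.
have -> : b = \sum_(n <- L2) (freq2 n * d n * normc (x n)) * (freq n * d n)^-1.
  apply: eq_big_seq => n; rewrite mem_filter => /andP[_ nL].
  have n0 := L0 _ nL; rewrite -freq_sqr.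
  have r0 : freq n != 0 :> R by rewrite gt_eqF // (lt_le_trans ltr01) // freq_ge1.
  have dn0 : d n != 0 by rewrite gt_eqF // (lt_le_trans ltr01) // d1.
  by field; apply/andP.
apply: (le_trans (sum_CauchySchwarz _ _ _)); rewrite mulrC; apply: ler_pM.
- by apply: sumr_ge0 => n _; rewrite sqr_ge0.
- by apply: sumr_ge0 => n _; rewrite sqr_ge0.
- under eq_bigr do rewrite exprVn exprMn freq_sqr.
  apply: H0; first exact: filter_uniq.
  by move=> n; rewrite mem_filter => /andP[? /L0].
rewrite /energy big_filter big_mkcond; apply: ler_sum => n _ /=.
case: ifP => _; first by rewrite !exprMn normc_sqr.
by rewrite mulr_ge0 ?nsq_ge0 // wd_ge0.
Qed.

(** The modes in [s0] are controlled by the kinetic energy with a constant proportional to their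
    number, the others by the tail. The top energy is charged with an arbitrarily small factor,
    which is what allows absorption into the dissipation. *)
Lemma wiener_sqr_le (eps : R) : 0 < eps -> exists2 C : R, 0 <= C &
  forall L x, uniq L -> (forall n, n \in L -> n != 0) ->
  wiener L x ^+ 2 <= eps * energy wd L x + C * energy freq2 L x.
Proof.
move=> e0; have [s0 H0] := wiener_tail_sqr_le (divr_gt0 e0 (ltr0n _ 2)).
exists (2 * (size s0)%:R) => [|L x uL L0]; first by rewrite mulr_ge0 ?ler0n.
have Hb := H0 L x uL L0.
rewrite /wiener (bigID (mem s0)) /= -(big_filter L (mem s0)).
set b := \sum_(n <- L | _) _ in Hb *.
set L1 := [seq n <- L | n \in s0]; set a := \sum_(n <- L1) _.
have Ha : a ^+ 2 <= (size s0)%:R * energy freq2 L x.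
  have -> : a = \sum_(n <- L1) 1 * (freq n * normc (x n)).
    by apply: eq_bigr => n _; rewrite mul1r.
  apply: (le_trans (sum_CauchySchwarz _ _ _)); apply: ler_pM.
  - by apply: sumr_ge0 => n _; rewrite sqr_ge0.
  - by apply: sumr_ge0 => n _; rewrite sqr_ge0.
  - under eq_bigr do rewrite expr1n.
    rewrite big_const_seq count_predT iter_addr_0 ler_nat.
    apply: uniq_leq_size; first exact: filter_uniq.
    by move=> n; rewrite mem_filter => /andP[].
  - rewrite /energy big_filter big_mkcond; apply: ler_sum => n _ /=.
    case: ifP => _; first by rewrite exprMn normc_sqr freq_sqr.
    by rewrite mulr_ge0 ?nsq_ge0 // freq2_ge0.
have : 0 <= (a - b) ^+ 2 by apply: sqr_ge0.
have -> : (a - b) ^+ 2 = 2 * a ^+ 2 + 2 * b ^+ 2 - (a + b) ^+ 2 by ring.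
lra.
Qed.

(** A polynomial in finitely many coefficients, each bounded by the energy since [|n| >= 1]. The
    constant depends on [L] and serves only to fix the step. *)
Lemma galerkin_field_bounded L (K1 : R) : modes L -> exists2 M : R, 0 <= M &
  forall x, energy freq2 L x <= K1 -> energy wd L (galerkin_field L x) <= M.
Proof.
move=> [uL L0 _]; pose kap := Num.sqrt K1.
pose c n := `|- (nu * freq2 n)| * kap + `|- (freq2 n)^-1| *
   (\sum_(k <- L) \sum_(l <- L | k + l == n) `|crs k l * dt n l : R| * (kap * kap))
   + normc (g n).
exists (\sum_(n <- L) wd n * c n ^+ 2) => [|x xK].
  by apply: sumr_ge0 => n _; rewrite mulr_ge0 ?wd_ge0 ?sqr_ge0.
have xk n : n \in L -> normc (x n) <= kap.
  move=> nL; rewrite normcE ler_wsqrtr // (le_trans _ xK) //.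
  apply: (@le_trans _ _ (freq2 n * nsq (x n))).
    by rewrite ler_peMl ?nsq_ge0 // freq2_ge1 // L0.
  apply: (ler_term_sum (f := fun n => freq2 n * nsq (x n))) => // i _.
  by rewrite mulr_ge0 ?freq2_ge0 ?nsq_ge0.
apply: ler_sum_mem => n nL; rewrite ler_wpM2l ?wd_ge0 // -normc_sqr.
have cn : normc (galerkin_field L x n) <= c n.
  rewrite /galerkin_field /c; apply: (le_trans (le_normcD _ _)); apply: lerD => //.
  apply: (le_trans (le_normcD _ _)); apply: lerD.
    by rewrite ComplexField.Normc.normcM normc_real ler_wpM2l // xk.
  rewrite !ComplexField.Normc.normcM normc_real normc_i mul1r ler_wpM2l //.
  apply: (le_trans (normc_sum_le _ _ _)); apply: ler_sum_mem => k kL.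
  apply: (le_trans (normc_sum_le _ _ _)).
  rewrite big_seq_cond [leRHS]big_seq_cond; apply: ler_sum => l /andP[lL _].
  rewrite !ComplexField.Normc.normcM normc_real ler_wpM2l //.
  by apply: ler_pM; rewrite ?normc_ge0 ?xk.
by rewrite ler_pXn2r ?nnegrE ?normc_ge0 // (le_trans _ cn) ?normc_ge0.
Qed.

Section Invariants.
Let W := G / nu ^+ 2.
(** [(G / nu + 1) / nu] is source over rate in the energy balance; the 1 pays for the
    discretisation. *)
Let K1 := Num.max G0 ((G / nu + 1) / nu).

(** [nu * h <= 1] keeps the factor [1 - nu * h] non-negative. The last condition makes the quadratic
    remainder [h^2 |F|^2] at most [h] on the ball that the energy never leaves. *)
Definition small_step L (h : R) := [/\ 0 < h, nu * h <= 1 &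
  forall x, energy freq2 L x <= K1 -> h * energy wd L (galerkin_field L x) <= 1].

Let G_ge0 : 0 <= G.
Proof. by have := @gG [::] isT (fun n nL => ltac:(by [])); rewrite /energy big_nil. Qed.
Let W_ge0 : 0 <= W. Proof. by rewrite divr_ge0 ?sqr_ge0. Qed.

(** Expansion of the square, the quadratic term being at most [h]. The reference [z] will be 0 or
    [stokes]. *)
Lemma euler_energy_step wt L h j : modes L -> small_step L h ->
  (forall n, n \in L -> 0 <= wt n <= wd n) -> energy freq2 L (euler L h j) <= K1 ->
  forall (z : Z2 -> R[i]),
  energy wt L (fun n => euler L h j.+1 n - z n) <=
  energy wt L (fun n => euler L h j n - z n) +
  h * (2 * (\sum_(n <- L) wt n * dotc (euler L h j n - z n)
                             (galerkin_field L (euler L h j) n)) + 1).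
Proof.
move=> LM [h0 _ hF] wtw xK z.
have -> : energy wt L (fun n => euler L h j.+1 n - z n) =
  energy wt L (fun n => (euler L h j n - z n) + (h%:C)%C * galerkin_field L (euler L h j) n).
  by apply: eq_bigr => n _; rewrite /= addrAC.
rewrite energy_step.
have H : h * energy wt L (galerkin_field L (euler L h j)) <= 1.
  apply: le_trans (hF _ xK); rewrite ler_wpM2l ?(ltW h0) //.
  by apply: energy_le => n /wtw/andP[].
have := ler_wpM2l (ltW h0) H.
rewrite -addrA lerD2l mulrA -expr2 mulr1 => H2.
rewrite mulrDr mulr1 mulrA (mulrC h 2); exact: lerD.
Qed.

(** The remainder of a step is controlled only inside the energy ball; the induction hypothesis
    supplies the ball. *)
Lemma euler_energy_bound L h : modes L -> small_step L h ->
  forall j, energy freq2 L (euler L h j) <= K1.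
Proof.
move=> LM hs; have [h0 nh hF] := hs; have [uL L0 _] := LM.
apply: (@contraction_step_bound _ _ nu h (G / nu + 1)) => //.
- exact: ltW.
- by rewrite [nu * K1]mulrC -ler_pdivrMr // le_max lexx orbT.
- rewrite le_max; apply/orP; left; apply: le_trans (x0G uL L0).
  by apply: energy_le => n nL; rewrite (le_trans (freq2_le_w2 (L0 _ nL))) // w2_le_wd // L0.
move=> j jK.
have Hz (x : Z2 -> R[i]) : energy freq2 L (fun n => x n - 0) = energy freq2 L x.
  by apply: eq_bigr => n _; rewrite subr0.
have wle n : n \in L -> 0 <= (freq2 n : R) <= wd n.
  move=> nL; rewrite freq2_ge0 (le_trans (freq2_le_w2 (L0 _ nL))) // w2_le_wd // L0 //.
have := @euler_energy_step freq2 L h j LM hs wle jK (fun=> 0).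
rewrite !Hz => /le_trans; apply.
under eq_bigr do rewrite subr0.
have := energy_dissipation LM (euler_hermitian h j LM).
set S := \sum_(n <- L) _ => /(ler_wpM2l (ltW h0)) H.
lra.
Qed.

Lemma wiener_split L x : modes L ->
  wiener L x ^+ 2 <= 2 * wiener L (fun n => x n - stokes n) ^+ 2 + 2 * wiener L stokes ^+ 2.
Proof.
move=> LM; have := wiener_add L (fun n => x n - stokes n) stokes.
have -> : wiener L (fun n => x n - stokes n + stokes n) = wiener L x.
  by apply: eq_bigr => n _; rewrite subrK.
set a := wiener L x; set b := wiener L _; set c := wiener L stokes => H.
have a0 : 0 <= a := wiener_ge0 _ _; have b0 : 0 <= b := wiener_ge0 _ _.
have c0 : 0 <= c := wiener_ge0 _ _.
apply: (@le_trans _ _ ((b + c) ^+ 2)).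
  by rewrite ler_pXn2r ?nnegrE // addr_ge0.
have := sqr_ge0 (b - c); have -> : (b - c) ^+ 2 = 2 * b ^+ 2 + 2 * c ^+ 2 - (b + c) ^+ 2.
  by ring.
lra.
Qed.

Lemma wiener_stokes_bound : exists2 Aw : R, 0 <= Aw & forall L, modes L ->
  wiener L stokes ^+ 2 <= Aw.
Proof.
have [C C0 HC] := wiener_sqr_le ltr01.
exists (1 * W + C * W) => [|L LM]; first by rewrite mul1r addr_ge0 // mulr_ge0.
have [uL L0 _] := LM.
apply: (le_trans (HC _ _ uL L0)); have HW := energy_stokes LM.
have HW2 : energy freq2 L stokes <= W.
  apply: le_trans HW; apply: energy_le => n nL.
  by rewrite (le_trans (freq2_le_w2 (L0 _ nL))) // w2_le_wd // L0.
by apply: lerD; rewrite ler_wpM2l.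
Qed.

Lemma euler_enstrophy_bound : exists2 K2 : R, 0 <= K2 & forall L h,
  modes L -> small_step L h ->
  forall j, energy w2 L (fun n => euler L h j n - stokes n) <= K2.
Proof.
have [Aw Aw0 HAw] := wiener_stokes_bound.
(* The Wiener factor of the flux puts [2 eps W / nu] in front of the dissipation, which is at most
   [nu / 4] with this choice. *)
pose eps := nu ^+ 2 / (8 * (W + 1)).
have W1 : 0 < W + 1 by rewrite ltr_wpDl.
have eps0 : 0 < eps.
  by apply: divr_gt0; [exact: exprn_gt0|apply: mulr_gt0; rewrite ?ltr0n].
have [C C0 HC] := wiener_sqr_le eps0.
pose C' := (2 * C * (2 * K1 + 2 * W) + 2 * Aw + 1) * W / nu.
pose K2 := Num.max (2 * G0 + 2 * W) ((2 * C' + 1) / (nu / 2)).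
have G00 : 0 <= G0.
  by have := @x0G [::] isT (fun n nL => ltac:(by [])); rewrite /energy big_nil.
exists K2 => [|L h LM hs]; first by rewrite le_max addr_ge0 // mulr_ge0.
have [h0 nh hF] := hs; have [uL L0 _] := LM.
have HW := energy_stokes LM; rewrite -/W in HW.
have nu2 : 0 < nu / 2 by rewrite divr_gt0.
(* Of the dissipation [nu], one half goes to [enstrophy_flux] and a quarter to its Wiener factor.
   Twice the remaining quarter is the rate [nu / 2]; the 1 is the error of the Euler step. *)
apply: (@contraction_step_bound _ _ (nu / 2) h (2 * C' + 1)).
- exact: ltW.
- by move: h0 nh; lra.
- by rewrite [nu / 2 * K2]mulrC -ler_pdivrMr // le_max lexx orbT.
- rewrite le_max; apply/orP; left; apply: (le_trans (energy_sub_le _ _ _)).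
    by move=> n _; exact: w2_ge0.
  have H1 : energy w2 L x0 <= G0.
    by apply: le_trans (x0G uL L0); apply: energy_le => n nL; rewrite w2_le_wd // L0.
  have H2 : energy w2 L stokes <= W.
    by apply: le_trans HW; apply: energy_le => n nL; rewrite w2_le_wd // L0.
  by rewrite /=; lra.
move=> j _; have jK := euler_energy_bound LM hs j.
have wle n : n \in L -> 0 <= w2 n <= wd n.
  by move=> nL; rewrite w2_ge0 w2_le_wd // L0.
apply: (le_trans (@euler_energy_step w2 L h j LM hs wle jK stokes)).
set x := euler L h j in jK *; set eta := fun n => x n - stokes n.
have xH : hermitian x := euler_hermitian h j LM.
have SE : \sum_(n <- L) w2 n * dotc (x n - stokes n) (galerkin_field L x n) =
   - nu * energy w3 L eta - \sum_(n <- L) freq2 n * dotc (eta n) ('i%C * vorticity_flux L x x n).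
  transitivity (\sum_(n <- L) freq2 n * freq2 n * dotc (x n - stokes n) (galerkin_field L x n)).
    by apply: eq_bigr => n _; rewrite /w2 expr2.
  rewrite (galerkin_field_pairing LM); congr (_ * _ - _).
  by apply: eq_bigr => n _; rewrite /w3 (exprSr _ 2).
have flux := enstrophy_flux LM xH.
have H2 : energy w2 L stokes <= W.
  by apply: le_trans HW; apply: energy_le => n nL; rewrite w2_le_wd // L0.
have H20 : 0 <= energy w2 L stokes by apply: energy_ge0 => n _; exact: w2_ge0.
have Hx := wiener_split x LM; have Heta := HC _ eta uL L0; have HAwL := HAw _ LM.
have Ed3 : energy wd L eta <= energy w3 L eta.
  by apply: energy_le => n nL; rewrite wd_le_w3 // L0.
have E23 : energy w2 L eta <= energy w3 L eta.
  by apply: energy_le => n nL; rewrite w2_le_w3 // L0.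
have E1 : energy freq2 L eta <= 2 * K1 + 2 * W.
  apply: (le_trans (energy_sub_le _ _ _)); first by move=> n _; exact: freq2_ge0.
  have : energy freq2 L stokes <= W.
    apply: le_trans H2; apply: energy_le => n nL; rewrite freq2_le_w2 // L0 //.
  by move: jK; lra.
have A2 : wiener L x ^+ 2 + 1 <= 2 * eps * energy w3 L eta +
    (2 * C * (2 * K1 + 2 * W) + 2 * Aw + 1).
  have t1 := ler_wpM2l C0 E1; have t2 := ler_wpM2l (ltW eps0) Ed3.
  by rewrite -/eta in Hx; lra.
have A20 : 0 <= wiener L x ^+ 2 + 1 by rewrite addr_ge0 ?sqr_ge0.
have E30 : 0 <= energy w3 L eta by apply: energy_ge0 => n _; exact: w3_ge0.
have prod : (wiener L x ^+ 2 + 1) / nu * energy w2 L stokes <= nu / 4 * energy w3 L eta + C'.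
  apply: (@le_trans _ _ ((2 * eps * energy w3 L eta +
    (2 * C * (2 * K1 + 2 * W) + 2 * Aw + 1)) / nu * W)).
    apply: ler_pM => //; first by rewrite divr_ge0 // ltW.
    by rewrite ler_wpM2r // invr_ge0 ltW.
  have -> : (2 * eps * energy w3 L eta +
    (2 * C * (2 * K1 + 2 * W) + 2 * Aw + 1)) / nu * W =
    2 * eps * W / nu * energy w3 L eta + C' by rewrite /C'; ring.
  rewrite lerD2r ler_wpM2r //.
  have -> : 2 * eps * W / nu = nu / 4 * (W / (W + 1)).
    by rewrite /eps; field; rewrite !gt_eqF.
  by rewrite ler_piMr ?divr_ge0 // ?(ltW nu0) // ler_pdivrMr // mul1r lerDl.
have Sle : \sum_(n <- L) w2 n * dotc (x n - stokes n) (galerkin_field L x n) <=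
   - (nu / 4) * energy w2 L eta + C'.
  rewrite SE; have := ler_wpM2l (ltW nu0) E23; rewrite -/eta in flux; lra.
have := ler_wpM2l (ltW h0) Sle; rewrite -/eta.
set S := \sum_(n <- L) _; set E := energy w2 L eta; lra.
Qed.

(** The flux contains the square of the energy [X] to be bounded. Interpolation gives [X^2 <= K2 Z],
    with the enstrophy bound [K2] and the dissipation [Z], so the flux becomes linear in [Z], and
    its coefficient is small with [eps]. *)
Lemma euler_regularity_bound : exists2 K3 : R, 0 <= K3 & forall L h,
  modes L -> small_step L h ->
  forall j, energy wd L (fun n => euler L h j n - stokes n) <= K3.
Proof.
have [Aw Aw0 HAw] := wiener_stokes_bound.
have [K2 K20 HK2] := euler_enstrophy_bound.
(* [320 = 16 * 5 * 4]: 16 from [regularity_flux], 5 multiples of [eps * X ^+ 2] (four from the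
   product below, one from Young's inequality for [q * X]), and 4 from the target [nu / 4]. *)
pose eps := nu ^+ 2 / (320 * (K2 + 1)).
have K21 : 0 < K2 + 1 by rewrite ltr_wpDl.
have eps0 : 0 < eps.
  by apply: divr_gt0; [exact: exprn_gt0|apply: mulr_gt0; rewrite ?ltr0n].
have [C C0 HC] := wiener_sqr_le eps0.
pose M := 2 * C * K2 + 2 * Aw + 1.
have M0 : 0 <= M by rewrite !addr_ge0 // !mulr_ge0.
(* The coefficient of [X] in the product of [2 eps X + M], which bounds the Wiener factor, and
   [2 X + 2 W], which bounds the energy of [x]. *)
pose q := 4 * eps * W + 2 * M.
pose C' := 16 / nu * (q ^+ 2 / (4 * eps) + 2 * W * M).
pose K3 := Num.max (2 * G0 + 2 * W) ((2 * C' + 1) / (nu / 2)).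
have G00 : 0 <= G0.
  by have := @x0G [::] isT (fun n nL => ltac:(by [])); rewrite /energy big_nil.
exists K3 => [|L h LM hs].
  by rewrite le_max (_ : 0 <= 2 * G0 + 2 * W) // addr_ge0 // mulr_ge0.
have [h0 nh hF] := hs; have [uL L0 _] := LM.
have HW := energy_stokes LM; rewrite -/W in HW.
have nu2 : 0 < nu / 2 by rewrite divr_gt0.
apply: (@contraction_step_bound _ _ (nu / 2) h (2 * C' + 1)).
- exact: ltW.
- by move: h0 nh; lra.
- by rewrite [nu / 2 * K3]mulrC -ler_pdivrMr // le_max lexx orbT.
- rewrite le_max; apply/orP; left; apply: (le_trans (energy_sub_le _ _ _)).
    by move=> n _; exact: wd_ge0.
  by have := x0G uL L0; rewrite /=; lra.
move=> j _; have jK := euler_energy_bound LM hs j.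
have wle n : n \in L -> 0 <= wd n <= wd n by move=> nL; rewrite wd_ge0 lexx.
apply: (le_trans (@euler_energy_step wd L h j LM hs wle jK stokes)).
have jK2 := HK2 _ _ LM hs j.
set x := euler L h j in jK jK2 *; set eta := fun n => x n - stokes n in jK2 *.
have SE : \sum_(n <- L) wd n * dotc (x n - stokes n) (galerkin_field L x n) =
   - nu * energy wd3 L eta - \sum_(n <- L) (freq2 n * d n ^+ 2) * dotc (eta n) ('i%C * vorticity_flux L x x n).
  transitivity (\sum_(n <- L) (freq2 n * (freq2 n * d n ^+ 2)) * dotc (x n - stokes n) (galerkin_field L x n)).
    by apply: eq_bigr => n _; rewrite /wd expr2 mulrA.
  rewrite (galerkin_field_pairing LM); congr (_ * _ - _).
  by apply: eq_bigr => n _; rewrite /wd3; congr (_ * _); ring.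
have flux := regularity_flux LM x; rewrite /= -/eta in flux.
have Hx := wiener_split x LM; rewrite -/eta in Hx.
have Heta := HC _ eta uL L0; have HAwL := HAw _ LM.
set X := energy wd L eta in Heta *; set Z := energy wd3 L eta in SE flux *.
have X0 : 0 <= X by apply: energy_ge0 => n _; exact: wd_ge0.
have Z0 : 0 <= Z by apply: energy_ge0 => n _; exact: wd3_ge0.
have XZ : X <= Z by apply: energy_le => n nL; rewrite wd_le_wd3 // L0.
have XX : X ^+ 2 <= K2 * Z.
  apply: (le_trans (energy_wd_interpolation LM eta)); apply: ler_wpM2r => //.
have E1 : energy freq2 L eta <= K2.
  by apply: le_trans jK2; apply: energy_le => n nL; rewrite freq2_le_w2 // L0.
have Edx : energy wd L x <= 2 * X + 2 * W.
  have -> : energy wd L x = energy wd L (fun n => eta n + stokes n).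
    by apply: eq_bigr => n _; rewrite /eta subrK.
  apply: (le_trans (energy_add_le _ _ _)); first by move=> n _; exact: wd_ge0.
  by rewrite -/X; lra.
have A2 : wiener L x ^+ 2 + 1 <= 2 * eps * X + M.
  by have t1 := ler_wpM2l C0 E1; rewrite /M; lra.
have A20 : 0 <= wiener L x ^+ 2 + 1 by rewrite addr_ge0 ?sqr_ge0.
have Edx0 : 0 <= energy wd L x by apply: energy_ge0 => n _; exact: wd_ge0.
have prod : 16 / nu * (wiener L x ^+ 2 + 1) * energy wd L x <= nu / 4 * Z + C'.
  rewrite -mulrA; apply: (@le_trans _ _ (16 / nu * ((2 * eps * X + M) * (2 * X + 2 * W)))).
    apply: ler_wpM2l; first by rewrite divr_ge0 // ltW.
    exact: ler_pM.
  have e4 : 0 < 4 * eps by rewrite mulr_gt0.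
  have yng : q * X <= eps * X ^+ 2 + q ^+ 2 / (4 * eps).
    rewrite -subr_ge0.
    have -> : eps * X ^+ 2 + q ^+ 2 / (4 * eps) - q * X =
              (2 * eps * X - q) ^+ 2 / (4 * eps) by field; rewrite gt_eqF.
    by rewrite divr_ge0 ?sqr_ge0 // ltW.
  have step : (2 * eps * X + M) * (2 * X + 2 * W) <=
     5 * eps * K2 * Z + (q ^+ 2 / (4 * eps) + 2 * W * M).
    have -> : (2 * eps * X + M) * (2 * X + 2 * W) =
      4 * eps * X ^+ 2 + q * X + 2 * W * M by rewrite /q; ring.
    have := ler_wpM2l (ltW eps0) XX; rewrite mulrA; lra.
  apply: (le_trans (ler_wpM2l _ step)); first by rewrite divr_ge0 // ltW.
  rewrite mulrDr -/C' lerD2r mulrA ler_wpM2r //.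
  have -> : 16 / nu * (5 * eps * K2) = nu / 4 * (K2 / (K2 + 1)).
    by rewrite /eps; field; rewrite !gt_eqF.
  by rewrite ler_piMr ?divr_ge0 // ?(ltW nu0) // ler_pdivrMr // mul1r lerDl.
have Sle : \sum_(n <- L) wd n * dotc (x n - stokes n) (galerkin_field L x n) <=
   - (nu / 4) * X + C'.
  rewrite SE; have := ler_wpM2l (ltW nu0) XZ; lra.
have := ler_wpM2l (ltW h0) Sle; rewrite -/eta.
set S := \sum_(n <- L) _; lra.
Qed.

(** The order of the quantifiers matters: [K] is chosen before the truncation, the admissible step
    after it. *)
Theorem euler_apriori : exists2 K : R, 0 <= K & forall L, modes L ->
  exists2 h0 : R, 0 < h0 & forall h, 0 < h <= h0 ->
  forall j, energy wd L (euler L h j) <= K.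
Proof.
have [K3 K30 HK3] := euler_regularity_bound.
exists (2 * K3 + 2 * W) => [|L LM]; first by rewrite addr_ge0 // mulr_ge0.
have [M M0 HM] := galerkin_field_bounded K1 LM.
have M1 : 0 < M + 1 by rewrite ltr_wpDl.
exists (Num.min nu^-1 (M + 1)^-1) => [|h /andP[h0]].
  by rewrite lt_min !invr_gt0 nu0.
rewrite le_min => /andP[h1 h2] j.
have hs : small_step L h.
  split=> // [|x /HM xM].
    by rewrite mulrC -ler_pdivlMr // mul1r.
  apply: (@le_trans _ _ ((M + 1)^-1 * (M + 1))); last by rewrite mulVf // gt_eqF.
  apply: ler_pM; rewrite ?(ltW h0) //; last by rewrite (le_trans xM) // lerDl.
  by apply: energy_ge0 => n _; exact: wd_ge0.
have -> : energy wd L (euler L h j) = energy wd L (fun n => (euler L h j n - stokes n) + stokes n).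
  by apply: eq_bigr => n _; rewrite subrK.
apply: (le_trans (energy_add_le _ _ _)); first by move=> n _; exact: wd_ge0.
have := HK3 _ _ LM hs j; have := energy_stokes LM; rewrite -/W; lra.
Qed.

End Invariants.
End Apriori.

(** * Equicontinuity in time *)

Section Equicontinuity.
Context {R : rcfType}.
Implicit Types (L : seq Z2) (x y : Z2 -> R[i]) (k l n : Z2).

(** The polarised [stream_flux], needed for the difference of two states. *)
Definition Bq L x y n : R[i] := \sum_(k <- L) \sum_(l <- L | k + l == n)
  ((crs k l * dt n l)%:C)%C * (x k * y l).

(** Each of the two symbols carries a factor [|n|], the first by [crs k l = crs k n]. The resulting
    [|n|^2] is cancelled by the [|n|^-2] in [galerkin_field]. *)
Lemma normc_Bq_le L x y n :
  normc (Bq L x y n) <= freq2 n * (wiener L x * wiener L y).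
Proof.
apply: (le_trans (normc_sum_le _ _ _)).
rewrite /wiener mulr_suml mulr_sumr; apply: ler_sum => k _.
apply: (le_trans (normc_sum_le _ _ _)).
rewrite !mulr_sumr big_mkcond; apply: ler_sum => l _.
case: eqP => [kl|_]; last first.
  by rewrite mulr_ge0 ?freq2_ge0 // !mulr_ge0 ?freq_ge0 ?normc_ge0.
rewrite !ComplexField.Normc.normcM normc_real normrM.
have h1 : `|crs k l| <= freq k * freq n :> R by rewrite -crs_sum kl; exact: normr_crs_le.
have h2 : `|dt n l| <= freq n * freq l :> R by exact: normr_dt_le.
apply: (@le_trans _ _ ((freq k * freq n * (freq n * freq l)) * (normc (x k) * normc (y l)))).
  apply: ler_wpM2r; first by rewrite mulr_ge0 ?normc_ge0.
  by apply: ler_pM.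
by rewrite le_eqVlt -freq_sqr; apply/orP; left; apply/eqP; ring.
Qed.

Lemma stream_flux_sub L x y n : stream_flux L x n - stream_flux L y n =
  Bq L (fun k => x k - y k) x n + Bq L y (fun k => x k - y k) n.
Proof.
rewrite -sumrB -big_split; apply: eq_bigr => k _ /=.
rewrite -sumrB -big_split; apply: eq_bigr => l _ /=.
by ring.
Qed.

Variables (nu : R) (d : Z2 -> R) (g x0 : Z2 -> R[i]) (K : R).
Hypotheses (nu0 : 0 < nu) (d0 : forall n, 0 <= d n) (d1 : forall n : Z2, n != 0 -> 1 <= d n) (K0 : 0 <= K).
Hypothesis tail : forall eps : R, 0 < eps -> exists s0 : seq Z2,
  forall s : seq Z2, uniq s -> (forall n, n \in s -> n != 0 /\ n \notin s0) ->
  \sum_(n <- s) (freq2 n * d n ^+ 2)^-1 <= eps.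
Local Notation galerkin_field := (galerkin_field nu g).
Local Notation euler := (euler nu g x0).

Lemma normc_le_wiener L x n : (forall n, n \in L -> n != 0) -> n \in L ->
  normc (x n) <= wiener L x.
Proof.
move=> L0 nL; apply: (@le_trans _ _ (freq n * normc (x n))).
  by rewrite ler_peMl ?normc_ge0 // freq_ge1 // L0.
apply: (ler_term_sum (f := fun n => freq n * normc (x n))) => // i _.
by rewrite mulr_ge0 ?freq_ge0 ?normc_ge0.
Qed.

Lemma wiener_bound : exists2 A : R, 0 <= A & forall L x, modes L ->
  energy (wd d) L x <= K -> wiener L x <= A.
Proof.
have [C C0 HC] := wiener_sqr_le d1 tail ltr01.
exists (Num.sqrt ((1 + C) * K)) => [|L x [uL L0 _] xK]; first exact: sqrtr_ge0.
rewrite -[wiener L x]ger0_norm ?wiener_ge0 // -sqrtr_sqr ler_wsqrtr //.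
apply: (le_trans (HC L x uL L0)); rewrite mulrDl; apply: lerD.
  by rewrite ler_wpM2l.
rewrite ler_wpM2l // (le_trans _ xK) //; apply: energy_le => n nL.
have n0 := L0 _ nL.
by rewrite (le_trans (freq2_le_w2 n0)) // (w2_le_wd d0 d1 n0).
Qed.

Lemma normc_galerkin_field_le L x n (A : R) : modes L -> wiener L x <= A -> n \in L ->
  normc (galerkin_field L x n) <= nu * freq2 n * A + A ^+ 2 + normc (g n).
Proof.
move=> [uL L0 _] xA nL; have n0 := L0 _ nL.
have A0 : 0 <= A by apply: le_trans xA; apply: wiener_ge0.
apply: (le_trans (le_normcD _ _)); apply: lerD => //.
apply: (le_trans (le_normcD _ _)); apply: lerD.
  rewrite ComplexField.Normc.normcM normc_real normrN ger0_norm ?mulr_ge0 ?freq2_ge0 ?(ltW nu0) //.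
  rewrite ler_wpM2l ?mulr_ge0 ?freq2_ge0 ?(ltW nu0) //.
  by rewrite (le_trans _ xA) // normc_le_wiener.
rewrite !ComplexField.Normc.normcM normc_real normc_i mul1r normrN ger0_norm ?invr_ge0 ?freq2_ge0 //.
rewrite mulrC ler_pdivrMr ?freq2_gt0 //.
apply: (le_trans (normc_Bq_le L x x n)); rewrite mulrC ler_wpM2r ?freq2_ge0 //.
by rewrite expr2; apply: ler_pM; rewrite ?wiener_ge0.
Qed.

Lemma normc_galerkin_field_sub_le L x y n (A : R) : modes L -> wiener L x <= A ->
  wiener L y <= A -> n \in L ->
  normc (galerkin_field L x n - galerkin_field L y n) <=
  (nu * freq2 n + 2 * A) * wiener L (fun k => x k - y k).
Proof.
move=> [uL L0 _] xA yA nL; have n0 := L0 _ nL.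
have A0 : 0 <= A by apply: le_trans xA; apply: wiener_ge0.
have -> : galerkin_field L x n - galerkin_field L y n = ((- (nu * freq2 n))%:C)%C * (x n - y n) +
   ((- (freq2 n)^-1)%:C)%C * ('i%C * (stream_flux L x n - stream_flux L y n)).
  by rewrite /galerkin_field; ring.
set D := wiener L _; have D0 : 0 <= D := wiener_ge0 _ _.
apply: (le_trans (le_normcD _ _)); rewrite mulrDl; apply: lerD.
  rewrite ComplexField.Normc.normcM normc_real normrN ger0_norm ?mulr_ge0 ?freq2_ge0 ?(ltW nu0) //.
  rewrite ler_wpM2l ?mulr_ge0 ?freq2_ge0 ?(ltW nu0) //.
  exact: (normc_le_wiener (fun k => x k - y k)).
rewrite !ComplexField.Normc.normcM normc_real normc_i mul1r normrN ger0_norm ?invr_ge0 ?freq2_ge0 //.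
rewrite mulrC ler_pdivrMr ?freq2_gt0 // stream_flux_sub.
apply: (le_trans (le_normcD _ _)).
apply: (le_trans (lerD (normc_Bq_le _ _ _ _) (normc_Bq_le _ _ _ _))).
rewrite -mulrDr [leRHS]mulrC ler_wpM2l ?freq2_ge0 // -/D.
have t1 := ler_wpM2l D0 xA; have t2 := ler_wpM2l D0 yA; lra.
Qed.

Section Bounded.
Variables (A : R).
Hypothesis A0 : 0 <= A.
Hypothesis HA : forall L x, modes L -> energy (wd d) L x <= K -> wiener L x <= A.

Definition good_run L h :=
  [/\ modes L, 0 < h & forall j, energy (wd d) L (euler L h j) <= K].

Let CF n := nu * freq2 n * A + A ^+ 2 + normc (g n).
Let CF_ge0 n : 0 <= CF n.
Proof. by rewrite !addr_ge0 ?normc_ge0 ?sqr_ge0 ?mulr_ge0 ?freq2_ge0 // ltW. Qed.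

Lemma euler_lipschitz L h n : good_run L h -> n \in L -> forall i m,
  normc (euler L h (i + m) n - euler L h i n) <= h * m%:R * CF n.
Proof.
move=> [LM h0 HK] nL i; elim=> [|m IH].
  by rewrite addn0 subrr ComplexField.Normc.normc0 mulr0 mul0r.
rewrite addnS /= addrAC.
have -> : h * m.+1%:R * CF n = h * m%:R * CF n + h * CF n by rewrite -natr1; ring.
apply: (le_trans (le_normcD _ _)); apply: lerD => //.
rewrite ComplexField.Normc.normcM normc_real ger0_norm ?(ltW h0) // ler_wpM2l ?(ltW h0) //.
by apply: normc_galerkin_field_le => //; apply: HA.
Qed.

(** The modes of a finite set are Lipschitz in time, each with its own constant, and the others are
    small by the tail estimate for the difference of two states, whose top energy is at most
    [4 K]. *)
Lemma euler_modulus (eps : R) : 0 < eps -> exists2 tau : R, 0 < tau &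
  forall L h, good_run L h -> forall i m, h * m%:R <= tau ->
  wiener L (fun n => euler L h (i + m) n - euler L h i n) <= eps.
Proof.
move=> e0.
have e1 : 0 < (eps / 2) ^+ 2 / (4 * K + 1).
  by rewrite divr_gt0 ?exprn_gt0 ?divr_gt0 // ltr_wpDl ?mulr_ge0.
have [s0 Hs0] := wiener_tail_sqr_le d1 tail e1.
pose S : R := \sum_(n <- undup s0) freq n * CF n.
have S0 : 0 <= S by apply: sumr_ge0 => n _; rewrite mulr_ge0 ?freq_ge0.
exists (eps / 2 / (S + 1)) => [|L h Lh i m hm].
  by rewrite !divr_gt0 // ltr_wpDl.
have [LM h0 HK] := Lh; have [uL L0 _] := LM.
set y := fun n => _; rewrite /wiener (bigID (mem s0)) /= (_ : eps = eps / 2 + eps / 2); last first.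
  by field.
apply: lerD.
  apply: (@le_trans _ _ (h * m%:R * S)).
    have ys n : n \in s0 -> n \in L ->
        freq n * normc (y n) <= h * m%:R * (freq n * CF n).
      move=> _ nL; rewrite mulrCA ler_wpM2l ?freq_ge0 //.
      exact: euler_lipschitz.
    have hm0 : 0 <= h * m%:R by rewrite mulr_ge0 ?ler0n // ltW.
    have -> : \sum_(n <- L | n \in s0) freq n * normc (y n) =
              \sum_(n <- undup s0 | n \in L) freq n * normc (y n).
      rewrite -big_filter -[RHS]big_filter; apply: perm_big.
      apply: uniq_perm; rewrite ?filter_uniq ?undup_uniq // => n.
      by rewrite !mem_filter mem_undup andbC.
    rewrite /S mulr_sumr big_mkcond; apply: ler_sum_mem => n.
    rewrite mem_undup => ns; case: ifP => [nL|_]; first exact: ys.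
    by apply: mulr_ge0 => //; apply: mulr_ge0 => //; exact: freq_ge0.
  apply: (@le_trans _ _ (eps / 2 / (S + 1) * S)); first by rewrite ler_wpM2r.
  have S1 : 0 < S + 1 by rewrite ltr_wpDl.
  rewrite mulrAC ler_pdivrMr // ler_wpM2l ?divr_ge0 ?(ltW e0) // lerDl //.
rewrite -(@ler_pXn2r _ 2) ?nnegrE ?divr_ge0 ?(ltW e0) //; last first.
  by apply: sumr_ge0 => n _; rewrite mulr_ge0 ?freq_ge0 ?normc_ge0.
apply: (le_trans (Hs0 _ _ uL L0)).
have Hy : energy (wd d) L y <= 4 * K.
  apply: (le_trans (energy_sub_le _ _ _)); first by move=> n _; exact: wd_ge0.
  by have := HK (i + m)%N; have := HK i; lra.
apply: (le_trans (ler_wpM2l (ltW e1) Hy)).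
rewrite mulrAC ler_pdivrMr ?ltr_wpDl ?mulr_ge0 //.
by rewrite ler_wpM2l ?sqr_ge0 // lerDl.
Qed.

(** An increment of the run is a sum of values of the field, which hardly varies over a time [tau].
    Being uniform in [L] and [h], this expansion survives the limit and becomes the differential
    equation. *)
Lemma euler_taylor n (eps : R) : 0 < eps -> exists2 tau : R, 0 < tau &
  forall L h, good_run L h -> n \in L -> forall i m, h * m%:R <= tau ->
  normc (euler L h (i + m) n - euler L h i n -
         ((h * m%:R)%:C)%C * galerkin_field L (euler L h i) n) <= eps * (h * m%:R).
Proof.
move=> e0; set c := nu * freq2 n + 2 * A.
have c0 : 0 <= c by rewrite addr_ge0 ?mulr_ge0 ?freq2_ge0 // ltW.
have c1 : 0 < c + 1 by rewrite ltr_wpDl.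
have [tau t0 Ht] := euler_modulus (divr_gt0 e0 c1).
exists tau => // L h Lh nL i; have [LM h0 HK] := Lh.
elim=> [|m IH] hm.
  by rewrite addn0 subrr mulr0 mul0r subr0 ComplexField.Normc.normc0 mulr0.
have hm' : h * m%:R <= tau.
  by rewrite (le_trans _ hm) // ler_wpM2l ?(ltW h0) // ler_nat.
rewrite addnS /=.
have -> : euler L h (i + m) n + h%:C%C * galerkin_field L (euler L h (i + m)) n -
   euler L h i n - (h * m.+1%:R)%:C%C * galerkin_field L (euler L h i) n =
   (euler L h (i + m) n - euler L h i n - (h * m%:R)%:C%C * galerkin_field L (euler L h i) n) +
   h%:C%C * (galerkin_field L (euler L h (i + m)) n - galerkin_field L (euler L h i) n).
  by apply: complex_ext; rewrite !cE /= -natr1; ring.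
apply: (le_trans (le_normcD _ _)).
have -> : eps * (h * m.+1%:R) = eps * (h * m%:R) + eps * h by rewrite -natr1; ring.
apply: lerD; first exact: IH.
rewrite ComplexField.Normc.normcM normc_real ger0_norm ?(ltW h0) // [leRHS]mulrC ler_wpM2l ?(ltW h0) //.
apply: (le_trans (normc_galerkin_field_sub_le (A := A) LM _ _ nL)); [exact: HA|exact: HA|].
apply: (le_trans (ler_wpM2l c0 (Ht L h Lh i m hm'))).
rewrite mulrCA -[leRHS]mulr1 ler_wpM2l ?(ltW e0) // ler_pdivrMr // mul1r lerDl //.
Qed.

End Bounded.
End Equicontinuity.

(** * Integration and differentiation on the torus *)

Section TorusIntegral.
Context {R : realType}.
Local Notation mu := (@lebesgue_measure R).
Local Notation leb2 := (@lebesgue2 R).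
Local Notation cell := (@cell R).
Implicit Types (f g h : R * R -> R).

(** An open set of the plane is a countable union of rational boxes, hence belongs to the product
    sigma-algebra on which [lebesgue2] is defined. *)
Lemma open_measurable2 (U : set (R * R)) : open U -> measurable U.
Proof.
move=> oU.
pose box (q : (rat * rat) * rat) : set (R * R) :=
  ball (ratr q.1.1 : R) (ratr q.2) `*` ball (ratr q.1.2 : R) (ratr q.2).
pose B n : set (R * R) := if unpickle n is Some q then
  (if `[< box q `<=` U >] then box q else set0) else set0.
have -> : U = \bigcup_n B n.
  apply/seteqP; split => [[x y] Uxy|z [n _]]; last first.
    rewrite /B; case: (unpickle n) => // q.
    by case: ifPn => // /asboolP; apply.
  have [e /= e0 eU] : nbhs_ball (x, y) U by rewrite nbhs_ballE; exact: open_nbhs_nbhs.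
  have e20 : 0 < e / 2 by rewrite divr_gt0.
  have [r] := rat_in_itvoo e20; rewrite in_itv /= => /andP[r0 re].
  have rat_near (a : R) : exists q : rat, `|a - ratr q| < ratr r.
    have [q] := @rat_in_itvoo R (a - ratr r) (a + ratr r) (ltac:(lra)).
    by rewrite in_itv /= => qa; exists q; rewrite ltr_distlC.
  have [p px] := rat_near x; have [q qy] := rat_near y.
  have bU : box ((p, q), r) `<=` U.
    move=> [a b] [/= pa qb]; apply: eU.
    have pa' : `|ratr p - a| < ratr r := pa.
    have qb' : `|ratr q - b| < ratr r := qb.
    have tri (u v w : R) : `|u - v| < ratr r -> `|v - w| < ratr r -> `|u - w| < e.
      move=> uv vw; rewrite (_ : u - w = (u - v) + (v - w)); last by ring.
      by rewrite (le_lt_trans (ler_normD _ _)) //; lra.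
    by split; [exact: tri px pa'|exact: tri qy qb'].
  exists (pickle ((p, q), r)); first exact: Logic.I.
  rewrite /B pickleK; case: ifPn => [_|/asboolPn//].
  have px' : `|ratr p - x| < ratr r by rewrite distrC.
  have qy' : `|ratr q - y| < ratr r by rewrite distrC.
  by split; [exact: px'|exact: qy'].
apply: bigcupT_measurable => n; rewrite /B.
case: (unpickle n) => [q|]; last exact: measurable0.
case: ifPn => _; last exact: measurable0.
by apply: measurableX; apply: open_measurable; exact: ball_open.
Qed.

Lemma continuous_measurable2 g : continuous g -> measurable_fun setT g.
Proof.
move=> /continuousP cg; apply: (measurability _ (RGenOpens.measurableE R)).
move=> _ [_ [a [b ->] <-]]; rewrite setTI; apply: open_measurable2.
exact/cg/interval_open.
Qed.

Lemma measurable_cell : measurable cell.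
Proof. by apply: measurableX; exact: measurable_itv. Qed.

Lemma pi2_gt0 : 0 < 2 * pi :> R.
Proof. by rewrite mulr_gt0 // pi_gt0. Qed.

Definition cell_area : R := (2 * pi) ^+ 2.

Lemma cell_area_gt0 : 0 < cell_area.
Proof. by rewrite exprn_gt0 // pi2_gt0. Qed.

Lemma lebesgue2_cell : leb2 cell = cell_area%:E.
Proof.
have mI : mu (`[0, 2 * pi[%classic : set R) = (2 * pi)%:E.
  by rewrite lebesgue_measure_itv /= lte_fin pi2_gt0 -EFinD subr0.
set J := (`[0, 2 * pi[%classic : set R) in mI *.
transitivity (mu J * mu J)%E.
  by apply: product_measure1E; exact: measurable_itv.
by rewrite mI -EFinM /cell_area expr2.
Qed.

(** A class stable under sums and products, on which integrability over [cell] is automatic since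
    [cell] has finite measure. *)
Definition bdd_meas g :=
  measurable_fun setT g /\ exists M, forall x, `|g x| <= M.

Lemma bdd_meas_integrable g : bdd_meas g -> leb2.-integrable cell (EFin \o g).
Proof.
move=> [mg [M gM]]; apply: measurable_bounded_integrable.
- exact: measurable_cell.
- have : (leb2 cell < +oo)%E by rewrite lebesgue2_cell ltry.
  exact.
- exact: measurable_funTS.
- exists M; split; first exact: num_real.
  by move=> N MN x _; exact: le_trans (gM x) (ltW MN).
Qed.

Lemma bdd_meas_cst (c : R) : bdd_meas (fun=> c).
Proof. by split; [exact: measurable_cst|exists `|c|]. Qed.

Lemma bdd_measD f g : bdd_meas f -> bdd_meas g -> bdd_meas (fun x => f x + g x).
Proof.
move=> [mf [M fM]] [mg [N gN]]; split; first exact: measurable_funD.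
by exists (M + N) => x; rewrite (le_trans (ler_normD _ _)) // lerD.
Qed.

Lemma bdd_measM f g : bdd_meas f -> bdd_meas g -> bdd_meas (fun x => f x * g x).
Proof.
move=> [mf [M fM]] [mg [N gN]]; split; first exact: measurable_funM.
by exists (M * N) => x; rewrite normrM ler_pM.
Qed.

Lemma bdd_measZ (c : R) g : bdd_meas g -> bdd_meas (fun x => c * g x).
Proof. by move=> ?; apply: bdd_measM => //; exact: bdd_meas_cst. Qed.

Lemma bdd_measN g : bdd_meas g -> bdd_meas (fun x => - g x).
Proof.
move=> /(bdd_measZ (-1)); congr bdd_meas.
by apply/funext => x; rewrite mulN1r.
Qed.

Lemma bdd_measB f g : bdd_meas f -> bdd_meas g -> bdd_meas (fun x => f x - g x).
Proof. by move=> ? ?; apply: bdd_measD => //; exact: bdd_measN. Qed.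

Lemma bdd_meas_sum (I : Type) (s : seq I) (F : I -> R * R -> R) :
  (forall i, bdd_meas (F i)) -> bdd_meas (fun x => \sum_(i <- s) F i x).
Proof.
move=> bF; elim: s => [|i s IH].
  by under eq_fun do rewrite big_nil; exact: bdd_meas_cst.
by under eq_fun do rewrite big_cons; exact: bdd_measD.
Qed.

Lemma torus_intD f g : bdd_meas f -> bdd_meas g ->
  torus_int (fun x => f x + g x) = torus_int f + torus_int g.
Proof.
move=> bf bg; rewrite /torus_int RintegralD //; first exact: measurable_cell.
- exact: bdd_meas_integrable.
- exact: bdd_meas_integrable.
Qed.

Lemma torus_intZ (c : R) g : bdd_meas g ->
  torus_int (fun x => c * g x) = c * torus_int g.
Proof.
move=> bg; rewrite /torus_int RintegralZl //; first exact: measurable_cell.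
exact: bdd_meas_integrable.
Qed.

Lemma torus_intN g : bdd_meas g -> torus_int (fun x => - g x) = - torus_int g.
Proof.
move=> bg; rewrite -mulN1r -torus_intZ //.
by congr torus_int; apply/funext => x; rewrite mulN1r.
Qed.

Lemma torus_intB f g : bdd_meas f -> bdd_meas g ->
  torus_int (fun x => f x - g x) = torus_int f - torus_int g.
Proof. by move=> bf bg; rewrite torus_intD ?torus_intN //; exact: bdd_measN. Qed.

Lemma torus_int_cst (c : R) : torus_int (fun=> c) = c * cell_area.
Proof.
rewrite /torus_int Rintegral_cst; last exact: measurable_cell.
by congr (_ * _); exact: (congr1 fine lebesgue2_cell).
Qed.

Lemma torus_int_sum (I : Type) (s : seq I) (F : I -> R * R -> R) :
  (forall i, bdd_meas (F i)) ->
  torus_int (fun x => \sum_(i <- s) F i x) = \sum_(i <- s) torus_int (F i).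
Proof.
move=> bF; elim: s => [|i s IH].
  by under eq_fun do rewrite big_nil; rewrite torus_int_cst mul0r big_nil.
under eq_fun do rewrite big_cons.
by rewrite torus_intD ?IH ?big_cons //; exact: bdd_meas_sum.
Qed.

Lemma le_torus_int f g : bdd_meas f -> bdd_meas g ->
  (forall x, cell x -> f x <= g x) -> torus_int f <= torus_int g.
Proof.
move=> bf bg fg; rewrite /torus_int le_Rintegral //; first exact: measurable_cell.
- exact: bdd_meas_integrable.
- exact: bdd_meas_integrable.
Qed.

Lemma normr_torus_int_le g M : bdd_meas g -> (forall x, `|g x| <= M) ->
  `|torus_int g| <= M * cell_area.
Proof.
move=> bg gM; rewrite ler_norml -mulNr -!torus_int_cst; apply/andP; split.
  apply: le_torus_int => //; first exact: bdd_meas_cst.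
  by move=> x _; have := gM x; rewrite ler_norml => /andP[].
apply: le_torus_int => //; first exact: bdd_meas_cst.
by move=> x _; have := gM x; rewrite ler_norml => /andP[].
Qed.

Local Notation I := (`[0, 2 * pi[%classic : set R).

Let restr g : R * R -> \bar R := (EFin \o g) \_ cell.

Let restr_integrable g : bdd_meas g -> leb2.-integrable setT (restr g).
Proof.
move=> bg; rewrite /restr -integrable_mkcond; last exact: measurable_cell.
exact: bdd_meas_integrable.
Qed.

Let restrE g x y : restr g (x, y) = if (x \in I) && (y \in I) then (g (x, y))%:E else 0%E.
Proof. by rewrite /restr patchE /Defs.cell in_setX. Qed.

Lemma torus_int_eq0_fst g : bdd_meas g ->
  (forall y, (\int[mu]_(x in I) (g (x, y))%:E = 0)%E) -> torus_int g = 0.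
Proof.
move=> bg g0; rewrite /torus_int /Rintegral integral_mkcond -/(restr g).
rewrite -(@integral21_prod_meas1 _ _ _ _ _ mu mu) ?integral0_eq //; last exact: restr_integrable.
move=> y _; rewrite /fubini_G; under eq_integral do rewrite restrE.
case: (boolP (y \in I)) => yI; last first.
  by under eq_integral do rewrite andbF; rewrite integral0_eq.
under eq_integral do rewrite andbT.
rewrite -[RHS](g0 y) [RHS]integral_mkcond.
by apply: eq_integral => x _; rewrite patchE.
Qed.

Lemma torus_int_eq0_snd g : bdd_meas g ->
  (forall x, (\int[mu]_(y in I) (g (x, y))%:E = 0)%E) -> torus_int g = 0.
Proof.
move=> bg g0; rewrite /torus_int /Rintegral integral_mkcond -/(restr g).
rewrite -(@integral12_prod_meas1 _ _ _ _ _ mu mu) ?integral0_eq //; last exact: restr_integrable.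
move=> x _; rewrite /fubini_F; under eq_integral do rewrite restrE.
case: (boolP (x \in I)) => xI; last by rewrite integral0_eq.
rewrite -[RHS](g0 x) [RHS]integral_mkcond.
by apply: eq_integral => y _; rewrite patchE.
Qed.

End TorusIntegral.

(** * Smooth functions and their directional derivatives *)

Section SmoothFunctions.
Context {R : realType} {V : normedModType R}.
Implicit Types (g : V -> R) (v : V).

Lemma derive_line g (x v : V) (t : R) :
  'D_1 (fun s : R => g (x + s *: v)) t = 'D_v g (x + t *: v).
Proof.
rewrite /derive; set F := (X in lim (X @ _) = _).
set G := (X in _ = lim (X @ _)); suff -> : F = G by [].
apply/funext => h; congr (_ *: (g _ - _)).
by rewrite [h *: 1]mulr1 scalerDl addrCA.
Qed.

Lemma derivable_line g (x v : V) (t : R) :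
  derivable g (x + t *: v) v -> derivable (fun s : R => g (x + s *: v)) t 1.
Proof.
rewrite /derivable; set F := (X in cvg (X @ _) -> _).
set G := (X in _ -> cvg (X @ _)); suff -> : G = F by [].
apply/funext => h; congr (_ *: (g _ - _)).
by rewrite [h *: 1]mulr1 scalerDl addrCA.
Qed.

Lemma smooth_derive g v : smooth g -> smooth ('D_v g).
Proof. by move=> sg s x; have := sg (rcons s v) x; rewrite /iter_derive foldr_rcons. Qed.

Lemma smooth_differentiable g : smooth g -> forall x, differentiable g x.
Proof. by move=> sg x; exact: (sg [::] x). Qed.

Lemma smooth_continuous g : smooth g -> continuous g.
Proof. by move=> sg x; exact: differentiable_continuous (smooth_differentiable sg x). Qed.

Lemma smooth_is_derive g (x v : V) (t : R) : smooth g ->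
  is_derive t 1 (fun s : R => g (x + s *: v)) ('D_v g (x + t *: v)).
Proof.
move=> sg; apply: DeriveDef; last exact: derive_line.
exact/derivable_line/diff_derivable/smooth_differentiable.
Qed.

Lemma iter_derive_lin g h (a : R) s : smooth g -> smooth h ->
  iter_derive s (fun x => a * g x + h x) =
  (fun x => a * iter_derive s g x + iter_derive s h x).
Proof.
move=> sg sh; elim: s => //= v s ->; apply/funext => x.
have dg : derivable (iter_derive s g) x v by exact/diff_derivable/sg.
have dh : derivable (iter_derive s h) x v by exact/diff_derivable/sh.
rewrite (_ : (fun x => _) = a *: iter_derive s g + iter_derive s h) //.
by rewrite deriveD; [rewrite deriveZ; [|exact: dg]|exact: derivableZ|exact: dh].
Qed.

Lemma smooth_lin g h (a : R) : smooth g -> smooth h ->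
  smooth (fun x => a * g x + h x).
Proof.
move=> sg sh s x; rewrite iter_derive_lin //.
rewrite (_ : (fun x => _) = a *: iter_derive s g + iter_derive s h) //.
apply: differentiableD; last exact: sh.
by apply: differentiableZ; exact: sg.
Qed.

Lemma smooth_cst (c : R) : smooth (fun _ : V => c).
Proof.
have H s : exists c', iter_derive s (fun _ : V => c) = fun=> c'.
  elim: s => [|v s [c' /= ->]]; first by exists c.
  by exists 0; apply/funext => x; rewrite derive_cst.
by move=> s x; have [c' ->] := H s; exact: differentiable_cst.
Qed.

End SmoothFunctions.

(** * Periodic functions and integration by parts *)

Section TorusCalculus.
Context {R : realType}.
Local Notation mu := (@lebesgue_measure R).
Local Notation T2 := (R * R)%type.
Local Notation e_ := (@torus_basis R).
Local Notation test := (@torus_test R).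
Implicit Types (f g h : T2 -> R) (j : 'I_2) (n : int * int).

Lemma torus_basis0 : e_ ord0 = (1, 0). Proof. by []. Qed.
Lemma torus_basis1 : e_ ord_max = (0, 1). Proof. by []. Qed.

Lemma ord2P (P : 'I_2 -> Prop) : P ord0 -> P ord_max -> forall j, P j.
Proof.
move=> P0 P1 [[|[|//]] jlt]; [move: P0|move: P1]; congr P; exact: val_inj.
Qed.

Lemma sum_ord2 {A : zmodType} (F : 'I_2 -> A) : \sum_(j < 2) F j = F ord0 + F ord_max.
Proof.
by rewrite big_ord_recl big_ord1; congr (_ + F _); exact: val_inj.
Qed.

Lemma periodic_int {A : Type} (g : T2 -> A) : torus_periodic g ->
  forall j (m : int) x, g (x + (m%:~R * (2 * pi)) *: e_ j) = g x.
Proof.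
move=> pg j; have nat_case (m : nat) x : g (x + (m%:R * (2 * pi)) *: e_ j) = g x.
  elim: m => [|m IH]; first by rewrite mul0r scale0r addr0.
  by rewrite -natr1 mulrDl mul1r scalerDl addrA pg.
case=> m x; first exact: nat_case.
rewrite NegzE mulrNz mulNr scaleNr -(nat_case m.+1 (x - _)).
by rewrite subrK.
Qed.

Lemma reduce1 (a : R) : exists m : int, (`[0, 2 * pi[%classic : set R) (a + m%:~R * (2 * pi)).
Proof.
exists (- Num.floor (a / (2 * pi))); rewrite /= in_itv /= mulrNz mulNr.
have p0 := @pi2_gt0 R; set m := Num.floor _.
have h1 : m%:~R * (2 * pi) <= a by rewrite -ler_pdivlMr // floor_le_tmp.
have h2 : a < (m%:~R + 1) * (2 * pi).
  by rewrite -ltr_pdivrMr // (_ : 1 = 1%:~R) // -intrD floorD1_gt.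
by rewrite mulrDl mul1r in h2; apply/andP; split; lra.
Qed.

(** The representative serves all periodic functions at once, whatever their codomain. *)
Lemma reduce_to_cell (x : T2) : exists2 y, cell y &
  forall (A : Type) (g : T2 -> A), torus_periodic g -> g x = g y.
Proof.
case: x => a b; have [m1 h1] := reduce1 a; have [m2 h2] := reduce1 b.
exists (a + m1%:~R * (2 * pi), b + m2%:~R * (2 * pi)) => // A g pg.
rewrite -(periodic_int pg ord0 m1) -(periodic_int pg ord_max m2).
congr g; rewrite torus_basis0 torus_basis1; congr (_, _) => /=.
  by rewrite !(scaler0, addr0) [_ *: 1]mulr1.
by rewrite !(scaler0, addr0) [_ *: 1]mulr1.
Qed.

Lemma periodic_continuous_bounded g : continuous g -> torus_periodic g ->
  exists M, forall x, `|g x| <= M.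
Proof.
move=> cg pg.
have cK : compact (`[0, 2 * pi]%classic `*` `[0, 2 * pi]%classic : set T2).
  by apply: compact_setX; exact: segment_compact.
have : bounded_set (g @` (`[0, 2 * pi]%classic `*` `[0, 2 * pi]%classic : set T2)).
  apply: compact_bounded; apply: continuous_compact => //.
  exact: continuous_subspaceT.
move=> [M [_ HM]]; exists (M + 1) => x.
have [y [y1 y2] /(_ _ _ pg) ->] := reduce_to_cell x.
apply: (HM (M + 1)); first by rewrite ltrDl.
exists y => //; split.
  by move: y1; rewrite /= !in_itv /= => /andP[-> /ltW].
by move: y2; rewrite /= !in_itv /= => /andP[-> /ltW].
Qed.

Lemma test_bdd_meas g : test g -> bdd_meas g.
Proof.
move=> [/smooth_continuous cg pg]; split; first exact: continuous_measurable2.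
exact: periodic_continuous_bounded.
Qed.

Lemma derive_periodic g v : torus_periodic g -> torus_periodic ('D_v g).
Proof.
move=> pg j x; rewrite /derive; set F := (X in lim (X @ _) = _).
set G := (X in _ = lim (X @ _)); suff -> : F = G by [].
apply/funext => h; congr (_ *: (_ - _)); last exact: pg.
by rewrite /= addrA pg.
Qed.

Lemma test_derive g v : test g -> test ('D_v g).
Proof. by move=> [sg pg]; split; [exact: smooth_derive|exact: derive_periodic]. Qed.

Lemma test_lin g h (a : R) : test g -> test h -> test (fun x => a * g x + h x).
Proof.
move=> [sg pg] [sh ph]; split; first exact: smooth_lin.
by move=> j x; rewrite pg ph.
Qed.

Lemma test_cst (c : R) : test (fun=> c).
Proof. by split; [exact: smooth_cst|move=> ? ?]. Qed.

Lemma test_sum (I : Type) (s : seq I) (a : I -> R) (F : I -> T2 -> R) :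
  (forall i, test (F i)) -> test (fun x => \sum_(i <- s) a i * F i x).
Proof.
move=> tF; elim: s => [|i s IH].
  by under eq_fun do rewrite big_nil; exact: test_cst.
by under eq_fun do rewrite big_cons; exact: test_lin.
Qed.

Lemma FTC_periodic (F f : R -> R) : continuous f ->
  (forall t : R, is_derive t 1 F (f t)) -> F (2 * pi) = F 0 ->
  (\int[mu]_(t in `[0%R, (2 * pi)%R[) (f t)%:E = 0)%E.
Proof.
move=> cf dF Fp.
have cF : continuous F.
  move=> t; apply: differentiable_continuous.
  by apply/derivable1_diffP; have [] := dF t.
rewrite integral_itv_bndo_bndc; last first.
  apply/measurable_EFinP; apply: measurable_funTS.
  exact: continuous_measurable_fun.
rewrite (@continuous_FTC2 _ f F) ?pi2_gt0 //.
- by rewrite Fp subee.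
- exact: continuous_subspaceT.
- split.
  + by move=> t _; have [] := dF t.
  + by apply: cvg_at_right_filter; exact: cF.
  + by apply: cvg_at_left_filter; exact: cF.
- by move=> t _; rewrite derive1E; have [_] := dF t.
Qed.

Lemma continuous_line (g : T2 -> R) (x v : T2) : continuous g ->
  continuous (fun s : R => g (x + s *: v)).
Proof.
move=> cg s; apply: (@continuous_comp _ _ _ (fun s : R => x + s *: v) g); last exact: cg.
apply: cvgD; first exact: cvg_cst.
by apply: cvgZr_tmp; exact: cvg_id.
Qed.

(** The fundamental theorem of calculus makes the integral vanish on each line in direction [j], and
    Fubini concludes. Differentiability is asked along these lines only, so that integration by
    parts needs just the product rule in one variable. *)
Lemma torus_int_line_derive g G j : torus_periodic g -> continuous G ->
  bdd_meas G ->
  (forall (x : T2) (t : R),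
    is_derive t 1 (fun s : R => g (x + s *: e_ j)) (G (x + t *: e_ j))) ->
  torus_int G = 0.
Proof.
move=> pg cG bG; elim/ord2P : j => dG.
  apply: torus_int_eq0_fst => // y.
  have E x : G (x, y) = G ((0, y) + x *: e_ ord0).
    by congr G; rewrite torus_basis0; congr (_, _); rewrite /= ?scaler0 ?addr0 // add0r [_ *: 1]mulr1.
  under eq_integral do rewrite E.
  apply: (@FTC_periodic (fun s : R => g ((0, y) + s *: e_ ord0))
    (fun s : R => G ((0, y) + s *: e_ ord0))).
  - exact: (@continuous_line _ (0, y) (e_ ord0) cG).
  - by rewrite scale0r addr0 pg.
apply: torus_int_eq0_snd => // x.
have E y : G (x, y) = G ((x, 0) + y *: e_ ord_max).
  by congr G; rewrite torus_basis1; congr (_, _); rewrite /= ?scaler0 ?addr0 // add0r [_ *: 1]mulr1.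
under eq_integral do rewrite E.
apply: (@FTC_periodic (fun s : R => g ((x, 0) + s *: e_ ord_max))
  (fun s : R => G ((x, 0) + s *: e_ ord_max))).
- exact: (@continuous_line _ (x, 0) (e_ ord_max) cG).
- by rewrite scale0r addr0 pg.
Qed.

Lemma torus_int_derive g j : test g -> torus_int ('D_(e_ j) g) = 0.
Proof.
move=> tg; have [sg pg] := tg; have tD := test_derive (e_ j) tg.
apply: (@torus_int_line_derive g _ j).
- exact: pg.
- exact: (smooth_continuous (proj1 tD)).
- exact: test_bdd_meas.
- by move=> x t; exact: smooth_is_derive.
Qed.

Lemma torus_int_by_parts f g j : test f -> test g ->
  torus_int (fun x => 'D_(e_ j) f x * g x) =
  - torus_int (fun x => f x * 'D_(e_ j) g x).
Proof.
move=> tf tg; have [sf pf] := tf; have [sg pg] := tg.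
have tDf := test_derive (e_ j) tf; have tDg := test_derive (e_ j) tg.
have b1 : bdd_meas (fun x => 'D_(e_ j) f x * g x).
  by apply: bdd_measM; apply: test_bdd_meas.
have b2 : bdd_meas (fun x => f x * 'D_(e_ j) g x).
  by apply: bdd_measM; apply: test_bdd_meas.
apply/eqP; rewrite -addr_eq0 -torus_intD //; apply/eqP.
apply: (@torus_int_line_derive (fun x => f x * g x) _ j).
- by move=> i x; rewrite pf pg.
- move=> x; apply: cvgD; apply: cvgM.
  + exact: (smooth_continuous (proj1 tDf)).
  + exact: (smooth_continuous sg).
  + exact: (smooth_continuous sf).
  + exact: (smooth_continuous (proj1 tDg)).
- exact: bdd_measD.
- move=> x t; have df := smooth_is_derive x (e_ j) t sf.
  have dg := smooth_is_derive x (e_ j) t sg.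
  have [d1 d2] := is_deriveM df dg; split; first exact: d1.
  by rewrite d2 /= addrC /GRing.scale /= [X in X + _]mulrC.
Qed.

Definition cosn n (x : T2) : R := cos (phase n x).
Definition sinn n (x : T2) : R := sin (phase n x).

Lemma phaseD n (x y : T2) : phase n (x + y) = phase n x + phase n y.
Proof. by rewrite /phase /=; ring. Qed.
Lemma phaseZ n (x : T2) (c : R) : phase n (c *: x) = c * phase n x.
Proof. by rewrite /phase /= /GRing.scale /=; ring. Qed.

Lemma phase_differentiable n (x : T2) : differentiable (phase n) x.
Proof.
have -> : phase n = n.1%:~R *: (@fst R R) + n.2%:~R *: (@snd R R) by [].
apply: differentiableD; apply: differentiableZ.
  by apply: (linear_differentiable (f := @fst R R)) => y; exact: cvg_fst.
by apply: (linear_differentiable (f := @snd R R)) => y; exact: cvg_snd.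
Qed.

Lemma is_derive_affine (a b t : R) : is_derive t 1 (fun s : R => a + s * b) b.
Proof.
have [d1 d2] := is_deriveD (is_derive_cst a t (1 : R))
  (is_deriveM (is_derive_id t (1 : R)) (is_derive_cst b t (1 : R))).
split; first exact: d1.
by rewrite d2 add0r scaler0 add0r; exact: mulr1.
Qed.

Lemma derive_phase (F : R -> R) (a : R) n (v x : T2) :
  is_derive (phase n x) 1 F a ->
  'D_v (F \o phase n) x = a * phase n v.
Proof.
move=> dF; have := derive_line (F \o phase n) x v 0.
rewrite scale0r addr0 => <-.
rewrite (_ : (fun s : R => _) = F \o (fun s => phase n x + s * phase n v)); last first.
  by apply/funext => s; rewrite /= phaseD phaseZ.
have dA := is_derive_affine (phase n x) (phase n v) 0.
have dF' : is_derive (phase n x + 0 * phase n v) 1 F a by rewrite mul0r addr0.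
by have [_ ->] := @is_derive1_comp R F (fun s : R => phase n x + s * phase n v) 0 a (phase n v) dF' dA.
Qed.

Lemma derive_cosn n (v x : T2) : 'D_v (cosn n) x = - phase n v * sinn n x.
Proof.
rewrite (derive_phase v (is_derive_cos (phase n x))).
by rewrite mulNr mulNr mulrC.
Qed.

Lemma derive_sinn n (v x : T2) : 'D_v (sinn n) x = phase n v * cosn n x.
Proof.
by rewrite (derive_phase v (is_derive_sin (phase n x))) mulrC.
Qed.

Lemma cosn_differentiable n (x : T2) : differentiable (cosn n) x.
Proof.
apply: (@differentiable_comp _ _ _ _ (phase n) cos); first exact: phase_differentiable.
by apply/derivable1_diffP; have [] := is_derive_cos (phase n x).
Qed.

Lemma sinn_differentiable n (x : T2) : differentiable (sinn n) x.
Proof.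
apply: (@differentiable_comp _ _ _ _ (phase n) sin); first exact: phase_differentiable.
by apply/derivable1_diffP; have [] := is_derive_sin (phase n x).
Qed.

(** The span of [cosn n] and [sinn n] is stable under every directional derivative, which reduces
    smoothness to differentiability. *)
Lemma trig_iter_derive n (a b : R) s : exists a' b' : R,
  iter_derive s (fun x => a * cosn n x + b * sinn n x) =
  (fun x => a' * cosn n x + b' * sinn n x).
Proof.
elim: s => [|v s [a' [b' /= ->]]]; first by exists a, b.
exists (b' * phase n v), (- (a' * phase n v)); apply/funext => x.
rewrite (_ : (fun y => _) = a' *: cosn n + b' *: sinn n) //.
have dc : derivable (cosn n) x v by exact/diff_derivable/cosn_differentiable.
have ds : derivable (sinn n) x v by exact/diff_derivable/sinn_differentiable.
rewrite deriveD; [|exact: derivableZ|exact: derivableZ].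
rewrite !deriveZ // derive_cosn derive_sinn /GRing.scale /=; ring.
Qed.

Lemma smooth_trig n (a b : R) : smooth (fun x => a * cosn n x + b * sinn n x).
Proof.
move=> s x; have [a' [b' ->]] := trig_iter_derive n a b s.
have H : differentiable (a' *: cosn n + b' *: sinn n) x.
  by apply: differentiableD; apply: differentiableZ;
    [exact: cosn_differentiable|exact: sinn_differentiable].
exact: H.
Qed.

Lemma phase_basis n j : phase n (e_ j) = (if j == ord0 then n.1 else n.2)%:~R.
Proof. by elim/ord2P: j; rewrite /phase /=; ring. Qed.

Lemma cos_sin_int (a : R) (m : int) :
  cos (a + 2 * pi * m%:~R) = cos a /\ sin (a + 2 * pi * m%:~R) = sin a.
Proof.
have nat_case (b : R) (k : nat) :
    cos (b + 2 * pi * k%:R) = cos b /\ sin (b + 2 * pi * k%:R) = sin b.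
  have -> : 2 * pi * k%:R = (pi *+ 2) *+ k :> R by rewrite mulr_natr mulr_natl.
  by rewrite !periodicn //; [exact: sinD2pi|exact: cosD2pi].
case: m => k; first exact: nat_case.
have := nat_case (a + 2 * pi * (Negz k)%:~R) k.+1.
rewrite (_ : a + _ + _ = a); first by move=> [-> ->].
by rewrite NegzE mulrNz; ring.
Qed.

Lemma test_cosn n : test (cosn n).
Proof.
split.
  have := smooth_trig n 1 0; congr smooth; apply/funext => x.
  by rewrite mul1r mul0r addr0.
by move=> j x; rewrite /cosn phaseD phaseZ phase_basis; case: (cos_sin_int (phase n x) (if j == ord0 then n.1 else n.2)).
Qed.

Lemma test_sinn n : test (sinn n).
Proof.
split.
  have := smooth_trig n 0 1; congr smooth; apply/funext => x.
  by rewrite mul1r mul0r add0r.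
by move=> j x; rewrite /sinn phaseD phaseZ phase_basis; case: (cos_sin_int (phase n x) (if j == ord0 then n.1 else n.2)).
Qed.

End TorusCalculus.

(** * Fourier series of test functions *)

Section FourierCoefficients.
Context {R : realType}.
Local Notation T2 := (R * R)%type.
Local Notation e_ := (@torus_basis R).
Local Notation test := (@torus_test R).
Local Notation A := (@cell_area R).
Implicit Types (f g h : T2 -> R) (j : 'I_2) (n m : Z2) (c : R[i]).

Definition ec m (x : T2) : R[i] := Complex (cosn m x) (sinn m x).

Lemma phase_add m n (x : T2) : phase (m + n) x = phase m x + phase n x.
Proof. by rewrite /phase /= !mulrzDr; ring. Qed.
Lemma phase_opp m (x : T2) : phase (- m) x = - phase m x.
Proof. by rewrite /phase /= !mulrNz; ring. Qed.
Lemma cosn_opp m (x : T2) : cosn (- m) x = cosn m x.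
Proof. by rewrite /cosn phase_opp cosN. Qed.
Lemma sinn_opp m (x : T2) : sinn (- m) x = - sinn m x.
Proof. by rewrite /sinn phase_opp sinN. Qed.
Lemma cosn_add m n (x : T2) :
  cosn (m + n) x = cosn m x * cosn n x - sinn m x * sinn n x.
Proof. by rewrite /cosn phase_add cosD. Qed.
Lemma sinn_add m n (x : T2) :
  sinn (m + n) x = sinn m x * cosn n x + cosn m x * sinn n x.
Proof. by rewrite /sinn phase_add sinD. Qed.

Lemma ec_add m n (x : T2) : ec (m + n) x = ec m x * ec n x.
Proof. by apply: complex_ext; rewrite !cE /= ?cosn_add ?sinn_add //; ring. Qed.
Lemma ec_opp m (x : T2) : ec (- m) x = conjc (ec m x).
Proof. by rewrite /ec /= cosn_opp sinn_opp. Qed.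

Lemma nsq_ec m (x : T2) : nsq (ec m x) = 1.
Proof. by rewrite /nsq /= /cosn /sinn cos2Dsin2. Qed.
Lemma normc_ec m (x : T2) : normc (ec m x) = 1.
Proof. by rewrite normcE nsq_ec sqrtr1. Qed.

Lemma normr_cosn_le m (x : T2) : `|cosn m x| <= 1.
Proof. by rewrite -(normc_ec m x); exact: (normr_Re_le (ec m x)). Qed.
Lemma normr_sinn_le m (x : T2) : `|sinn m x| <= 1.
Proof. by rewrite -(normc_ec m x); exact: (normr_Im_le (ec m x)). Qed.

Lemma bdd_cosn m : bdd_meas (@cosn R m).
Proof. exact/test_bdd_meas/test_cosn. Qed.
Lemma bdd_sinn m : bdd_meas (@sinn R m).
Proof. exact/test_bdd_meas/test_sinn. Qed.

(** For [m != 0] some component [m_j] is non-zero, and [m_j] times the cosine is a derivative of the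
    sine, so its integral vanishes. *)
Lemma torus_int_cosn m : torus_int (@cosn R m) = if m == 0 then A else 0.
Proof.
case: eqP => [->|/eqP m0].
  rewrite -[RHS]mul1r -torus_int_cst; congr torus_int; apply/funext => x.
  by rewrite /cosn /phase /= !mul0r addr0 cos0.
have [j mj] : exists j, phase m (e_ j) != 0.
  case: m m0 => a b; rewrite xpair_eqE negb_and => /orP[a0|b0].
    by exists ord0; rewrite phase_basis /= intr_eq0.
  by exists ord_max; rewrite phase_basis /= intr_eq0.
have : torus_int (fun x : T2 => phase m (e_ j) * cosn m x) = 0.
  rewrite -[RHS](torus_int_derive j (test_sinn m)).
  by congr torus_int; apply/funext => x; rewrite derive_sinn.
rewrite torus_intZ; last exact: bdd_cosn.
by move/eqP; rewrite mulf_eq0 (negPf mj) /= => /eqP.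
Qed.

Lemma torus_int_sinn m : torus_int (@sinn R m) = 0.
Proof.
have [->|m0] := eqVneq m 0.
  rewrite -[RHS](mul0r A) -torus_int_cst; congr torus_int; apply/funext => x.
  by rewrite /sinn /phase /= !mul0r addr0 sin0.
have [j mj] : exists j, phase m (e_ j) != 0.
  case: m m0 => a b; rewrite xpair_eqE negb_and => /orP[a0|b0].
    by exists ord0; rewrite phase_basis /= intr_eq0.
  by exists ord_max; rewrite phase_basis /= intr_eq0.
have : torus_int (fun x : T2 => - phase m (e_ j) * sinn m x) = 0.
  rewrite -[RHS](torus_int_derive j (test_cosn m)).
  by congr torus_int; apply/funext => x; rewrite derive_cosn.
rewrite torus_intZ; last exact: bdd_sinn.
by move/eqP; rewrite mulf_eq0 oppr_eq0 (negPf mj) /= => /eqP.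
Qed.

(** The integral of [g e^{-in.x}], without the factor [(2 pi)^-2] of [fourier_coeff]; hence the
    factors [A] and [A^-1] in what follows. [dist_fourier] is normalised in the same way. *)
Definition fourier n g : R[i] :=
  Complex (torus_int (fun x => g x * cosn n x))
          (- torus_int (fun x => g x * sinn n x)).

Lemma fourierD n f g : bdd_meas f -> bdd_meas g ->
  fourier n (fun x => f x + g x) = fourier n f + fourier n g.
Proof.
move=> bf bg; apply: complex_ext; rewrite !cE /=.
  rewrite -torus_intD; [|exact/bdd_measM/bdd_cosn|exact/bdd_measM/bdd_cosn].
  by congr torus_int; apply/funext => x; rewrite mulrDl.
rewrite -opprD -torus_intD; [|exact/bdd_measM/bdd_sinn|exact/bdd_measM/bdd_sinn].
by congr (- torus_int _); apply/funext => x; rewrite mulrDl.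
Qed.

Lemma fourierZ n (a : R) g : bdd_meas g ->
  fourier n (fun x => a * g x) = (a%:C)%C * fourier n g.
Proof.
move=> bg; apply: complex_ext; rewrite !cE /= !mul0r ?subr0 ?addr0.
  rewrite -torus_intZ; last exact/bdd_measM/bdd_cosn.
  by congr torus_int; apply/funext => x; rewrite mulrA.
rewrite mulrN -torus_intZ; last exact/bdd_measM/bdd_sinn.
by congr (- torus_int _); apply/funext => x; rewrite mulrA.
Qed.

Lemma fourierB n f g : bdd_meas f -> bdd_meas g ->
  fourier n (fun x => f x - g x) = fourier n f - fourier n g.
Proof.
move=> bf bg; have -> : (fun x => f x - g x) = (fun x => f x + -1 * g x).
  by apply/funext => x; rewrite mulN1r.
rewrite fourierD ?fourierZ //; last exact: bdd_measZ.
by apply: complex_ext; rewrite !cE /=; ring.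
Qed.

Lemma fourier_cst0 n : fourier n (fun=> 0) = 0.
Proof.
rewrite -[LHS]/(fourier n (fun=> 0)) (_ : (fun=> 0) = (fun x : T2 => 0 * 1)).
  by rewrite fourierZ ?mul0r //; exact: bdd_meas_cst.
by apply/funext => x; rewrite mul0r.
Qed.

Lemma fourier_sum n (I : Type) (s : seq I) (F : I -> T2 -> R) :
  (forall i, bdd_meas (F i)) ->
  fourier n (fun x => \sum_(i <- s) F i x) = \sum_(i <- s) fourier n (F i).
Proof.
move=> bF; elim: s => [|i s IH].
  by under [X in fourier n X]eq_fun do rewrite big_nil; rewrite fourier_cst0 big_nil.
under [X in fourier n X]eq_fun do rewrite big_cons.
by rewrite fourierD ?IH ?big_cons //; exact: bdd_meas_sum.
Qed.

Lemma normc_fourier_le n g (M : R) : bdd_meas g -> (forall x, `|g x| <= M) ->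
  normc (fourier n g) <= 2 * (M * A).
Proof.
move=> bg gM; have M0 : 0 <= M := le_trans (normr_ge0 _) (gM 0).
apply: (le_trans (normc_le_ReIm _)); rewrite mulr2n mulrDl mul1r /= normrN.
apply: lerD; apply: normr_torus_int_le.
- exact/bdd_measM/bdd_cosn.
- by move=> x; rewrite normrM -[M]mulr1 ler_pM // normr_cosn_le.
- exact/bdd_measM/bdd_sinn.
- by move=> x; rewrite normrM -[M]mulr1 ler_pM // normr_sinn_le.
Qed.

Definition trig c m (x : T2) : R := Re (c * ec m x).

Lemma trigE c m x : trig c m x = Re c * cosn m x - Im c * sinn m x.
Proof. by rewrite /trig !cE. Qed.

Lemma test_trig c m : test (trig c m).
Proof.
have -> : trig c m = (fun x => Re c * cosn m x + (- Im c * sinn m x + 0)).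
  by apply/funext => x; rewrite trigE addr0 mulNr.
apply: test_lin; first exact: test_cosn.
by apply: test_lin; [exact: test_sinn|exact: test_cst].
Qed.

Lemma bdd_trig c m : bdd_meas (trig c m).
Proof. exact/test_bdd_meas/test_trig. Qed.

Lemma normr_trig_le c m x : `|trig c m x| <= normc c.
Proof.
by apply: (le_trans (normr_Re_le _)); rewrite ComplexField.Normc.normcM normc_ec mulr1.
Qed.

Lemma torus_int_cosn2 m n (a b : R) :
  torus_int (fun x => a * cosn m x + b * cosn n x) =
  a * torus_int (@cosn R m) + b * torus_int (@cosn R n).
Proof.
by rewrite torus_intD ?torus_intZ //; try exact: bdd_cosn; apply: bdd_measZ; exact: bdd_cosn.
Qed.
Lemma torus_int_sinn2 m n (a b : R) :
  torus_int (fun x => a * sinn m x + b * sinn n x) = 0.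
Proof.
rewrite torus_intD ?torus_intZ ?torus_int_sinn ?mulr0 ?addr0 //;
 try exact: bdd_sinn; apply: bdd_measZ; exact: bdd_sinn.
Qed.

(** The real part of [c e^{im.x}] is half the sum of a mode at [m] with coefficient [c] and one at
    [- m] with the conjugate coefficient. *)
Lemma fourier_trig n c m : fourier n (trig c m) =
  ((A / 2)%:C)%C * (c * (m == n)%:R + conjc c * (m == - n)%:R).
Proof.
have b1 (a : R) k : bdd_meas (fun x => a * cosn k x) by apply: bdd_measZ; exact: bdd_cosn.
have b2 (a : R) k : bdd_meas (fun x => a * sinn k x) by apply: bdd_measZ; exact: bdd_sinn.
have mn : (m - n == 0) = (m == n) by rewrite subr_eq0.
have pn : (m + n == 0) = (m == - n) by rewrite addr_eq0.
have b3 (a b : R) k l : bdd_meas (fun x => a * cosn k x + b * cosn l x) by exact: bdd_measD.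
have b4 (a b : R) k l : bdd_meas (fun x => a * sinn k x + b * sinn l x) by exact: bdd_measD.
apply: complex_ext; rewrite !cE /=.
  transitivity (torus_int (fun x =>
    (Re c / 2 * cosn (m - n) x + Re c / 2 * cosn (m + n) x) +
    (- (Im c / 2) * sinn (m - n) x + - (Im c / 2) * sinn (m + n) x))).
    congr torus_int; apply/funext => x; rewrite trigE.
    by rewrite !cosn_add !sinn_add cosn_opp sinn_opp; field.
  rewrite torus_intD // torus_int_cosn2 torus_int_sinn2 !torus_int_cosn mn pn.
  by case: (m == n); case: (m == - n); rewrite /=; field.
transitivity (- torus_int (fun x =>
    (- (Im c / 2) * cosn (m - n) x + (Im c / 2) * cosn (m + n) x) +
    ((Re c / 2) * sinn (m + n) x + - (Re c / 2) * sinn (m - n) x))).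
  congr (- torus_int _); apply/funext => x; rewrite trigE.
  by rewrite !cosn_add !sinn_add cosn_opp sinn_opp; field.
rewrite torus_intD // torus_int_cosn2 torus_int_sinn2 !torus_int_cosn mn pn.
by case: (m == n); case: (m == - n); rewrite /=; field.
Qed.

Lemma fourier_derive n g j : test g ->
  fourier n ('D_(e_ j) g) = 'i%C * ((phase n (e_ j))%:C)%C * fourier n g.
Proof.
move=> tg; have bg := test_bdd_meas tg.
have E1 : torus_int (fun x => 'D_(e_ j) g x * cosn n x) =
    phase n (e_ j) * torus_int (fun x => g x * sinn n x).
  rewrite torus_int_by_parts //; last exact: test_cosn.
  rewrite -torus_intZ; last exact/bdd_measM/bdd_sinn.
  rewrite -torus_intN.
    by congr torus_int; apply/funext => x; rewrite derive_cosn; ring.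
  apply: bdd_measM => //; apply: test_bdd_meas; apply: test_derive; exact: test_cosn.
have E2 : torus_int (fun x => 'D_(e_ j) g x * sinn n x) =
    - (phase n (e_ j) * torus_int (fun x => g x * cosn n x)).
  rewrite torus_int_by_parts //; last exact: test_sinn.
  rewrite -torus_intZ; last exact/bdd_measM/bdd_cosn.
  congr (- torus_int _); apply/funext => x; rewrite derive_sinn; ring.
by apply: complex_ext; rewrite !cE /= ?E1 ?E2; ring.
Qed.

Definition decay n : R := ((1 + n.1%:~R ^+ 2) * (1 + n.2%:~R ^+ 2))^-1.

Lemma decay_ge0 n : 0 <= decay n.
Proof. by rewrite invr_ge0 mulr_ge0 // addr_ge0 // sqr_ge0. Qed.

Lemma normc_alt4_le (z a b c : R[i]) :
  normc (z - a - b + c) <= normc z + normc a + normc b + normc c.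
Proof.
apply: (le_trans (le_normcD _ _)); rewrite lerD2r.
apply: (le_trans (le_normcD _ _)); rewrite normcN lerD2r.
by apply: (le_trans (le_normcD _ _)); rewrite normcN.
Qed.

(** Integration by parts with [(1 - d_1^2) (1 - d_2^2)], whose symbol is the inverse of [decay n]:
    four terms of order at most 4, each bounded by [2 * (M * A)]. *)
Lemma fourier_decay n g (M : R) : test g ->
  derivatives_le (range e_) 4 M g -> normc (fourier n g) <= 8 * A * M * decay n.
Proof.
move=> tg gM.
have dl s : (size s <= 4)%N -> all (fun v => `[< range e_ v >]) s ->
    test (iter_derive s g) /\ normc (fourier n (iter_derive s g)) <= 2 * (M * A).
  move=> s4 /allP sE.
  have ts : test (iter_derive s g).
    by elim: s {s4 sE} => //= v s IH; exact: test_derive.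
  split=> //; apply: normc_fourier_le; first exact: test_bdd_meas.
  by apply: gM => // v /sE /asboolP.
have r j : `[< range e_ (e_ j) >] by apply/asboolP; exists j.
have [t0 h0] := dl [::] isT isT.
have [t1 h1] := dl [:: e_ ord0; e_ ord0] isT (ltac:(by rewrite /= !r)).
have [t2 h2] := dl [:: e_ ord_max; e_ ord_max] isT (ltac:(by rewrite /= !r)).
have [t3 h3] := dl [:: e_ ord0; e_ ord0; e_ ord_max; e_ ord_max] isT (ltac:(by rewrite /= !r)).
have D2 h j : test h -> fourier n ('D_(e_ j) ('D_(e_ j) h)) =
    ((- (phase n (e_ j)) ^+ 2)%:C)%C * fourier n h.
  move=> th; rewrite !fourier_derive //; last exact: test_derive.
  by apply: complex_ext; rewrite !cE /=; ring.
rewrite /decay ler_pdivlMr; last by rewrite mulr_gt0 // ltr_pwDl // sqr_ge0.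
set P := (1 + _) * _.
have P0 : 0 <= P by rewrite mulr_ge0 // addr_ge0 // sqr_ge0.
have -> : normc (fourier n g) * P = normc (fourier n g - fourier n (iter_derive [:: e_ ord0; e_ ord0] g)
   - fourier n (iter_derive [:: e_ ord_max; e_ ord_max] g)
   + fourier n (iter_derive [:: e_ ord0; e_ ord0; e_ ord_max; e_ ord_max] g)).
  rewrite -[P in LHS](ger0_norm P0) -normc_real -ComplexField.Normc.normcM.
  have F1 : fourier n (iter_derive [:: e_ ord0; e_ ord0] g) = _ := D2 g ord0 tg.
  have F2 : fourier n (iter_derive [:: e_ ord_max; e_ ord_max] g) = _ := D2 g ord_max tg.
  have F3 : fourier n (iter_derive [:: e_ ord0; e_ ord0; e_ ord_max; e_ ord_max] g) = _ :=
    D2 _ ord0 t2.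
  have PE : P = (1 + phase n (e_ ord0) ^+ 2) * (1 + phase n (e_ ord_max) ^+ 2).
    by rewrite /P !phase_basis.
  have alg (z a b c : R[i]) (p q : R) : a = ((- p ^+ 2)%:C)%C * z ->
      b = ((- q ^+ 2)%:C)%C * z -> c = ((- p ^+ 2)%:C)%C * b ->
      z * (((1 + p ^+ 2) * (1 + q ^+ 2))%:C)%C = z - a - b + c.
    by move=> -> -> ->; apply: complex_ext; rewrite !cE /=; ring.
  by rewrite PE; congr normc; exact: alg F1 F2 F3.
have h0' : normc (fourier n g) <= 2 * (M * A) := h0.
apply: (le_trans (normc_alt4_le _ _ _ _)).
apply: (le_trans (lerD (lerD (lerD h0' h1) h2) h3)).
by rewrite le_eqVlt; apply/orP; left; apply/eqP; ring.
Qed.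

End FourierCoefficients.

(** * Sums over boxes of the lattice *)

Section Boxes.
Context {R : realType}.

Definition zrange (K : nat) : seq int :=
  [seq Posz k | k <- iota 0 K.+1] ++ [seq Negz k | k <- iota 0 K].

Definition box (K : nat) : seq Z2 := [seq (i, j) | i <- zrange K, j <- zrange K].

Lemma mem_zrange K (i : int) : (i \in zrange K) = (`|i| <= K)%N.
Proof.
rewrite mem_cat; case: i => k.
  rewrite mem_map; last by move=> ? ? [].
  rewrite mem_iota /= add0n ltnS; case: (leqP k K) => //= _.
  by apply/negP => /mapP[].
rewrite [X in _ || X]mem_map; last by move=> ? ? [].
rewrite mem_iota /= add0n; case: (ltnP k K) => // _; rewrite ?orbT //.
by rewrite orbF; apply/negP => /mapP[].
Qed.

Lemma uniq_zrange K : uniq (zrange K).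
Proof.
rewrite cat_uniq !map_inj_uniq ?iota_uniq ?andbT /=; try by move=> ? ? [].
by apply/hasPn => i /mapP[k _ ->]; apply/negP => /mapP[].
Qed.

Lemma mem_box K (n : Z2) : (n \in box K) = (`|n.1| <= K)%N && (`|n.2| <= K)%N.
Proof.
case: n => i j /=; rewrite -!mem_zrange.
by apply/allpairsP/andP => [[[a b] [/= ? ? [-> ->]]]//|[? ?]]; exists (i, j).
Qed.

Lemma uniq_box K : uniq (box K).
Proof. by apply: allpairs_uniq; rewrite ?uniq_zrange //; case=> ? ? []. Qed.

Lemma box_sub K K' : (K <= K')%N -> {subset box K <= box K'}.
Proof.
by move=> KK n; rewrite !mem_box => /andP[a b]; rewrite !(leq_trans _ KK).
Qed.

Lemma box_exhaust (s : seq Z2) : exists K, {subset s <= box K}.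
Proof.
elim: s => [|n s [K sK]]; first by exists 0%N.
exists (maxn K (maxn `|n.1| `|n.2|)) => m; rewrite inE => /orP[/eqP ->|/sK].
  by rewrite mem_box !leq_max !leqnn !orbT.
by apply: box_sub; rewrite leq_maxl.
Qed.

Lemma ler_sum_subset (T : eqType) (s t : seq T) (w : T -> R) : uniq s ->
  {subset s <= t} -> (forall i, 0 <= w i) ->
  \sum_(i <- s) w i <= \sum_(i <- t) w i.
Proof.
move=> us st w0; elim: s t us st => [|x s IH] t.
  by rewrite big_nil => _ _; exact: sumr_ge0.
move=> /= /andP[xs us] st; have xt : x \in t by apply: st; rewrite mem_head.
rewrite big_cons (big_rem x xt) /= lerD2l; apply: IH => // y ys.
have := st y; rewrite inE ys orbT => /(_ isT) yt.
by rewrite (perm_mem (perm_to_rem xt)) inE in yt; case/predU1P: yt => // yx; rewrite -yx ys in xs.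
Qed.

(** A box whose sum is within [eps] of the supremum leaves at most [eps] to any finite set disjoint
    from it. *)
Lemma box_tail (w : Z2 -> R) (C : R) : (forall n, 0 <= w n) ->
  (forall K, \sum_(n <- box K) w n <= C) -> forall eps, 0 < eps ->
  exists K0, forall s, uniq s -> (forall n, n \in s -> n \notin box K0) ->
  \sum_(n <- s) w n <= eps.
Proof.
move=> w0 wC eps e0; pose S := [set x | exists K, x = \sum_(n <- box K) w n].
have supS : has_sup S.
  by split; [exists (\sum_(n <- box 0) w n); exists 0%N|exists C => _ [K ->]].
have [_ [K0 ->] hK0] := sup_adherent e0 supS.
exists K0 => s us sK0; have [K sK] := box_exhaust (s ++ box K0).
have : \sum_(n <- s ++ box K0) w n <= \sum_(n <- box K) w n.
  apply: ler_sum_subset => //; rewrite cat_uniq us uniq_box andbT.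
  by apply/hasPn => n nK0; apply/negP => /sK0; rewrite nK0.
have : \sum_(n <- box K) w n <= sup S by apply: sup_upper_bound => //; exists K.
have -> : \sum_(n <- s ++ box K0) w n = \sum_(n <- s) w n + \sum_(n <- box K0) w n.
  exact: big_cat.
lra.
Qed.

Lemma sum_box_prod_le (a b : int -> R) (C : R) K :
  (forall i, 0 <= a i) -> (forall i, 0 <= b i) ->
  \sum_(i <- zrange K) a i <= C -> \sum_(i <- zrange K) b i <= C ->
  \sum_(n <- box K) a n.1 * b n.2 <= C * C.
Proof.
move=> a0 b0 aC bC; rewrite /box big_allpairs.
rewrite (eq_bigr (fun i => a i * \sum_(j <- zrange K) b j)); last first.
  by move=> i _; rewrite mulr_sumr.
by rewrite -mulr_suml; apply: ler_pM => //; exact: sumr_ge0.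
Qed.

(** Non-zero integers come in pairs of opposite signs, and the sum over the positive ones
    telescopes. *)
Lemma sum_zrange_telescope (F : nat -> R) (h : nat -> R) K :
  (forall k, F k.+1 <= h k - h k.+1) -> (forall k, 0 <= h k) ->
  \sum_(i <- zrange K) F `|i|%N <= F 0%N + 2 * h 0%N.
Proof.
move=> Fh h0; rewrite /zrange big_cat !big_map /= big_cons -addrA lerD2l.
have tel : \sum_(k <- iota 0 K) F k.+1 <= h 0%N.
  apply: (@le_trans _ _ (h 0%N - h K)); last by rewrite gerBl.
  elim: K => [|K IH]; first by rewrite big_nil subrr.
  rewrite -[K.+1]addn1 iotaD big_cat /= add0n big_seq1 addn1.
  by have := Fh K; lra.
rewrite mulr2n mulrDl mul1r; apply: lerD => //.
by rewrite -[1%N]addn0 iotaDl big_map.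
Qed.

Lemma sum_decay_le K : \sum_(n <- box K) (decay n : R) <= 25.
Proof.
pose F (k : nat) : R := (1 + k%:R ^+ 2)^-1.
have FE (i : int) : F `|i|%N = (1 + i%:~R ^+ 2)^-1.
  by case: i => k; rewrite /F // NegzE abszN mulrNz sqrrN.
have F0 (i : int) : 0 <= F `|i|%N by rewrite invr_ge0 addr_ge0 // sqr_ge0.
have HF : \sum_(i <- zrange K) F `|i|%N <= 5.
  (* [1 / (1 + (k+1)^2)] is at most [2 / (k+1) - 2 / (k+2)], which gives [1 + 2 * 2 = 5] on the line
     and 25 in the plane. *)
  apply: (le_trans (@sum_zrange_telescope F (fun k => 2 / k.+1%:R) K _ _)).
  - move=> k; rewrite /F -subr_ge0 -[k.+2%:R]natr1 -[k.+1%:R]natr1.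
    set x : R := k%:R; have x0 : 0 <= x by rewrite ler0n.
    have -> : 2 / (x + 1) - 2 / (x + 1 + 1) - (1 + (x + 1) ^+ 2)^-1 =
      (x ^+ 2 + x + 2) / ((x + 1) * (x + 1 + 1) * (1 + (x + 1) ^+ 2)).
      by field; rewrite !gt_eqF //; nra.
    by apply: divr_ge0; nra.
  - by move=> k; rewrite divr_ge0.
  - by rewrite /F expr0n /= addr0 !invr1; lra.
have -> : 25 = 5 * 5 :> R by ring.
have := @sum_box_prod_le (fun i => F `|i|%N) (fun i => F `|i|%N) 5 K F0 F0 HF HF.
by congr (_ <= _); apply: eq_bigr => n _; rewrite !FE /decay invfM.
Qed.

End Boxes.

(** * Limits along ultrafilters *)

Section UltrafilterLimits.
Context {R : realType}.
Variable U : set_system nat.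
Hypothesis UU : UltraFilter U.
Implicit Types (a b : nat -> R).

Let UP : ProperFilter U. Proof. exact: ultra_proper. Qed.

(** Compactness of [[- M, M]] provides a cluster point, and an ultrafilter converges to each of its
    cluster points. *)
Lemma ultra_bounded_cvg a (M : R) : (forall N, `|a N| <= M) ->
  exists l : R, a N @[N --> U] --> l.
Proof.
move=> aM; have PF : ProperFilter (a @ U) by exact: fmap_proper_filter.
have : (a @ U) (`[- M, M]%classic : set R).
  by apply: (@filterE _ U _ (a @^-1` _)) => N /=; rewrite in_itv /= -ler_norml.
move=> /(@segment_compact R (- M) M) [p [_ clp]]; exists p => B Bp.
have [//|nB] := in_ultra_setVsetC (a @^-1` B) UU.
have [x [nBx Bx]] := clp (~` B) B nB Bp; by case: (nBx Bx).
Qed.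

Lemma ulim_le a (l c : R) : a N @[N --> U] --> l ->
  (\forall N \near U, a N <= c) -> l <= c.
Proof.
move=> al ac; rewrite leNgt; apply/negP => cl.
have : \forall N \near U, `|l - a N| < l - c.
  by move/cvgrPdist_lt : al; apply; rewrite subr_gt0.
move=> H; have [N [aNc]] := filter_ex (filterI ac H).
by rewrite ltr_distlC => /andP[]; lra.
Qed.

Lemma ulim_ge a (l c : R) : a N @[N --> U] --> l ->
  (\forall N \near U, c <= a N) -> c <= l.
Proof.
move=> al ac; rewrite -lerN2; apply: (@ulim_le (fun N => - a N)).
  exact: cvgN.
by apply: filterS ac => N; rewrite lerN2.
Qed.

Lemma ulim_norm_le a (l c : R) : a N @[N --> U] --> l ->
  (\forall N \near U, `|a N| <= c) -> `|l| <= c.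
Proof.
move=> al ac; rewrite ler_norml; apply/andP; split.
  by apply: ulim_ge al _; apply: filterS ac => N; rewrite ler_norml => /andP[].
by apply: ulim_le al _; apply: filterS ac => N; rewrite ler_norml => /andP[].
Qed.

Lemma ulim_unique a (l l' : R) : a N @[N --> U] --> l -> a N @[N --> U] --> l' ->
  l = l'.
Proof. by move=> al al'; exact: (@cvg_unique _ (@Rhausdorff R) (a @ U)). Qed.

Lemma ulim_cst_eq a (l c : R) : a N @[N --> U] --> l ->
  (\forall N \near U, a N = c) -> l = c.
Proof.
move=> al ac; apply/eqP; rewrite eq_le; apply/andP; split.
  by apply: ulim_le al _; apply: filterS ac => N ->.
by apply: ulim_ge al _; apply: filterS ac => N ->.
Qed.

Lemma ulim_dist a (l : R) : (forall eps, 0 < eps ->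
  \forall N \near U, `|a N - l| <= eps) -> a N @[N --> U] --> l.
Proof.
by move=> H; apply/cvgrPdist_le => e /H; apply: filterS => N; rewrite distrC.
Qed.

Lemma ulim_distP a (l : R) : a N @[N --> U] --> l -> forall eps, 0 < eps ->
  \forall N \near U, `|a N - l| <= eps.
Proof.
by move=> /cvgrPdist_le H e /H; apply: filterS => N; rewrite distrC.
Qed.

Lemma ulim_sum (I : Type) (s : seq I) (F : I -> nat -> R) (l : I -> R) :
  (forall i, F i N @[N --> U] --> l i) ->
  \sum_(i <- s) F i N @[N --> U] --> \sum_(i <- s) l i.
Proof.
move=> Fl; elim: s => [|i s IH].
  by under eq_fun do rewrite big_nil; rewrite big_nil; exact: cvg_cst.
by under eq_fun do rewrite big_cons; rewrite big_cons; exact: cvgD.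
Qed.

End UltrafilterLimits.

Lemma exists_free_ultrafilter : exists U : set_system nat, UltraFilter U /\
  forall P : nat -> Prop, (exists N0, forall N, (N0 <= N)%N -> P N) ->
  \forall N \near U, P N.
Proof.
have [U [UU oU]] := ultraFilterLemma (eventually_filter).
exists U; split => // P [N0 HN]; apply: oU.
by exists N0.
Qed.

(** * Uniqueness of Fourier coefficients *)

Section Uniqueness.
Context {R : realType}.
Local Notation T2 := (R * R)%type.
Local Notation A := (@cell_area R).
Implicit Types (f g h D : T2 -> R) (n m : Z2).

Lemma torus_int_indic_box (p q e : R) : 0 < e -> 0 <= p - e -> p + e <= 2 * pi ->
  0 <= q - e -> q + e <= 2 * pi ->
  torus_int (\1_(`]p - e, p + e[%classic `*` `]q - e, q + e[%classic) : T2 -> R) =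
  (2 * e) ^+ 2.
Proof.
move=> e0 p1 p2 q1 q2; set W := _ `*` _.
have mW : measurable W by apply: measurableX; exact: measurable_itv.
rewrite /torus_int /Rintegral integral_indic //; last exact: measurable_cell.
have -> : W `&` cell = W.
  apply/setIidPl => -[x y] [/=]; rewrite !in_itv /= => /andP[a b] /andP[c d].
  by split; rewrite /= in_itv /=; apply/andP; split; lra.
have mI (z : R) : lebesgue_measure (`]z - e, z + e[%classic : set R) = (2 * e)%:E.
  rewrite lebesgue_measure_itv /= lte_fin (_ : z - e < z + e); last by lra.
  by rewrite -EFinD; congr EFin; ring.
have prodE (X Y : set R) : measurable X -> measurable Y ->
    lebesgue2 (X `*` Y) = (lebesgue_measure X * lebesgue_measure Y)%E.
  by move=> mX mY; apply: product_measure1E.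
have WE : lebesgue2 W = ((2 * e)%:E * (2 * e)%:E)%E.
  by rewrite prodE; [rewrite !mI|exact: measurable_itv|exact: measurable_itv].
transitivity (fine (lebesgue2 W)); first by [].
by rewrite WE -EFinM expr2.
Qed.

(** [D h] is orthogonal to all trigonometric functions. For a given [D] these [h] are stable under
    linear combinations and, by the addition formulas, under multiplication by a mode; so if all
    Fourier coefficients of [D] vanish, they include every power of a trigonometric polynomial. *)
Definition annihilates D h :=
  bdd_meas h /\ forall n, torus_int (fun x => D x * h x * cosn n x) = 0 /\
                          torus_int (fun x => D x * h x * sinn n x) = 0.

Lemma annihilates_lin D h h' (a : R) : bdd_meas D ->
  annihilates D h -> annihilates D h' -> annihilates D (fun x => a * h x + h' x).
Proof.
move=> bD [bh Hh] [bh' Hh']; split; first by apply: bdd_measD => //; exact: bdd_measZ.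
move=> n; have [c s] := Hh n; have [c' s'] := Hh' n.
have b1 (k k' : T2 -> R) : bdd_meas k -> bdd_meas k' -> bdd_meas (fun x => D x * k x * k' x).
  by move=> ? ?; do 2 apply: bdd_measM => //.
have [bc bs] := (@bdd_cosn R n, @bdd_sinn R n).
split.
  transitivity (torus_int (fun x => a * (D x * h x * cosn n x) + D x * h' x * cosn n x)).
    by congr torus_int; apply/funext => x; ring.
  rewrite torus_intD ?torus_intZ ?c ?c' ?mulr0 ?addr0 //; try exact: b1.
  by apply: bdd_measZ; exact: b1.
transitivity (torus_int (fun x => a * (D x * h x * sinn n x) + D x * h' x * sinn n x)).
  by congr torus_int; apply/funext => x; ring.
rewrite torus_intD ?torus_intZ ?s ?s' ?mulr0 ?addr0 //; try exact: b1.
by apply: bdd_measZ; exact: b1.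
Qed.

Lemma annihilates_trig D h m (a b : R) : bdd_meas D -> annihilates D h ->
  annihilates D (fun x => (a * cosn m x + b * sinn m x) * h x).
Proof.
move=> bD [bh Hh].
have btr : bdd_meas (fun x : T2 => a * cosn m x + b * sinn m x).
  by apply: bdd_measD; apply: bdd_measZ; [exact: bdd_cosn|exact: bdd_sinn].
split; first exact: bdd_measM.
have bDh : bdd_meas (fun x => D x * h x) by exact: bdd_measM.
have lin4 (k l : Z2) (c1 c2 c3 c4 : R) :
    torus_int (fun x => (c1 * (D x * h x * cosn k x) + c2 * (D x * h x * cosn l x)) +
      (c3 * (D x * h x * sinn k x) + c4 * (D x * h x * sinn l x))) = 0.
  have bk (i : Z2) (c : R) : bdd_meas (fun x => c * (D x * h x * cosn i x)).
    by apply: bdd_measZ; apply: bdd_measM => //; exact: bdd_cosn.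
  have bs (i : Z2) (c : R) : bdd_meas (fun x => c * (D x * h x * sinn i x)).
    by apply: bdd_measZ; apply: bdd_measM => //; exact: bdd_sinn.
  have b1 i : bdd_meas (fun x => D x * h x * cosn i x) by apply: bdd_measM => //; exact: bdd_cosn.
  have b2 i : bdd_meas (fun x => D x * h x * sinn i x) by apply: bdd_measM => //; exact: bdd_sinn.
  rewrite torus_intD; [|exact: bdd_measD|exact: bdd_measD].
  rewrite !torus_intD // !torus_intZ //.
  have [-> ->] := Hh k; have [-> ->] := Hh l; by rewrite !mulr0 !addr0.
move=> n; split.
  rewrite -[RHS](lin4 (n - m) (n + m) (a / 2) (a / 2) (- (b / 2)) (b / 2)).
  congr torus_int; apply/funext => x.
  by rewrite !cosn_add !sinn_add cosn_opp sinn_opp; field.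
rewrite -[RHS](lin4 (n - m) (n + m) (b / 2) (- (b / 2)) (a / 2) (a / 2)).
congr torus_int; apply/funext => x.
by rewrite !cosn_add !sinn_add cosn_opp sinn_opp; field.
Qed.

Lemma cos_norm (z : R) : cos `|z| = cos z.
Proof. by have [_|_] := ler0P z; rewrite ?cosN. Qed.

(** A cosine of at least [cos eps] means closeness to a multiple of [2 pi], and the position of [p]
    keeps [|y - p|] below [2 pi - eps], which leaves only the multiple 0. *)
Lemma cos_ge_near (y p eps : R) : 0 < eps -> eps < p -> eps < 2 * pi - p ->
  0 < p < 2 * pi -> 0 <= y < 2 * pi -> cos eps <= cos (y - p) -> `|y - p| <= eps.
Proof.
move=> e0 ep e2p /andP[p0 p2] /andP[y0 y2] H.
have pi0 := @pi_gt0 R.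
rewrite leNgt; apply/negP => elt.
have cosabs : cos (y - p) = cos `|y - p| by rewrite cos_norm.
have epi : eps < pi by lra.
have z0 : 0 <= `|y - p| by [].
have z1 : `|y - p| < 2 * pi - eps.
  by rewrite ltr_distlC; apply/andP; split; lra.
have ce : eps \in `[0, pi] by rewrite in_itv /=; apply/andP; split; lra.
have [zpi|zpi] := leP `|y - p| pi.
  have cz : `|y - p| \in `[0, pi] by rewrite in_itv /= z0.
  have : cos `|y - p| < cos eps by rewrite ltr_cos.
  by rewrite -cosabs ltNge H.
have cz : 2 * pi - `|y - p| \in `[0, pi] by rewrite in_itv /=; apply/andP; split; lra.
have : cos (2 * pi - `|y - p|) < cos eps by rewrite ltr_cos //; lra.
have -> : cos (2 * pi - `|y - p|) = cos `|y - p|.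
  rewrite -[in RHS]cosN; have [<- _] := cos_sin_int (- `|y - p|) 1.
  by congr cos; rewrite mulr1 addrC.
by rewrite -cosabs ltNge H.
Qed.

(* Peak kernel: the powers of [T] below are trigonometric polynomials, hence orthogonal to [D],
   and they concentrate at [(p, q)]. *)
Lemma fourier_zero_le0 D : continuous D -> torus_periodic D ->
  (forall n, fourier n D = 0) -> forall p q : R, 0 < p < 2 * pi -> 0 < q < 2 * pi ->
  D (p, q) <= 0.
Proof.
move=> cD pD fD p q /andP[p0 p2] /andP[q0 q2]; rewrite leNgt; apply/negP.
set c := D (p, q) => c0.
have bD : bdd_meas D.
  by split; [exact: continuous_measurable2|exact: periodic_continuous_bounded].
have [M DM] := bD.2.
have M0 : 0 <= M := le_trans (normr_ge0 _) (DM 0).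
have [e e0 De] : exists2 e : R, 0 < e & forall x : T2, `|x.1 - p| < e ->
    `|x.2 - q| < e -> c / 2 <= D x.
  have c20 : 0 < c / 2 by rewrite divr_gt0.
  have := cD (p, q); move/cvgrPdist_lt => /(_ _ c20).
  rewrite -nbhs_ballE => -[e /= e0 He]; exists e => // x x1 x2.
  have bx : ball (p, q) e x by split => /=; rewrite /ball /= distrC.
  have := He _ bx; rewrite /= -/c ltr_distlC => /andP[+ _]; lra.
(* Small enough for [D >= c / 2] on the [eps]-square around [(p, q)], and for the periodic copies of
   the peak to stay away from the cell. *)
pose eps := Num.min (Num.min e (Num.min p (2 * pi - p))) (Num.min q (2 * pi - q)) / 2.
have [e1 e2 e3 e4 e5] : [/\ 0 < eps, eps < e, eps < p /\ eps < 2 * pi - p, eps < q &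
    eps < 2 * pi - q].
  set m := Num.min _ _ in eps *.
  have m0 : 0 < m by rewrite !lt_min e0 p0 q0 !subr_gt0 p2 q2.
  have : m <= m by []; rewrite {2}/m !le_min => /andP[/andP[me /andP[mp mp2]] /andP[mq mq2]].
  by rewrite /eps; split; [lra|lra|split; lra|lra|lra].
have [e3a e3b] := e3.
pose s := eps / 2; pose C := cos s.
have pi0 := @pi_gt0 R.
have s0 : 0 < s by rewrite divr_gt0.
have C1 : C < 1.
  rewrite -cos0 /C ltr_cos // in_itv /=; apply/andP; split; rewrite /s; lra.
have C0 : 0 < C by apply: cos_gt0_pihalf; apply/andP; split; rewrite /s; lra.
have CE : cos eps = 2 * C ^+ 2 - 1.
  have -> : eps = s *+ 2 by rewrite /s mulr2n; lra.
  by rewrite cos_mulr2n mulr_natl.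
(* [2 C^2 = 1 + cos eps]. Hence [T x >= 1] forces the two cosines to add up to at least
   [1 + cos eps], so each is at least [cos eps], and a point [x] of the cell is then within [eps] of
   [(p, q)] in both coordinates. *)
pose Q := 2 + 2 * C ^+ 2.
have Q0 : 0 < Q by rewrite /Q; nra.
pose T (x : T2) := (2 + cos (x.1 - p) + cos (x.2 - q)) / Q.
have T0 x : 0 <= T x.
  rewrite divr_ge0 ?(ltW Q0) //; have := cos_geN1 (x.1 - p); have := cos_geN1 (x.2 - q); lra.
have TE : T = fun x => (cos p / Q * cosn (1, 0) x + sin p / Q * sinn (1, 0) x) +
    ((cos q / Q * cosn (0, 1) x + sin q / Q * sinn (0, 1) x) + 2 / Q).
  apply/funext => x; rewrite /T /cosn /sinn /phase /= !mul1r !mul0r addr0 add0r.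
  by rewrite !cosB; field; rewrite gt_eqF.
have annT k : annihilates D (fun x => T x ^+ k).
  elim: k => [|k IH].
    have -> : (fun x => T x ^+ 0) = (fun=> 1) by apply/funext => x; rewrite expr0.
    split; first exact: bdd_meas_cst.
    move=> n; have := fD n; rewrite /fourier => -[h1 h2]; split.
      by rewrite -[RHS]h1; congr torus_int; apply/funext => x; rewrite mulr1.
    by apply/eqP; rewrite -oppr_eq0 -[X in _ == X]h2; apply/eqP; congr (- torus_int _); apply/funext => x; rewrite mulr1.
  have -> : (fun x => T x ^+ k.+1) = (fun x =>
     1 * ((cos p / Q * cosn (1, 0) x + sin p / Q * sinn (1, 0) x) * T x ^+ k) +
     (1 * ((cos q / Q * cosn (0, 1) x + sin q / Q * sinn (0, 1) x) * T x ^+ k) +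
     (2 / Q * T x ^+ k + (0 * T x ^+ k + 0 * T x ^+ k)))).
    apply/funext => x; rewrite exprS {1}TE; ring.
  apply: annihilates_lin => //; first exact: annihilates_trig.
  apply: annihilates_lin => //; first exact: annihilates_trig.
  apply: annihilates_lin => //; apply: annihilates_lin => //.
  have -> : (fun x => 0 * T x ^+ k) = (fun x => (0 * cosn 0 x + 0 * sinn 0 x) * T x ^+ k).
    by apply/funext => x; ring.
  exact: annihilates_trig.
pose W : set T2 := `]p - s, p + s[%classic `*` `]q - s, q + s[%classic.
(* On [W], of half-side [eps / 2], both cosines are at least [C], so that
   [T >= (2 + 2 C) / Q = 1 + eta]. *)
pose eta := C * (1 - C) / (1 + C ^+ 2).
have eta0 : 0 < eta by rewrite divr_gt0 ?mulr_gt0 ?subr_gt0 //; nra.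
have TW x : W x -> 1 + eta <= T x.
  case: x => x y [/=]; rewrite !in_itv /= => /andP[x1 x2] /andP[y1 y2].
  have cz (z r : R) : r - s < z -> z < r + s -> C <= cos (z - r).
    move=> z1 z2; have zs : `|z - r| <= s.
      by rewrite ler_distlC; apply/andP; split; lra.
    rewrite -(cos_norm (z - r)) /C leNgt ltr_cos -?leNgt // in_itv /=.
      by rewrite (ltW s0) /= /s; lra.
    by rewrite normr_ge0 /= (le_trans zs) // /s; lra.
  have := cz _ _ x1 x2; have := cz _ _ y1 y2; rewrite /T /= => h1 h2.
  rewrite ler_pdivlMr //.
  have -> : (1 + eta) * Q = 2 + 2 * C.
    by rewrite /eta /Q; field; rewrite gt_eqF //; nra.
  lra.
have Tcell x : cell x -> 1 <= T x -> c / 2 <= D x.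
  case: x => x y [/=]; rewrite !in_itv /= => x01 y01.
  rewrite ler_pdivlMr // mul1r /Q => H.
  apply: De => /=.
    apply: (@le_lt_trans _ _ eps) => //; apply: cos_ge_near => //; rewrite ?p0 ?p2 //.
    by rewrite CE; have := cos_le1 (y - q); lra.
  apply: (@le_lt_trans _ _ eps) => //; apply: cos_ge_near => //; rewrite ?q0 ?q2 //.
  by rewrite CE; have := cos_le1 (x - p); lra.
have mW : measurable W by apply: measurableX; exact: measurable_itv.
have bW : bdd_meas (\1_W : T2 -> R).
  split; first exact: measurable_indic.
  by exists 1 => x; rewrite indicE; case: (_ \in _); rewrite ?normr1 ?normr0.
have iW : torus_int (\1_W : T2 -> R) = (2 * s) ^+ 2.
  by apply: torus_int_indic_box => //; rewrite /s; lra.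
(* The vanishing integral of [D * T ^+ k] is bounded below: on [W] the integrand is at least [c / 2]
   times [(1 + eta)^k]; elsewhere it is non-negative where [T >= 1] and at least [- M] where
   [T < 1]. Exponential growth in [k] then gives the contradiction. *)
have key k : c / 2 * (1 + eta) ^+ k * (2 * s) ^+ 2 - M * A <= 0.
  have [bTk annk] := annT k.
  have z0 : torus_int (fun x => D x * T x ^+ k) = 0.
    have [h _] := annk 0; rewrite -[RHS]h; congr torus_int; apply/funext => x.
    by rewrite /cosn /phase /= !mul0r addr0 cos0 mulr1.
  rewrite -[leRHS]z0 -iW -torus_int_cst -torus_intZ // -torus_intB; last 2 first.
  - exact: bdd_measZ.
  - exact: bdd_meas_cst.
  apply: le_torus_int.
  - by apply: bdd_measB; [exact: bdd_measZ|exact: bdd_meas_cst].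
  - exact: bdd_measM.
  move=> x cx; rewrite indicE; case: (boolP (x \in W)) => xW /=.
    move/set_mem : xW => /TW xW; rewrite mulr1.
    have T1 : 1 <= T x by rewrite (le_trans _ xW) // lerDl ltW.
    have DT := Tcell _ cx T1.
    have pk : (1 + eta) ^+ k <= T x ^+ k.
      by rewrite lerXn2r // nnegrE //; rewrite addr_ge0 // ltW.
    have p0k : 0 <= (1 + eta) ^+ k by rewrite exprn_ge0 // addr_ge0 // ltW.
    have c20 : 0 <= c / 2 by rewrite divr_ge0 // ltW.
    have := ler_pM c20 p0k DT pk; lra.
  rewrite mulr0 add0r; have [T1|T1] := leP 1 (T x).
    have DT := Tcell _ cx T1.
    have : 0 <= D x * T x ^+ k.
      by rewrite mulr_ge0 ?exprn_ge0 // (le_trans _ DT) // divr_ge0 // ltW.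
    by lra.
  have := DM x; rewrite ler_norml => /andP[MD _].
  have Tk1 : T x ^+ k <= 1 by rewrite exprn_ile1 // ltW.
  have Tk0 : 0 <= T x ^+ k by rewrite exprn_ge0.
  nra.
have bern k : 1 + k%:R * eta <= (1 + eta) ^+ k.
  elim: k => [|k IH]; first by rewrite mul0r addr0 expr0.
  rewrite exprS -natr1; have k0 : 0 <= k%:R :> R by [].
  apply: (@le_trans _ _ ((1 + eta) * (1 + k%:R * eta))); first nra.
  by rewrite ler_wpM2l // addr_ge0 // ltW.
pose a := c / 2 * (2 * s) ^+ 2.
have a0 : 0 < a by rewrite mulr_gt0 ?divr_gt0 // exprn_gt0 // mulr_gt0.
have A0 := @cell_area_gt0 R.
pose k := (Num.truncn (M * A / (a * eta))).+1.
have kbig : M * A / (a * eta) < k%:R by rewrite truncnS_gt.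
have ae0 : 0 < a * eta by exact: mulr_gt0.
rewrite (ltr_pdivrMr _ _ ae0) in kbig.
have := key k; have -> : c / 2 * (1 + eta) ^+ k * (2 * s) ^+ 2 = a * (1 + eta) ^+ k.
  by rewrite mulrAC.
have := ler_wpM2l (ltW a0) (bern k); rewrite mulrDr mulr1.
rewrite mulrCA; move: (a * (1 + eta) ^+ k) (k%:R * (a * eta)) kbig => u v; lra.
Qed.

(** The peak argument, applied to [D] and to [- D], covers the interior of the cell; the edges are
    reached by continuity. *)
Lemma fourier_unique D : continuous D -> torus_periodic D ->
  (forall n, fourier n D = 0) -> forall x, D x = 0.
Proof.
move=> cD pD fD.
have bD : bdd_meas D.
  by split; [exact: continuous_measurable2|exact: periodic_continuous_bounded].
have int0 (p q : R) : 0 < p < 2 * pi -> 0 < q < 2 * pi -> D (p, q) = 0.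
  move=> p02 q02; apply/eqP; rewrite eq_le fourier_zero_le0 //=.
  rewrite -oppr_le0; apply: (@fourier_zero_le0 (fun x => - D x)) => //.
  - by move=> x; apply: cvgN; exact: cD.
  - by move=> j x; rewrite pD.
  - move=> n; have -> : (fun x => - D x) = (fun x => -1 * D x).
      by apply/funext => x; rewrite mulN1r.
    by rewrite fourierZ // fD mulr0.
move=> x; have [[p q] [p01 q01] /(_ _ _ pD) ->] := reduce_to_cell x.
rewrite /= !in_itv /= in p01 q01.
move: p01 q01 => /andP[p0 p2] /andP[q0 q2].
apply/eqP; rewrite -normr_eq0 eq_le normr_ge0 andbT; apply/ler_addgt0Pl => e e0.
rewrite addr0.
have := cD (p, q); move/cvgrPdist_le => /(_ _ e0).
rewrite -nbhs_ballE => -[r /= r0 Hr].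
pose t := Num.min r (Num.min (2 * pi - p) (2 * pi - q)) / 2.
have [t0 tr tp tq] : [/\ 0 < t, t < r, t < 2 * pi - p & t < 2 * pi - q].
  set m := Num.min _ _ in t *.
  have m0 : 0 < m by rewrite !lt_min r0 !subr_gt0 p2 q2.
  have : m <= m by []; rewrite {2}/m !le_min => /andP[mr /andP[mp mq]].
  by rewrite /t; split; lra.
have bt : ball (p, q) r (p + t, q + t).
  by split; rewrite /ball /= opprD addrA subrr add0r normrN gtr0_norm.
have z : D (p + t, q + t) = 0 by apply: int0; apply/andP; split; lra.
by have := Hr _ bt; rewrite /= z subr0.
Qed.

End Uniqueness.

Lemma continuous_uniform_approx {R : realType} {X : topologicalType} (G : X -> R) :
  (forall eps : R, 0 < eps -> exists h : X -> R, continuous h /\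
     forall x, `|G x - h x| <= eps) -> continuous G.
Proof.
move=> H x; apply/cvgrPdist_le => e e0.
have [h [ch Gh]] := H (e / 3) (divr_gt0 e0 (ltr0n _ 3)).
have := ch x; move/cvgrPdist_le => /(_ (e / 3) (divr_gt0 e0 (ltr0n _ 3))).
apply: filterS => y hxy.
have -> : G x - G y = (G x - h x) + (h x - h y) - (G y - h y) by ring.
apply: (le_trans (ler_normB _ _)); apply: (@le_trans _ _ (e / 3 + e / 3 + e / 3)).
  apply: lerD => //; apply: (le_trans (ler_normD _ _)); apply: lerD => //.
by rewrite le_eqVlt; apply/orP; left; apply/eqP; field.
Qed.

(** * Uniform convergence of truncated Fourier series *)

Section FourierSums.
Context {R : realType}.
Local Notation T2 := (R * R)%type.
Local Notation A := (@cell_area R).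
Local Notation e_ := (@torus_basis R).
Local Notation test := (@torus_test R).
Implicit Types (f g h D : T2 -> R) (n m : Z2) (T : (T2 -> R) -> R).

Lemma fourierN n g : bdd_meas g -> fourier (- n) g = conjc (fourier n g).
Proof.
move=> bg; apply: complex_ext; rewrite !cE /=.
  by congr torus_int; apply/funext => x; rewrite cosn_opp.
congr (- _); rewrite -torus_intN; last exact/bdd_measM/bdd_sinn.
by congr torus_int; apply/funext => x; rewrite sinn_opp mulrN.
Qed.

Lemma sum_delta (s : seq Z2) n (F : Z2 -> R[i]) : uniq s -> n \in s ->
  \sum_(m <- s) F m * (m == n)%:R = F n.
Proof.
move=> us ns; rewrite (bigD1_seq n) //= eqxx mulr1 big1_seq ?addr0 // => m.
by case/andP => /negPf -> _; rewrite mulr0.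
Qed.

Definition fsum g K (x : T2) : R :=
  \sum_(n <- box K) trig ((A^-1%:C)%C * fourier n g) n x.

Lemma box_opp K n : (- n \in box K) = (n \in box K).
Proof. by rewrite !mem_box /= !abszN. Qed.

Lemma fourier_fsum K n g : bdd_meas g -> n \in box K -> fourier n (fsum g K) = fourier n g.
Proof.
move=> bg nK; rewrite fourier_sum; last by move=> m; exact: bdd_trig.
under eq_bigr do rewrite fourier_trig.
have nK' : - n \in box K by rewrite box_opp.
rewrite -mulr_sumr big_split /= (sum_delta (fun m => (A^-1%:C)%C * fourier m g) (uniq_box K) nK).
rewrite (sum_delta (fun m => conjc ((A^-1%:C)%C * fourier m g)) (uniq_box K) nK') fourierN //.
have A0 : A != 0 by rewrite gt_eqF // cell_area_gt0.
by apply: complex_ext; rewrite !cE /=; field.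
Qed.

Lemma test_trig_sum (s : seq Z2) (c : Z2 -> R[i]) :
  test (fun x => \sum_(n <- s) trig (c n) n x).
Proof.
have := @test_sum R Z2 s (fun=> 1) (fun n => trig (c n) n) (fun n => test_trig (c n) n).
by congr test; apply/funext => x; apply: eq_bigr => n _; rewrite mul1r.
Qed.

Lemma test_fsum g K : test (fsum g K).
Proof. exact: test_trig_sum. Qed.

Lemma derivatives_le_ge0 (E : set T2) N (M : R) g :
  derivatives_le E N M g -> 0 <= M.
Proof.
move=> gM; have : `|iter_derive [::] g 0| <= M by apply: gM.
exact: le_trans.
Qed.

Lemma fsum_coef_le n g (M : R) : test g -> derivatives_le (range e_) 4 M g ->
  normc ((A^-1%:C)%C * fourier n g) <= 8 * M * decay n.
Proof.
move=> tg gM; have A0 := @cell_area_gt0 R.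
rewrite ComplexField.Normc.normcM normc_real ger0_norm ?invr_ge0 ?(ltW A0) //.
rewrite mulrC ler_pdivrMr //; apply: (le_trans (fourier_decay n tg gM)).
by rewrite le_eqVlt; apply/orP; left; apply/eqP; ring.
Qed.

Lemma fsum_sub_le K K' g (M : R) x : test g -> derivatives_le (range e_) 4 M g ->
  (K <= K')%N -> `|fsum g K' x - fsum g K x| <=
  8 * M * \sum_(n <- [seq n <- box K' | n \notin box K]) decay n.
Proof.
move=> tg gM KK; rewrite {1}/fsum (bigID (mem (box K))) /=.
have perm : perm_eq [seq n <- box K' | n \in box K] (box K).
  apply: uniq_perm; [exact: filter_uniq (uniq_box K')|exact: uniq_box|].
  move=> n; rewrite mem_filter.
  by case: (boolP (n \in box K)) => // nK; rewrite (box_sub KK nK).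
rewrite -[X in X + _ - _]big_filter (perm_big _ perm).
rewrite addrC addKr -big_filter mulr_sumr.
apply: (le_trans (ler_norm_sum _ _ _)); apply: ler_sum => n _.
exact: le_trans (normr_trig_le _ _ _) (fsum_coef_le n tg gM).
Qed.

(** The partial sums have a limit [G], uniformly by the summability of [decay]; it is continuous
    with the coefficients of [g], hence equal to [g] by [fourier_unique]. The rate depends on [g]
    only through a bound for four derivatives, so it is common to all time slices of a space-time
    test function. *)
Lemma fsum_cvg (eps : R) : 0 < eps -> exists K0, forall K, (K0 <= K)%N ->
  forall g (M : R), test g -> derivatives_le (range e_) 4 M g ->
  forall x, `|g x - fsum g K x| <= eps * M.
Proof.
have tailK (eta : R) : 0 < eta -> exists K0, forall K K', (K0 <= K)%N -> (K <= K')%N ->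
    forall g (M : R) x, test g -> derivatives_le (range e_) 4 M g ->
    `|fsum g K' x - fsum g K x| <= eta * M.
  move=> e0; have e8 : 0 < eta / 8 by rewrite divr_gt0.
  have [K0 HK0] := box_tail (@decay_ge0 R) (@sum_decay_le R) e8.
  exists K0 => K K' K0K KK g M x tg gM; have M0 := derivatives_le_ge0 gM.
  apply: (le_trans (fsum_sub_le x tg gM KK)).
  have : \sum_(n <- [seq n <- box K' | n \notin box K]) (decay n : R) <= eta / 8.
    apply: HK0; first by apply: filter_uniq; exact: uniq_box.
    by move=> n; rewrite mem_filter => /andP[nK _]; apply: contra nK; exact: box_sub.
  move/(ler_wpM2l (mulr_ge0 (ler0n R 8) M0)) => /le_trans; apply.
  by rewrite le_eqVlt; apply/orP; left; apply/eqP; field.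
move=> e0; have [K0 HK0] := tailK eps e0; exists K0 => K K0K g M tg gM x.
have M0 := derivatives_le_ge0 gM; have bg := test_bdd_meas tg.
have [U [UU UN]] := exists_free_ultrafilter.
have fb y N : `|fsum g N y| <= 8 * M * 25.
  apply: (le_trans (ler_norm_sum _ _ _)).
  apply: (@le_trans _ _ (\sum_(n <- box N) 8 * M * decay n)).
    apply: ler_sum => n _.
    exact: le_trans (normr_trig_le _ _ _) (fsum_coef_le n tg gM).
  by rewrite -mulr_sumr ler_wpM2l ?mulr_ge0 // sum_decay_le.
have /choice[G HG] : forall y, exists l : R, fsum g N y @[N --> U] --> l.
  by move=> y; exact: (ultra_bounded_cvg UU (fb y)).
have unif eta : 0 < eta -> exists K1, forall K, (K1 <= K)%N ->
    forall y, `|G y - fsum g K y| <= eta * M.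
  move=> /tailK[K1 HK1]; exists K1 => N K1N y.
  apply: (@ulim_norm_le _ U UU (fun N' => fsum g N' y - fsum g N y)).
    by apply: cvgB; [exact: HG|exact: cvg_cst].
  by apply: UN; exists N => N' NN'; exact: HK1.
have unif' eta : 0 < eta -> exists K1, forall y, `|G y - fsum g K1 y| <= eta.
  move=> eta0; have M1 : 0 < M + 1 by rewrite ltr_wpDl.
  have [K1 HK1] := unif _ (divr_gt0 eta0 M1); exists K1 => y.
  apply: (le_trans (HK1 _ (leqnn _) y)).
  by rewrite mulrAC ler_pdivrMr // ler_wpM2l ?(ltW eta0) // lerDl.
have cG : continuous G.
  apply: continuous_uniform_approx => eta /unif'[K1 HK1]; exists (fsum g K1).
  by split => //; exact: (smooth_continuous (proj1 (test_fsum g K1))).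
have pG : torus_periodic G.
  move=> j y; apply: (ulim_unique UU (HG _)).
  have -> : (fun N => fsum g N (y + (2 * pi) *: e_ j)) = fun N => fsum g N y.
    by apply/funext => N; rewrite (proj2 (test_fsum g N)).
  exact: HG.
have bG : bdd_meas G.
  by split; [exact: continuous_measurable2|exact: periodic_continuous_bounded].
have fourierG n : fourier n (fun y => g y - G y) = 0.
  apply: ComplexField.Normc.eq0_normc; apply/eqP; rewrite eq_le normc_ge0 andbT.
  apply/ler_addgt0Pl => eta eta0; rewrite addr0.
  have A0 := @cell_area_gt0 R.
  have [K1 nK1] : exists K1, n \in box K1.
    by have [K1 H] := box_exhaust [:: n]; exists K1; apply: H; rewrite inE.
  have M1 : 0 < M + 1 by rewrite ltr_wpDl.
  have eA : 0 < eta / (2 * A) by apply: divr_gt0 => //; exact: mulr_gt0.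
  have d0 : 0 < eta / (2 * A) / (M + 1) by exact: divr_gt0.
  have [K2 HK2] := unif _ d0.
  pose N := maxn K1 K2.
  have nN : n \in box N by apply: box_sub nK1; exact: leq_maxl.
  have bN := test_bdd_meas (test_fsum g N).
  rewrite fourierB // -(fourier_fsum bg nN) -fourierB //.
  have GN y : `|fsum g N y - G y| <= eta / (2 * A).
    rewrite distrC; apply: (le_trans (HK2 _ (leq_maxr _ _) y)).
    by rewrite mulrAC ler_pdivrMr // ler_wpM2l ?(ltW eA) // lerDl.
  apply: (le_trans (normc_fourier_le n (bdd_measB bN bG) GN)).
  by rewrite le_eqVlt; apply/orP; left; apply/eqP; field; rewrite gt_eqF.
have gG y : g y = G y.
  apply/eqP; rewrite -subr_eq0; apply/eqP.
  apply: (@fourier_unique R (fun y => g y - G y)) => //.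
    by move=> z; apply: cvgB; [exact: (smooth_continuous (proj1 tg))|exact: cG].
  by move=> j z; rewrite pG (proj2 tg).
rewrite gG; have [K1 HK1] := unif eps e0.
apply: (@ulim_norm_le _ U UU (fun N' => fsum g N' x - fsum g K x)).
  by apply: cvgB; [exact: HG|exact: cvg_cst].
by apply: UN; exists K => N' NN'; exact: HK0.
Qed.

Lemma derive_trig c n j x : 'D_(e_ j) (trig c n) x =
  trig ('i%C * ((phase n (e_ j))%:C)%C * c) n x.
Proof.
have -> : trig c n = (fun x => Re c * cosn n x + (- Im c * sinn n x + 0)).
  by apply/funext => y; rewrite trigE addr0 mulNr.
have tc := proj1 (@test_cosn R n); have ts := proj1 (@test_sinn R n).
have t0 := proj1 (@test_cst R 0).
have := @iter_derive_lin R _ (@cosn R n) (fun x => - Im c * sinn n x + 0) (Re c) [:: e_ j] tc (smooth_lin (- Im c) ts t0).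
move/(congr1 (fun F => F x)) => /= ->.
have := @iter_derive_lin R _ (@sinn R n) (fun=> 0) (- Im c) [:: e_ j] ts t0.
move/(congr1 (fun F => F x)) => /= ->.
rewrite derive_cosn derive_sinn derive_cst trigE !cE /=; ring.
Qed.

Lemma derive_trig_sum (s : seq Z2) (c : Z2 -> R[i]) j x :
  'D_(e_ j) (fun x => \sum_(n <- s) trig (c n) n x) x =
  \sum_(n <- s) trig ('i%C * ((phase n (e_ j))%:C)%C * c n) n x.
Proof.
elim: s => [|n s IH].
  have -> : (fun x => \sum_(n <- [::]) trig (c n) n x) = fun=> 0.
    by apply/funext => y; rewrite big_nil.
  by rewrite derive_cst big_nil.
have -> : (fun x => \sum_(n <- n :: s) trig (c n) n x) =
    (fun x => 1 * trig (c n) n x + \sum_(n <- s) trig (c n) n x).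
  by apply/funext => y; rewrite big_cons mul1r.
have := @iter_derive_lin R _ (trig (c n) n) (fun x => \sum_(n <- s) trig (c n) n x) 1
  [:: e_ j] (proj1 (test_trig (c n) n)) (proj1 (test_trig_sum s c)).
move/(congr1 (fun F => F x)) => /= ->.
by rewrite IH derive_trig big_cons mul1r.
Qed.

Lemma derive_fsum g K j : test g ->
  'D_(e_ j) (fsum g K) = fsum ('D_(e_ j) g) K.
Proof.
move=> tg; apply/funext => x; rewrite derive_trig_sum; apply: eq_bigr => n _.
by rewrite fourier_derive //; congr trig; ring.
Qed.

Lemma test_iter_derive s g : test g -> test (iter_derive s g).
Proof. by move=> tg; elim: s => //= v s IH; exact: test_derive. Qed.

Lemma iter_derive_fsum s g K : test g -> (forall v, v \in s -> range e_ v) ->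
  iter_derive s (fsum g K) = fsum (iter_derive s g) K.
Proof.
move=> tg; elim: s => //= v s IH sE; rewrite IH; last first.
  by move=> w ws; apply: sE; rewrite inE ws orbT.
have [j _ <-] := sE v (mem_head _ _).
by apply: derive_fsum; exact: test_iter_derive.
Qed.

Lemma derivatives_le_iter N (M : R) g s k : derivatives_le (range e_) N M g ->
  (forall v, v \in s -> range e_ v) -> (size s + k <= N)%N ->
  derivatives_le (range e_) k M (iter_derive s g).
Proof.
move=> gM sE sk s' s'k s'E x; rewrite /iter_derive -foldr_cat; apply: gM.
  by rewrite size_cat addnC (leq_trans _ sk) // leq_add2l.
by move=> v; rewrite mem_cat => /orP[/s'E|/sE].
Qed.

(** Truncation commutes with derivatives, so [fsum_cvg] controls [N] derivatives of the remainder at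
    the cost of [N + 4] derivatives of [g]. *)
Lemma dist_fsum_cvg T : torus_distribution T -> exists N, forall eps : R, 0 < eps ->
  exists K0, forall K, (K0 <= K)%N -> forall g (M : R), test g ->
  derivatives_le (range e_) N M g -> `|T g - T (fsum g K)| <= eps * M.
Proof.
move=> [Tlin [N [C HC]]]; exists (N + 4)%N => eps e0.
have C1 : 0 < `|C| + 1 by rewrite ltr_wpDl.
have [K0 HK0] := fsum_cvg (divr_gt0 e0 C1); exists K0 => K KK g M tg gM.
have tf := test_fsum g K; have M0 := derivatives_le_ge0 gM.
have TE : T g - T (fsum g K) = T (fun x => -1 * fsum g K x + g x).
  by rewrite (Tlin (-1) _ _ tf tg) mulN1r addrC.
rewrite TE.
have : derivatives_le (range e_) N (eps / (`|C| + 1) * M) (fun x => -1 * fsum g K x + g x).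
  move=> s sN sE x; rewrite (iter_derive_lin (-1) s (proj1 tf) (proj1 tg)).
  rewrite (iter_derive_fsum K tg sE) mulN1r addrC.
  apply: HK0 => //; first exact: test_iter_derive.
  by apply: (derivatives_le_iter gM sE); rewrite leq_add2r.
move=> dM; have H := HC _ _ (test_lin (-1) tf tg) dM; apply: (le_trans H).
have -> : C * (eps / (`|C| + 1) * M) = C / (`|C| + 1) * (eps * M).
  by field; rewrite gt_eqF.
rewrite ler_piMl //; first by rewrite mulr_ge0 // ltW.
by rewrite ler_pdivrMr // mul1r (le_trans (ler_norm C)) // lerDl.
Qed.

Definition dist_fourier T n : R[i] := Complex (T (cosn n)) (- T (sinn n)).

Lemma dist0 T : linear_on test T -> T (fun=> 0) = 0.
Proof.
move=> Tlin; have t0 := @test_cst R 0.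
transitivity (T (fun x => -1 * 0 + 0)).
  by congr T; apply/funext => x; rewrite mulr0 addr0.
by rewrite (Tlin (-1) _ _ t0 t0) mulN1r addNr.
Qed.

Lemma dist_trig T c n : torus_distribution T -> T (trig c n) = Re c * T (cosn n) - Im c * T (sinn n).
Proof.
move=> [Tlin _]; have tc := @test_cosn R n; have ts := @test_sinn R n.
have t0 := @test_cst R 0.
have -> : trig c n = (fun x => Re c * cosn n x + (- Im c * sinn n x + 0)).
  by apply/funext => y; rewrite trigE addr0 mulNr.
have T0 := dist0 Tlin.
rewrite Tlin //; last exact: test_lin.
by rewrite Tlin // T0 addr0 mulNr.
Qed.

Lemma dist_trig_sum T (s : seq Z2) (c : Z2 -> R[i]) : torus_distribution T ->
  T (fun x => \sum_(n <- s) trig (c n) n x) = \sum_(n <- s) T (trig (c n) n).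
Proof.
move=> TD; have [Tlin _] := TD; elim: s => [|n s IH].
  rewrite big_nil -[RHS](dist0 Tlin).
  by congr T; apply/funext => x; rewrite big_nil.
rewrite big_cons -IH -[T (trig (c n) n)]mul1r -Tlin; last 2 first.
- exact: test_trig.
- exact: test_trig_sum.
by congr T; apply/funext => x; rewrite big_cons mul1r.
Qed.

Lemma dist_fsum T g K : torus_distribution T ->
  T (fsum g K) = A^-1 * \sum_(n <- box K) dotc (dist_fourier T n) (fourier n g).
Proof.
move=> TD; rewrite dist_trig_sum // mulr_sumr; apply: eq_bigr => n _.
by rewrite dist_trig // /dotc !cE /=; ring.
Qed.

Lemma bdd_meas_dist v : bdd_meas v -> torus_distribution (fun g => torus_int (fun x => v x * g x)).
Proof.
move=> bv; split.
  move=> a g h /test_bdd_meas bg /test_bdd_meas bh.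
  rewrite -torus_intZ; last exact: bdd_measM.
  rewrite -torus_intD; last 2 first.
  - by apply: bdd_measZ; exact: bdd_measM.
  - exact: bdd_measM.
  by congr torus_int; apply/funext => x; ring.
have [M vM] := bv.2; have M0 : 0 <= M := le_trans (normr_ge0 _) (vM 0).
exists 0%N, (M * A) => g M' tg gM'.
have gle x : `|g x| <= M' by apply: (gM' [::]).
rewrite -mulrA (mulrC A) mulrA; apply: normr_torus_int_le.
  by apply: bdd_measM => //; exact: test_bdd_meas.
by move=> x; rewrite normrM ler_pM.
Qed.

Lemma dist_fourier_bdd v n : dist_fourier (fun g => torus_int (fun x => v x * g x)) n = fourier n v.
Proof. by []. Qed.

End FourierSums.

(** * Complex limits along an ultrafilter *)

Section ComplexUltralimit.
Context {R : realType}.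
Variable U : set_system nat.
Hypothesis UU : UltraFilter U.
Let UP : ProperFilter U. Proof. exact: ultra_proper. Qed.
Implicit Types (Z W : nat -> R[i]) (z w : R[i]).

(** Convergence measured by the real-valued modulus [normc], in which all estimates on modes are
    stated. *)
Definition ccvg Z z := forall eps : R, 0 < eps ->
  \forall N \near U, normc (Z N - z) <= eps.

Lemma normc_distC (z w : R[i]) : normc (z - w) = normc (w - z).
Proof. by rewrite -normcN opprB. Qed.

Lemma ccvg_ReIm Z (a b : R) : Re (Z N) @[N --> U] --> a ->
  Im (Z N) @[N --> U] --> b -> ccvg Z (Complex a b).
Proof.
move=> Za Zb e e0; have e2 : 0 < e / 2 by rewrite divr_gt0.
apply: filterS (filterI (ulim_distP UU Za e2) (ulim_distP UU Zb e2)) => N [h1 h2]; apply: (le_trans (normc_le_ReIm _)).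
by rewrite !cE /= (_ : e = e / 2 + e / 2) ?lerD //; field.
Qed.

Lemma ccvg_bounded Z (M : R) : (forall N, normc (Z N) <= M) -> exists z, ccvg Z z.
Proof.
move=> ZM.
have [a Za] : exists a : R, Re (Z N) @[N --> U] --> a.
  by apply: (ultra_bounded_cvg UU (M := M)) => N; apply: le_trans (ZM N); exact: normr_Re_le.
have [b Zb] : exists b : R, Im (Z N) @[N --> U] --> b.
  by apply: (ultra_bounded_cvg UU (M := M)) => N; apply: le_trans (ZM N); exact: normr_Im_le.
by exists (Complex a b); exact: ccvg_ReIm.
Qed.

Lemma ccvg_near Z W z : ccvg Z z -> (\forall N \near U, Z N = W N) -> ccvg W z.
Proof.
move=> Zz ZW e /Zz H; apply: filterS (filterI H ZW) => N [+ <-].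
by [].
Qed.

Lemma ccvg_cst z : ccvg (fun=> z) z.
Proof. by move=> e e0; apply: filterE => N; rewrite subrr ComplexField.Normc.normc0 ltW. Qed.

Lemma ccvgD Z W z w : ccvg Z z -> ccvg W w -> ccvg (fun N => Z N + W N) (z + w).
Proof.
move=> Zz Ww e e0; have e2 : 0 < e / 2 by rewrite divr_gt0.
apply: filterS (filterI (Zz _ e2) (Ww _ e2)) => N [h1 h2].
rewrite opprD addrACA (_ : e = e / 2 + e / 2); last by field.
by apply: (le_trans (le_normcD _ _)); exact: lerD.
Qed.

Lemma ccvgM z0 Z z : ccvg Z z -> ccvg (fun N => z0 * Z N) (z0 * z).
Proof.
move=> Zz e e0; have c1 : 0 < normc z0 + 1 by rewrite ltr_wpDl // normc_ge0.
apply: filterS (Zz _ (divr_gt0 e0 c1)) => N h.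
rewrite -mulrBr ComplexField.Normc.normcM.
apply: (le_trans (ler_wpM2l (normc_ge0 _) h)).
by rewrite mulrCA -[leRHS]mulr1 ler_wpM2l ?(ltW e0) // ler_pdivrMr // mul1r lerDl.
Qed.

Lemma ccvg_sum (I : Type) (s : seq I) (F : I -> nat -> R[i]) (l : I -> R[i]) :
  (forall i, ccvg (F i) (l i)) ->
  ccvg (fun N => \sum_(i <- s) F i N) (\sum_(i <- s) l i).
Proof.
move=> Fl; elim: s => [|i s IH].
  by under eq_fun do rewrite big_nil; rewrite big_nil; exact: ccvg_cst.
by under eq_fun do rewrite big_cons; rewrite big_cons; exact: ccvgD.
Qed.

Lemma ccvg_norm_le Z z (c : R) : ccvg Z z ->
  (\forall N \near U, normc (Z N) <= c) -> normc z <= c.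
Proof.
move=> Zz Zc; apply/ler_addgt0Pl => e e0.
have [N [h1 h2]] := filter_ex (filterI (Zz _ e0) Zc).
have -> : z = (Z N) - (Z N - z) by ring.
by apply: (le_trans (le_normcD _ _)); rewrite normcN addrC lerD.
Qed.

Lemma ccvg_unique Z z w : ccvg Z z -> ccvg Z w -> z = w.
Proof.
move=> Zz Zw; apply/eqP; rewrite -subr_eq0; apply/eqP/ComplexField.Normc.eq0_normc.
apply/eqP; rewrite eq_le normc_ge0 andbT.
have : ccvg (fun N => Z N + -1 * Z N) (z + -1 * w) by apply: ccvgD => //; exact: ccvgM.
rewrite mulN1r => H; apply: (ccvg_norm_le H); apply: filterE => N.
by rewrite mulN1r subrr ComplexField.Normc.normc0.
Qed.

End ComplexUltralimit.

(** * Trigonometric velocity fields and their products *)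

Section TrigonometricFields.
Context {R : realType}.
Local Notation T2 := (R * R)%type.
Local Notation A := (@cell_area R).
Implicit Types (L : seq Z2) (c : Z2 -> R[i]) (n : Z2).

Definition perp n (i : 'I_2) : R := if i == ord0 then - n.2%:~R else n.1%:~R.

Lemma perp0E n : perp n ord0 = - n.2%:~R. Proof. by []. Qed.
Lemma perp1E n : perp n ord_max = n.1%:~R. Proof. by []. Qed.

Lemma perpN n i : perp (- n) i = - perp n i.
Proof. by elim/ord2P: i; rewrite ?perp0E ?perp1E /= mulrNz. Qed.

Lemma normr_perp_le n i : `|perp n i| <= freq n.
Proof.
rewrite -sqrtr_sqr ler_wsqrtr // /freq2; elim/ord2P: i.
  by rewrite perp0E sqrrN lerDr sqr_ge0.
by rewrite perp1E lerDl sqr_ge0.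
Qed.

Lemma sum_perp_crs (k n : Z2) : \sum_(j < 2) phase n (torus_basis j) * perp k j = crs k n.
Proof. by rewrite sum_ord2 !phase_basis perp0E perp1E /crs /=; ring. Qed.

Lemma sum_perp_dt (k n : Z2) : \sum_(j < 2) perp n j * perp k j = dt n k.
Proof. by rewrite sum_ord2 !perp0E !perp1E /dt /=; ring. Qed.

Definition tsum L c (x : T2) : R := \sum_(n <- L) trig (c n) n x.

Lemma fourier_tsum L c n : modes L -> (forall n, c (- n) = conjc (c n)) ->
  (n \notin L -> c n = 0) -> fourier n (tsum L c) = (A%:C)%C * c n.
Proof.
move=> [uL _ LN] cH cL; rewrite fourier_sum; last by move=> m; exact: bdd_trig.
under eq_bigr do rewrite fourier_trig.
have LNn : (- n \in L) = (n \in L).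
  by rewrite -(perm_mem LN) mem_map // => ? ? /oppr_inj.
rewrite -mulr_sumr big_split /=.
case: (boolP (n \in L)) => nL.
  rewrite (sum_delta c uL nL) (sum_delta (fun m => conjc (c m)) uL); last by rewrite LNn.
  by rewrite cH; apply: complex_ext; rewrite !cE /=; field.
rewrite cL // mulr0 !big1_seq ?addr0 ?mulr0 // => m /andP[_ mL].
  by case: eqP => [mn|]; rewrite ?mulr0 //; move: mL; rewrite mn LNn (negPf nL).
by case: eqP => [mn|]; rewrite ?mulr0 //; move: mL; rewrite mn (negPf nL).
Qed.

Definition csum L c (x : T2) : R[i] := \sum_(n <- L) c n * ec n x.

Lemma Re_csum L c x : Re (csum L c x) = tsum L c x.
Proof. by rewrite /csum Re_sum. Qed.

Lemma conjc_sum (I : Type) (s : seq I) (P : pred I) (f : I -> R[i]) :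
  conjc (\sum_(i <- s | P i) f i) = \sum_(i <- s | P i) conjc (f i).
Proof.
by apply: complex_ext; rewrite ?cE ?Re_sum ?Im_sum -?sumrN; apply: eq_bigr => i _; rewrite !cE.
Qed.

Lemma Im_csum L c x : modes L -> (forall n, c (- n) = conjc (c n)) ->
  Im (csum L c x) = 0.
Proof.
move=> [_ _ LN] cH; have : conjc (csum L c x) = csum L c x.
  rewrite /csum conjc_sum -[RHS](perm_big _ LN) big_map; apply: eq_bigr => n _.
  by rewrite cH ec_opp; apply: complex_ext; rewrite !cE; ring.
by move/(congr1 (@complex.Im R)); rewrite cE; lra.
Qed.

(** The complex sums [csum] are real, so the product of the real parts is the real part of the
    product, where modes multiply to [ec (k + l)]. By the symmetry of [L] the modes [n] and [- n]
    contribute equally. *)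
Lemma fourier_tsum_mul L c c' n : modes L -> (forall n, c (- n) = conjc (c n)) ->
  (forall n, c' (- n) = conjc (c' n)) ->
  fourier n (fun x => tsum L c x * tsum L c' x) =
  (A%:C)%C * \sum_(k <- L) \sum_(l <- L | k + l == n) c k * c' l.
Proof.
move=> LM cH cH'; have [uL _ LN] := LM.
transitivity (fourier n (fun x => \sum_(k <- L) \sum_(l <- L) trig (c k * c' l) (k + l) x)).
  congr fourier; apply/funext => x; rewrite -!Re_csum.
  transitivity (Re (csum L c x * csum L c' x)).
    by rewrite [RHS]cE (Im_csum x LM cH) mul0r subr0.
  rewrite /csum mulr_suml Re_sum; apply: eq_bigr => k _.
  rewrite mulr_sumr Re_sum; apply: eq_bigr => l _.
  by rewrite /trig ec_add; congr Re; ring.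
rewrite fourier_sum; last by move=> k; apply: bdd_meas_sum => l; exact: bdd_trig.
transitivity (((A / 2)%:C)%C *
    (\sum_(k <- L) \sum_(l <- L) c k * c' l * (k + l == n)%:R +
     \sum_(k <- L) \sum_(l <- L) conjc (c k * c' l) * (k + l == - n)%:R)).
  rewrite -big_split mulr_sumr; apply: eq_bigr => k _ /=.
  rewrite fourier_sum; last by move=> l; exact: bdd_trig.
  rewrite -big_split mulr_sumr; apply: eq_bigr => l _ /=.
  by rewrite fourier_trig.
pose S := \sum_(k <- L) \sum_(l <- L | k + l == n) c k * c' l.
have E1 : \sum_(k <- L) \sum_(l <- L) c k * c' l * (k + l == n)%:R = S.
  apply: eq_bigr => k _; rewrite [RHS]big_mkcond; apply: eq_bigr => l _.
  by case: (_ == n); rewrite ?mulr1 ?mulr0.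
have E2 : \sum_(k <- L) \sum_(l <- L) conjc (c k * c' l) * (k + l == - n)%:R = S.
  rewrite -[LHS](perm_big _ LN) big_map; apply: eq_bigr => k _.
  rewrite -[LHS](perm_big _ LN) big_map [RHS]big_mkcond; apply: eq_bigr => l _.
  rewrite -opprD eqr_opp cH cH'; case: (_ == n); rewrite ?mulr1 ?mulr0 //.
  by apply: complex_ext; rewrite !cE; ring.
by rewrite E1 E2 -/S; apply: complex_ext; rewrite !cE /=; field.
Qed.

Lemma normr_tsum_perp_le L (x : Z2 -> R[i]) i y :
  `|tsum L (fun n => ((perp n i)%:C)%C * x n) y| <= wiener L x.
Proof.
apply: (le_trans (ler_norm_sum _ _ _)); apply: ler_sum => n _.
apply: (le_trans (normr_trig_le _ _ _)).
by rewrite ComplexField.Normc.normcM normc_real ler_wpM2r ?normc_ge0 // normr_perp_le.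
Qed.

Lemma tsum_sub L (x y : Z2 -> R[i]) i z :
  tsum L (fun n => ((perp n i)%:C)%C * x n) z - tsum L (fun n => ((perp n i)%:C)%C * y n) z =
  tsum L (fun n => ((perp n i)%:C)%C * (x n - y n)) z.
Proof.
by rewrite -sumrB; apply: eq_bigr => n _; rewrite !trigE !cE /=; ring.
Qed.

(** On [k + l = n] the symbol factors through [crs k l = n . k^perp] and [dt n l = n^perp . l^perp].
    In this form the flux depends on the velocity only through the products [u_j u_i], which pass to
    the limit under uniform convergence. *)
Lemma stream_flux_velocity L (x : Z2 -> R[i]) n :
  stream_flux L x n = \sum_(i < 2) \sum_(j < 2) ((perp n i * phase n (torus_basis j))%:C)%C *
    \sum_(k <- L) \sum_(l <- L | k + l == n)
      (((perp k j)%:C)%C * x k) * (((perp l i)%:C)%C * x l).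
Proof.
under eq_bigr do under eq_bigr do rewrite mulr_sumr.
under eq_bigr do rewrite exchange_big.
rewrite exchange_big /stream_flux; apply: eq_bigr => k _ /=.
under [RHS]eq_bigr do under eq_bigr do rewrite mulr_sumr.
under [RHS]eq_bigr do rewrite exchange_big.
rewrite exchange_big /=; apply: eq_bigr => l /eqP kl.
have -> : crs k l * dt n l = \sum_(i < 2) \sum_(j < 2)
    (perp n i * perp l i) * (phase n (torus_basis j) * perp k j) :> R.
  rewrite -[crs k l]crs_sum kl -sum_perp_crs -sum_perp_dt mulrC mulr_suml.
  by apply: eq_bigr => i _; rewrite mulr_sumr.
rewrite !sum_ord2; apply: complex_ext; rewrite !cE /=; ring.
Qed.

End TrigonometricFields.

Lemma taylor_split (R : rcfType) (a b : R) (p q P Q D F : R[i]) :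
  p - q - (b%:C)%C * D = ((P - Q - (a%:C)%C * F) - (P - p)) + (Q - q) +
  (((a - b)%:C)%C * D + (a%:C)%C * (F - D)).
Proof. by rewrite rmorphB /=; ring. Qed.

Lemma taylor_swap (R : rcfType) (s t : R) (p q D F : R[i]) :
  p - q - ((t - s)%:C)%C * D = - (q - p - ((s - t)%:C)%C * F) + ((s - t)%:C)%C * (D - F).
Proof. by rewrite !rmorphB /=; ring. Qed.

(** * The limit of the approximations *)

Section GalerkinLimit.
Context {R : realType}.
Local Notation T2 := (R * R)%type.
Local Notation A := (@cell_area R).
Implicit Types (n : Z2) (i j : 'I_2).
Variables (nu : R) (d : Z2 -> R) (g x0 : Z2 -> R[i]) (G G0 : R).
Hypotheses (nu0 : 0 < nu) (d0 : forall n, 0 <= d n)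
  (d1 : forall n : Z2, n != 0 -> 1 <= d n)
  (d2 : forall n : Z2, n != 0 -> d n ^+ 2 <= freq2 n)
  (dD : forall k l : Z2, k != 0 -> l != 0 -> freq2 k <= freq2 l :> R -> d (k + l) <= 2 * d l).
Hypothesis tail : forall eps : R, 0 < eps -> exists s0 : seq Z2,
  forall s : seq Z2, uniq s -> (forall n, n \in s -> n != 0 /\ n \notin s0) ->
  \sum_(n <- s) (freq2 n * d n ^+ 2)^-1 <= eps.
Hypotheses (gH : hermitian g) (x0H : hermitian x0).
Hypothesis gG : forall s : seq Z2, uniq s -> (forall n, n \in s -> n != 0) ->
  energy (fun n => d n ^+ 2) s g <= G.
Hypothesis x0G : forall s : seq Z2, uniq s -> (forall n, n \in s -> n != 0) ->
  energy (wd d) s x0 <= G0.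

Definition punctured_box N : seq Z2 := [seq n <- box N | n != 0].
Local Notation LN := punctured_box.

Lemma mem_LN N n : (n \in LN N) = (n != 0) && (n \in box N).
Proof. by rewrite mem_filter. Qed.

Lemma modes_LN N : modes (LN N).
Proof.
have uL : uniq (LN N) by apply: filter_uniq; exact: uniq_box.
split => //; first by move=> n; rewrite mem_LN => /andP[].
apply: uniq_perm => //; first by rewrite map_inj_uniq //; exact: oppr_inj.
move=> n; apply/mapP/idP => [[m mL ->]|nL].
  by move: mL; rewrite !mem_LN oppr_eq0 box_opp.
by exists (- n); rewrite ?opprK //; move: nL; rewrite !mem_LN oppr_eq0 box_opp.
Qed.

Lemma mem_LN_eventually n : n != 0 -> exists N0, forall N, (N0 <= N)%N -> n \in LN N.
Proof.
move=> n0; have [K H] := box_exhaust [:: n]; exists K => N KN.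
by rewrite mem_LN n0 (box_sub KN) // H // inE.
Qed.

Section Run.
Variables (K : R) (h : nat -> R).
Hypothesis K0 : 0 <= K.
Hypothesis run : forall N, good_run nu d g x0 K (LN N) (h N).
Hypothesis hN : forall N, h N <= N.+1%:R^-1.
Variable U : set_system nat.
Hypothesis UU : UltraFilter U.
Hypothesis Ufree : forall P : nat -> Prop,
  (exists N0, forall N, (N0 <= N)%N -> P N) -> \forall N \near U, P N.
Let UP : ProperFilter U. Proof. exact: ultra_proper. Qed.

Let h0 N : 0 < h N. Proof. by case: (run N). Qed.

Definition step_index N (t : R) : nat := Num.truncn (t / h N).

(** Piecewise constant in time, extended by 0 outside the truncation; the grid of times is refined
    as the truncation grows, since [h N] tends to 0. *)
Definition approx N (t : R) n : R[i] :=
  if n \in LN N then euler nu g x0 (LN N) (h N) (step_index N t) n else 0.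

Lemma h_small (eps : R) : 0 < eps -> \forall N \near U, h N <= eps.
Proof.
move=> e0; apply: Ufree; exists (Num.truncn eps^-1) => N HN.
apply: (le_trans (hN N)); rewrite -[leRHS]invrK lef_pV2 ?posrE ?invr_gt0 //.
by rewrite ltW // (lt_le_trans (truncnS_gt _)) // ler_nat ltnS.
Qed.

Lemma near_mem_LN n : n != 0 -> \forall N \near U, n \in LN N.
Proof. by move=> n0; apply: Ufree; exact: mem_LN_eventually. Qed.

Lemma approx_hermitian N t : hermitian (approx N t).
Proof.
move=> n; rewrite /approx !mem_LN oppr_eq0 box_opp.
case: ifP => _; first by apply: euler_hermitian => //; exact: modes_LN.
by apply: complex_ext; rewrite !cE /= ?opprK ?oppr0.
Qed.

Lemma approxE N t n : n \in LN N ->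
  approx N t n = euler nu g x0 (LN N) (h N) (step_index N t) n.
Proof. by rewrite /approx => ->. Qed.

Lemma energy_approx N t : energy (wd d) (LN N) (approx N t) <= K.
Proof.
have [_ _ HK] := run N; apply: le_trans (HK (step_index N t)).
by rewrite le_eqVlt; apply/orP; left; apply/eqP; apply: eq_big_seq => n nL; rewrite approxE.
Qed.

Lemma wiener_eq L (x y : Z2 -> R[i]) : {in L, x =1 y} -> wiener L x = wiener L y.
Proof. by move=> xy; apply: eq_big_seq => n /xy ->. Qed.

Lemma galerkin_field_approx N t n : n \in LN N -> galerkin_field nu g (LN N) (approx N t) n =
  galerkin_field nu g (LN N) (euler nu g x0 (LN N) (h N) (step_index N t)) n.
Proof.
move=> nL; rewrite /galerkin_field approxE //; congr (_ + _ * ('i%C * _) + _).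
apply: eq_big_seq => k kL; rewrite big_seq_cond [RHS]big_seq_cond.
by apply: eq_bigr => l /andP[lL _]; rewrite !approxE.
Qed.

Lemma step_indexP N (s t : R) : 0 <= s -> s <= t ->
  (step_index N s <= step_index N t)%N /\
  `|h N * (step_index N t - step_index N s)%N%:R - (t - s)| <= h N.
Proof.
move=> s0 st; have hp := h0 N; have t0 : 0 <= t := le_trans s0 st.
have key (r : R) : 0 <= r -> h N * (step_index N r)%:R <= r < h N * (step_index N r)%:R + h N.
  move=> r0; have : (step_index N r)%:R <= r / h N < (step_index N r).+1%:R.
    by apply: truncn_itv; rewrite divr_ge0 // ltW.
  rewrite ler_pdivlMr // ltr_pdivrMr // -natr1 mulrDl mul1r => /andP[a b].
  by rewrite mulrC a.
have ij : (step_index N s <= step_index N t)%N.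
  by apply: le_truncn; rewrite ler_wpM2r // invr_ge0 ltW.
split => //; rewrite natrB //.
have /andP[a b] := key s s0; have /andP[a' b'] := key t t0.
by rewrite ler_norml mulrBr; apply/andP; split; lra.
Qed.

Variables (M : R).
Hypothesis M0 : 0 <= M.
Hypothesis HM : forall L x, modes L -> energy (wd d) L x <= K -> wiener L x <= M.

Lemma wiener_approx_le N t : wiener (LN N) (approx N t) <= M.
Proof. by apply: HM; [exact: modes_LN|exact: energy_approx]. Qed.

Lemma normc_approx_le N t n : normc (approx N t n) <= M.
Proof.
rewrite /approx; case: ifP => nL; last by rewrite ComplexField.Normc.normc0.
rewrite -approxE //; apply: le_trans (wiener_approx_le N t).
by apply: normc_le_wiener => //; case: (modes_LN N).
Qed.

Definition psi (t : R) n : R[i] := projT1 (cid (ccvg_bounded UU (fun N => normc_approx_le N t n))).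

Lemma psi_cvg t n : ccvg U (fun N => approx N t n) (psi t n).
Proof. exact: (projT2 (cid (ccvg_bounded UU (fun N => normc_approx_le N t n)))). Qed.

Lemma psi0 t : psi t 0 = 0.
Proof.
apply: (ccvg_unique UU (psi_cvg t 0)).
by apply: (ccvg_near UU (ccvg_cst UU 0)); apply: filterE => N; rewrite /approx mem_LN eqxx.
Qed.

Lemma psi_initial n : n != 0 -> psi 0 n = x0 n.
Proof.
move=> n0; apply: (ccvg_unique UU (psi_cvg 0 n)).
apply: (ccvg_near UU (ccvg_cst UU (x0 n))); apply: filterS (near_mem_LN n0) => N nL.
by rewrite approxE // /step_index mul0r truncn0.
Qed.

(** Finitely many modes converge simultaneously and eventually all belong to the truncation, so the
    bound on the runs is inherited. *)
Lemma energy_psi t (s : seq Z2) : uniq s -> (forall n, n \in s -> n != 0) ->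
  energy (wd d) s (psi t) <= K.
Proof.
move=> us sn0; apply/ler_addgt0Pl => e e0.
have nsq_cvg n : \forall N \near U, `|nsq (approx N t n) - nsq (psi t n)| <=
     e / (\sum_(n <- s) wd d n + 1).
  have S1 : 0 < \sum_(n <- s) wd d n + 1.
    by rewrite ltr_wpDl // sumr_ge0 // => m _; exact: wd_ge0.
  have e1 : 0 < e / (\sum_(n <- s) wd d n + 1) / (2 * M + 1).
    by rewrite !divr_gt0 // ltr_wpDl // mulr_ge0.
  apply: filterS (psi_cvg t n e1) => N HNn.
  have pM : normc (psi t n) <= M.
    by apply: (ccvg_norm_le UU (psi_cvg t n)); apply: filterE => N'; exact: normc_approx_le.
  have aM := normc_approx_le N t n.
  rewrite -!normc_sqr subr_sqr normrM.
  have h1 : `|normc (approx N t n) - normc (psi t n)| <= normc (approx N t n - psi t n).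
    rewrite ler_norml; apply/andP; split.
      have := le_normcD (psi t n - approx N t n) (approx N t n).
      by rewrite subrK normc_distC; lra.
    have := le_normcD (approx N t n - psi t n) (psi t n).
    by rewrite subrK; lra.
  have h2 : `|normc (approx N t n) + normc (psi t n)| <= 2 * M + 1.
    rewrite ger0_norm ?addr_ge0 ?normc_ge0 //; lra.
  have M1 : 0 < 2 * M + 1 by rewrite ltr_wpDl // mulr_ge0.
  apply: (le_trans (ler_pM (normr_ge0 _) (normr_ge0 _) (le_trans h1 HNn) h2)).
  by rewrite divfK // gt_eqF.
have all_near (r : seq Z2) : \forall N \near U, forall n, n \in r -> 
    `|nsq (approx N t n) - nsq (psi t n)| <= e / (\sum_(n <- s) wd d n + 1).
  elim: r => [|m r IH]; first exact: filterE.
  apply: filterS (filterI (nsq_cvg m) IH) => N [h1 h2] n.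
  by rewrite inE => /predU1P[->|/h2].
have sub_near (r : seq Z2) : (forall n, n \in r -> n != 0) -> \forall N \near U, {subset r <= LN N}.
  elim: r => [|m r IH] r0; first exact: filterE.
  have m0 : m != 0 by apply: r0; rewrite mem_head.
  have /IH H : forall n, n \in r -> n != 0 by move=> n nr; apply: r0; rewrite inE nr orbT.
  apply: filterS (filterI (near_mem_LN m0) H) => N [h1 h2] n.
  by rewrite inE => /predU1P[->|/h2].
have [N [h1 h2]] := filter_ex (filterI (all_near s) (sub_near s sn0)).
have S1 : 0 < \sum_(n <- s) wd d n + 1.
  by rewrite ltr_wpDl // sumr_ge0 // => m _; exact: wd_ge0.
apply: (@le_trans _ _ (\sum_(n <- s) (wd d n * (e / (\sum_(n <- s) wd d n + 1)) + wd d n * nsq (approx N t n)))).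
  apply: ler_sum_mem => n ns; rewrite -mulrDr ler_wpM2l ?wd_ge0 //.
  have := h1 n ns; rewrite ler_norml => /andP[]; lra.
rewrite big_split /= -mulr_suml; apply: lerD.
  by rewrite mulrCA -[leRHS]mulr1 ler_wpM2l ?(ltW e0) // ler_pdivrMr // mul1r lerDl.
apply: le_trans (energy_approx N t); apply: ler_sum_subset => // n.
by rewrite mulr_ge0 ?wd_ge0 ?nsq_ge0.
Qed.

Definition pfac i (x : Z2 -> R[i]) n : R[i] := ((perp n i)%:C)%C * x n.

Lemma pfac_conj i (x : Z2 -> R[i]) : hermitian x ->
  forall n, pfac i x (- n) = conjc (pfac i x n).
Proof.
by move=> xH n; rewrite /pfac xH perpN; apply: complex_ext; rewrite !cE /=; ring.
Qed.

Definition uapprox N t i (y : T2) : R := tsum (LN N) (pfac i (approx N t)) y.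

Lemma normr_uapprox_le N t i y : `|uapprox N t i y| <= M.
Proof. exact: le_trans (normr_tsum_perp_le _ _ _ _) (wiener_approx_le N t). Qed.

Definition usol (t : R) (y : T2) i : R :=
  projT1 (cid (ultra_bounded_cvg UU (fun N => normr_uapprox_le N t i y))).

Lemma usol_cvg t y i : uapprox N t i y @[N --> U] --> usol t y i.
Proof. exact: (projT2 (cid (ultra_bounded_cvg UU (fun N => normr_uapprox_le N t i y)))). Qed.

Lemma normr_usol_le t y i : `|usol t y i| <= M.
Proof.
apply: (@ulim_norm_le R U UU _ _ M (@usol_cvg t y i)).
by apply: filterE => N; exact: normr_uapprox_le.
Qed.

(** The limit, pointwise in [y] by construction, is uniform because the high modes are small
    uniformly in [N] and [y], and the low modes are finite in number. *)
Lemma usol_unif t i (eps : R) : 0 < eps ->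
  \forall N \near U, forall y, `|uapprox N t i y - usol t y i| <= eps.
Proof.
move=> e0; have e3 : 0 < eps / 4 by rewrite divr_gt0.
have e4 : 0 < (eps / 4) ^+ 2 / (K + 1) by rewrite divr_gt0 ?exprn_gt0 // ltr_wpDl.
have [s0 Hs0] := wiener_tail_sqr_le d1 tail e4.
pose S := undup s0.
have dist N y : `|uapprox N t i y - tsum S (pfac i (approx N t)) y| <= eps / 4.
  have [uL L0 _] := modes_LN N.
  rewrite /uapprox /tsum (bigID (mem s0)) /=.
  have -> : \sum_(n <- LN N | n \in s0) trig (pfac i (approx N t) n) n y =
            \sum_(n <- S) trig (pfac i (approx N t) n) n y.
    rewrite [RHS](bigID (mem (LN N))) /= [X in _ = _ + X]big1 ?addr0; last first.
      by move=> n nL; rewrite /pfac /approx (negPf nL) mulr0 /trig mul0r.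
    rewrite -big_filter -[RHS]big_filter; apply: perm_big.
    apply: uniq_perm; [exact: filter_uniq uL|exact/filter_uniq/undup_uniq|move=> n].
    by rewrite !mem_filter mem_undup; case: (n \in s0); rewrite /= ?andbF ?andbT.
  rewrite addrAC subrr add0r; apply: (le_trans (ler_norm_sum _ _ _)).
  set B := (X in X <= _).
  have BA : B <= \sum_(n <- LN N | n \notin s0) freq n * normc (approx N t n).
    apply: ler_sum => n _; apply: (le_trans (normr_trig_le _ _ _)).
    by rewrite ComplexField.Normc.normcM normc_real ler_wpM2r ?normc_ge0 // normr_perp_le.
  apply: (le_trans BA); rewrite -(@ler_pXn2r _ 2) ?nnegrE ?(ltW e3) //; last first.
    by apply: sumr_ge0 => n _; rewrite mulr_ge0 ?freq_ge0 ?normc_ge0.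
  apply: (le_trans (Hs0 _ _ uL L0)).
  apply: (le_trans (ler_wpM2l (ltW e4) (energy_approx N t))).
  have K1 : 0 < K + 1 by rewrite ltr_wpDl.
  by rewrite mulrAC ler_pdivrMr // ler_wpM2l ?sqr_ge0 // lerDl.
have fin_cvg : \forall N \near U, forall y,
    `|tsum S (pfac i (approx N t)) y - tsum S (pfac i (psi t)) y| <= eps / 4.
  pose r : R := \sum_(n <- S) freq n.
  have r0 : 0 <= r by apply: sumr_ge0 => n _; exact: freq_ge0.
  have r1 : 0 < r + 1 by rewrite ltr_wpDl.
  have all_near (q : seq Z2) : \forall N \near U, forall n, n \in q ->
      normc (approx N t n - psi t n) <= eps / 4 / (r + 1).
    elim: q => [|m q IH]; first exact: filterE.
    have em : 0 < eps / 4 / (r + 1) by rewrite divr_gt0.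
    apply: filterS (filterI (psi_cvg t m em) IH) => N [h1 h2] n.
    by rewrite inE => /predU1P[->|/h2].
  apply: filterS (all_near S) => N H y; rewrite tsum_sub.
  apply: (le_trans (normr_tsum_perp_le _ _ _ _)).
  apply: (@le_trans _ _ (\sum_(n <- S) freq n * (eps / 4 / (r + 1)))).
    by apply: ler_sum_mem => n nS; rewrite ler_wpM2l ?freq_ge0 // H.
  by rewrite -mulr_suml -/r mulrCA -[leRHS]mulr1 ler_wpM2l ?(ltW e3) // ler_pdivrMr // mul1r lerDl.
have lim_dist y : `|usol t y i - tsum S (pfac i (psi t)) y| <= eps / 4 + eps / 4.
  apply: (@ulim_norm_le _ U UU (fun N => uapprox N t i y - tsum S (pfac i (psi t)) y)).
    by apply: cvgB; [exact: usol_cvg|exact: cvg_cst].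
  apply: filterS fin_cvg => N /(_ y) H.
  have -> : uapprox N t i y - tsum S (pfac i (psi t)) y =
    (uapprox N t i y - tsum S (pfac i (approx N t)) y) +
    (tsum S (pfac i (approx N t)) y - tsum S (pfac i (psi t)) y) by ring.
  by apply: (le_trans (ler_normD _ _)); exact: lerD.
apply: filterS fin_cvg => N H y.
have -> : uapprox N t i y - usol t y i =
  (uapprox N t i y - tsum S (pfac i (approx N t)) y) +
  (tsum S (pfac i (approx N t)) y - tsum S (pfac i (psi t)) y) -
  (usol t y i - tsum S (pfac i (psi t)) y) by ring.
apply: (le_trans (ler_normB _ _)).
apply: (@le_trans _ _ ((eps / 4 + eps / 4) + (eps / 4 + eps / 4))); last by lra.
apply: lerD; last exact: lim_dist.
by apply: (le_trans (ler_normD _ _)); apply: lerD; [exact: dist|exact: H].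
Qed.

Lemma test_uapprox N t i : torus_test (uapprox N t i).
Proof. exact: test_trig_sum. Qed.

Lemma usol_continuous t i : continuous (fun y => usol t y i).
Proof.
apply: continuous_uniform_approx => e e0.
have [N H] := filter_ex (usol_unif t i e0); exists (uapprox N t i).
split; first exact: (smooth_continuous (proj1 (test_uapprox N t i))).
by move=> y; rewrite distrC.
Qed.

Lemma usol_periodic t i : torus_periodic (fun y => usol t y i).
Proof.
move=> j y; apply: (ulim_unique UU (@usol_cvg t _ i)).
have -> : (fun N => uapprox N t i (y + (2 * pi) *: torus_basis j)) = fun N => uapprox N t i y.
  by apply/funext => N; exact: (proj2 (test_uapprox N t i)).
exact: usol_cvg.
Qed.

Lemma usol_bdd t i : bdd_meas (fun y => usol t y i).
Proof.
split; first by apply: continuous_measurable2; exact: usol_continuous.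
by exists M => y; exact: normr_usol_le.
Qed.

Lemma fourier_unif_cvg n (F : nat -> T2 -> R) (f : T2 -> R) :
  (forall N, bdd_meas (F N)) -> bdd_meas f ->
  (forall eps : R, 0 < eps -> \forall N \near U, forall y, `|F N y - f y| <= eps) ->
  ccvg U (fun N => fourier n (F N)) (fourier n f).
Proof.
move=> bF bf H e e0; have A0 := @cell_area_gt0 R.
have e2 : 0 < e / (2 * A) by apply: divr_gt0 => //; exact: mulr_gt0.
apply: filterS (H _ e2) => N HN; rewrite -fourierB //.
apply: (le_trans (normc_fourier_le n (bdd_measB (bF N) bf) HN)).
by rewrite le_eqVlt; apply/orP; left; apply/eqP; field; rewrite gt_eqF.
Qed.

Lemma fourier_uapprox N t i n : fourier n (uapprox N t i) = (A%:C)%C * pfac i (approx N t) n.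
Proof.
apply: fourier_tsum; first exact: modes_LN.
  by apply: pfac_conj; exact: approx_hermitian.
by move=> nL; rewrite /pfac /approx (negPf nL) mulr0.
Qed.

Lemma fourier_usol t i n : fourier n (fun y => usol t y i) = (A%:C)%C * pfac i (psi t) n.
Proof.
have H := @fourier_unif_cvg n _ _ (fun N => test_bdd_meas (test_uapprox N t i)) (usol_bdd t i) (usol_unif t i).
apply: (ccvg_unique UU H).
have := ccvgM UU (A%:C)%C (ccvgM UU ((perp n i)%:C)%C (psi_cvg t n)).
by move/(ccvg_near UU); apply; apply: filterE => N; rewrite fourier_uapprox.
Qed.

(** The flux in velocity form, for the limit velocity; unlike a convolution of [psi] with itself, it
    involves no infinite sum over modes. *)
Definition Bvel t n : R[i] := \sum_(i < 2) \sum_(j < 2)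
  ((perp n i * phase n (torus_basis j))%:C)%C *
  ((A^-1%:C)%C * fourier n (fun y => usol t y j * usol t y i)).

Lemma stream_flux_cvg t n : ccvg U (fun N => stream_flux (LN N) (approx N t) n) (Bvel t n).
Proof.
have A0 : A != 0 by rewrite gt_eqF // cell_area_gt0.
have E N : stream_flux (LN N) (approx N t) n = \sum_(i < 2) \sum_(j < 2)
    ((perp n i * phase n (torus_basis j))%:C)%C *
    ((A^-1%:C)%C * fourier n (fun y => uapprox N t j y * uapprox N t i y)).
  rewrite stream_flux_velocity; apply: eq_bigr => i _; apply: eq_bigr => j _; congr (_ * _).
  rewrite fourier_tsum_mul; [|exact: modes_LN|by apply: pfac_conj; exact: approx_hermitian..].
  by rewrite /pfac; apply: complex_ext; rewrite !cE /=; field.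
have -> : (fun N => stream_flux (LN N) (approx N t) n) = _ := funext E.
apply: ccvg_sum => // i; apply: ccvg_sum => // j; do 2 apply: ccvgM => //.
apply: fourier_unif_cvg.
- by move=> N; apply: bdd_measM; apply: test_bdd_meas; exact: test_uapprox.
- by apply: bdd_measM; exact: usol_bdd.
move=> e e0; have M1 : 0 < 2 * M + 1 by rewrite ltr_wpDl // mulr_ge0.
have e1 : 0 < e / (2 * M + 1) by rewrite divr_gt0.
apply: filterS (filterI (usol_unif t j e1) (usol_unif t i e1)) => N [h1 h2] y.
have -> : uapprox N t j y * uapprox N t i y - usol t y j * usol t y i =
  (uapprox N t j y - usol t y j) * uapprox N t i y +
  usol t y j * (uapprox N t i y - usol t y i) by ring.
apply: (le_trans (ler_normD _ _)); rewrite !normrM.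
have a1 := normr_uapprox_le N t i y; have a2 := normr_usol_le t y j.
apply: (@le_trans _ _ (e / (2 * M + 1) * M + M * (e / (2 * M + 1)))).
  by apply: lerD; apply: ler_pM.
have -> : e / (2 * M + 1) * M + M * (e / (2 * M + 1)) = e * ((2 * M) / (2 * M + 1)).
  by field; rewrite gt_eqF.
by rewrite ler_piMr ?(ltW e0) // ler_pdivrMr // mul1r lerDl.
Qed.

Definition rhs t n : R[i] := ((- (nu * freq2 n))%:C)%C * psi t n +
  ((- (freq2 n)^-1)%:C)%C * ('i%C * Bvel t n) + g n.

Lemma rhs_cvg t n : ccvg U (fun N => galerkin_field nu g (LN N) (approx N t) n) (rhs t n).
Proof.
apply: ccvgD => //; last exact: ccvg_cst.
apply: ccvgD => //; first by apply: ccvgM => //; exact: psi_cvg.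
by do 2 apply: ccvgM => //; exact: stream_flux_cvg.
Qed.

Lemma approx_modulus (eps : R) : 0 < eps -> exists2 tau : R, 0 < tau &
  forall s t, 0 <= s -> s <= t -> t - s <= tau -> \forall N \near U,
  wiener (LN N) (fun n => approx N t n - approx N s n) <= eps.
Proof.
move=> e0; have [tau t0 Ht] := @euler_modulus R nu d g x0 K nu0 d1 K0 tail M M0 HM eps e0.
have t2 : 0 < tau / 2 by rewrite divr_gt0.
(* The other half of [tau] covers the rounding of the times to the grid, at most [h N]. *)
exists (tau / 2) => // s t s0 st ts.
apply: filterS (h_small t2) => N hs.
have [ij hm] := step_indexP N s0 st.
rewrite -(@wiener_eq (LN N) (fun n => euler nu g x0 (LN N) (h N) (step_index N s + (step_index N t - step_index N s)) n
   - euler nu g x0 (LN N) (h N) (step_index N s) n)); last first.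
  by move=> n nL; rewrite /= subnKC // !approxE.
apply: Ht; first exact: run.
by move: hm; rewrite ler_norml => /andP[_]; lra.
Qed.

Lemma usol_time_modulus (eps : R) : 0 < eps -> exists2 tau : R, 0 < tau &
  forall s t, 0 <= s -> 0 <= t -> `|t - s| <= tau -> forall y i,
  `|usol t y i - usol s y i| <= eps.
Proof.
move=> e0; have [tau t0 Ht] := approx_modulus e0; exists tau => // s t s0' t0'.
wlog st : s t s0' t0' / s <= t => [H|] ts y i.
  have [st|/ltW st] := leP s t; first exact: H.
  by rewrite distrC; apply: H => //; rewrite distrC.
apply: (@ulim_norm_le _ U UU (fun N => uapprox N t i y - uapprox N s i y)).
  by apply: cvgB; exact: usol_cvg.
rewrite ger0_norm ?subr_ge0 // in ts.
apply: filterS (Ht s t s0' st ts) => N HN.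
rewrite /uapprox /pfac tsum_sub.
exact: le_trans (normr_tsum_perp_le _ _ _ _) HN.
Qed.

Lemma rhs_modulus n (eps : R) : n != 0 -> 0 < eps -> exists2 tau : R, 0 < tau &
  forall s t, 0 <= s -> s <= t -> t - s <= tau ->
  normc (rhs t n - rhs s n) <= eps.
Proof.
move=> n0 e0; set c := nu * freq2 n + 2 * M.
have c0 : 0 <= c by rewrite addr_ge0 ?mulr_ge0 ?freq2_ge0 // ltW.
have c1 : 0 < c + 1 by rewrite ltr_wpDl.
have [tau t0 Ht] := approx_modulus (divr_gt0 e0 c1).
exists tau => // s t s0 st ts.
have H : ccvg U (fun N => galerkin_field nu g (LN N) (approx N t) n + -1 * galerkin_field nu g (LN N) (approx N s) n)
    (rhs t n + -1 * rhs s n).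
  by apply: ccvgD => //; [exact: rhs_cvg|apply: ccvgM => //; exact: rhs_cvg].
rewrite mulN1r in H; apply: (ccvg_norm_le UU H).
apply: filterS (filterI (Ht s t s0 st ts) (near_mem_LN n0)) => N [HN nL].
rewrite mulN1r.
have HH := normc_galerkin_field_sub_le g nu0 (modes_LN N) (wiener_approx_le N t) (wiener_approx_le N s) nL; apply: (le_trans HH).
apply: (le_trans (ler_wpM2l c0 HN)).
by rewrite mulrCA -[leRHS]mulr1 ler_wpM2l ?(ltW e0) // ler_pdivrMr // mul1r lerDl.
Qed.

(** Passage to the limit in [euler_taylor]. The times are fixed before [N], so a single index, close
    enough to the limit in all respects, suffices. *)
Lemma psi_taylor n (eps : R) : n != 0 -> 0 < eps -> exists2 tau : R, 0 < tau &
  forall s t, 0 <= s -> s <= t -> t - s <= tau ->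
  normc (psi t n - psi s n - ((t - s)%:C)%C * rhs s n) <= eps * (t - s).
Proof.
move=> n0 e0.
have [tau t0 Ht] := @euler_taylor R nu d g x0 K nu0 d1 K0 tail M M0 HM n eps e0.
have t2 : 0 < tau / 2 by rewrite divr_gt0.
exists (tau / 2) => // s t s0 st ts.
apply/ler_addgt0Pr => e e_gt0.
(* [del * Cst] collects the errors: rounding of the time enters with the factors [eps] and
   [normc (rhs s n)], the two values of [psi] with 2, the field with [tau]. *)
pose Cst := eps + 2 + normc (rhs s n) + tau.
have F0 := normc_ge0 (rhs s n).
have C0 : 0 < Cst by rewrite /Cst; lra.
pose del := Num.min (tau / 2) (e / Cst).
have del0 : 0 < del by rewrite lt_min t2 divr_gt0.
have delC : del * Cst <= e by rewrite -ler_pdivlMr // ge_min lexx orbT.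
have del2 : del <= tau / 2 by rewrite ge_min lexx.
have [N [[[[n1 n2] n3] n4] nL]] := filter_ex (filterI (filterI (filterI (filterI
  (psi_cvg t n del0) (psi_cvg s n del0)) (rhs_cvg s n del0)) (h_small del0)) (near_mem_LN n0)).
have [ij hm] := step_indexP N s0 st.
set i := step_index N s in ij hm *; set m := (step_index N t - i)%N in hm *.
have hmt : h N * m%:R <= tau by move: hm; rewrite ler_norml => /andP[_]; lra.
have hm0 : 0 <= h N * m%:R by rewrite mulr_ge0 ?ler0n // ltW.
have := Ht (LN N) (h N) (run N) nL i m hmt.
have -> : euler nu g x0 (LN N) (h N) (i + m) n = approx N t n by rewrite approxE // /m subnKC.
have -> : euler nu g x0 (LN N) (h N) i n = approx N s n by rewrite approxE.
rewrite -[galerkin_field _ _ _ _ _](galerkin_field_approx s nL).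
set F := galerkin_field _ _ _ _ _ in n3 *; set D := rhs s n in n3 F0 *.
set P := approx N t n in n1 *; set Q := approx N s n in n2 * => H.
have -> : psi t n - psi s n - ((t - s)%:C)%C * D =
  ((P - Q - ((h N * m%:R)%:C)%C * F) - (P - psi t n)) + (Q - psi s n) +
  (((h N * m%:R - (t - s))%:C)%C * D + ((h N * m%:R)%:C)%C * (F - D)).
  exact: taylor_split.
apply: (le_trans (le_normcD _ _)).
apply: (@le_trans _ _ ((eps * (h N * m%:R) + del + del) + (del * normc D + tau * del))).
  apply: lerD.
    apply: (le_trans (le_normcD _ _)); apply: lerD => //.
    by apply: (le_trans (le_normcD _ _)); rewrite normcN; apply: lerD.
  apply: (le_trans (le_normcD _ _)); rewrite !ComplexField.Normc.normcM !normc_real.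
  apply: lerD.
    by rewrite ler_wpM2r ?normc_ge0 // (le_trans hm).
  by rewrite ger0_norm //; apply: ler_pM; rewrite ?normc_ge0.
have hm' : h N * m%:R <= (t - s) + del by move: hm; rewrite ler_norml => /andP[_]; lra.
have := ler_wpM2l (ltW e0) hm'; move: delC; rewrite /Cst -/D; lra.
Qed.

(** For [t < s] the expansion is based at [t], and the continuity of [rhs] moves the base point to
    [s] at the cost of [eps / 2]. *)
Lemma psi_derivative n (eps : R) : n != 0 -> 0 < eps -> exists2 tau : R, 0 < tau &
  forall s t, 0 <= s -> 0 <= t -> `|t - s| <= tau ->
  normc (psi t n - psi s n - ((t - s)%:C)%C * rhs s n) <= eps * `|t - s|.
Proof.
move=> n0 e0; have e2 : 0 < eps / 2 by rewrite divr_gt0.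
have [tau1 t1 H1] := psi_taylor n0 e2; have [tau2 t2 H2] := rhs_modulus n0 e2.
exists (Num.min tau1 tau2); first by rewrite lt_min t1.
move=> s t s0 t0; rewrite le_min => /andP[h1 h2].
have [st|/ltW ts] := leP s t.
  rewrite ger0_norm ?subr_ge0 // in h1 *.
  apply: (le_trans (H1 s t s0 st h1)).
  by rewrite ler_wpM2r ?subr_ge0 //; lra.
rewrite ler0_norm ?subr_le0 // opprB in h1 h2 *.
have -> : psi t n - psi s n - ((t - s)%:C)%C * rhs s n =
  - (psi s n - psi t n - ((s - t)%:C)%C * rhs t n) + ((s - t)%:C)%C * (rhs s n - rhs t n).
  exact: taylor_swap.
apply: (le_trans (le_normcD _ _)); rewrite normcN ComplexField.Normc.normcM normc_real.
rewrite ger0_norm ?subr_ge0 //.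
have k1 := H1 t s t0 ts h1.
have st0 : 0 <= s - t by rewrite subr_ge0.
have k2 := ler_wpM2l st0 (H2 t s t0 ts h2); lra.
Qed.

End Run.

Theorem galerkin_limit : exists (u : R -> T2 -> 'I_2 -> R) (p : R -> Z2 -> R[i]) (K M : R),
  [/\ [/\ forall t i, continuous (fun y => u t y i),
      forall t i, torus_periodic (fun y => u t y i),
      forall t y i, `|u t y i| <= M &
      forall eps : R, 0 < eps -> exists2 tau : R, 0 < tau &
        forall s t, 0 <= s -> 0 <= t -> `|t - s| <= tau ->
        forall y i, `|u t y i - u s y i| <= eps],
    forall t i n, fourier n (fun y => u t y i) = (A%:C)%C * (((perp n i)%:C)%C * p t n),
    (forall n, n != 0 -> p 0 n = x0 n) /\ (forall t, p t 0 = 0),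
    forall t (s : seq Z2), uniq s -> (forall n, n \in s -> n != 0) ->
      energy (wd d) s (p t) <= K &
    forall n (eps : R), n != 0 -> 0 < eps -> exists2 tau : R, 0 < tau &
      forall s t, 0 <= s -> 0 <= t -> `|t - s| <= tau ->
      normc (p t n - p s n - ((t - s)%:C)%C *
        (((- (nu * freq2 n))%:C)%C * p s n +
         ((- (freq2 n)^-1)%:C)%C * ('i%C * \sum_(i < 2) \sum_(j < 2)
            ((perp n i * phase n (torus_basis j))%:C)%C *
            ((A^-1%:C)%C * fourier n (fun y => u s y j * u s y i))) + g n))
        <= eps * `|t - s|].
Proof.
have [K K0 HK] := @euler_apriori R nu d g x0 G G0 nu0 d0 d1 d2 dD tail gH x0H gG x0G.
have /choice[h Hh] : forall N, exists h : R, good_run nu d g x0 K (LN N) h /\ h <= N.+1%:R^-1.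
  move=> N; have [h1 h10 H] := HK _ (modes_LN N).
  have hp : 0 < Num.min h1 N.+1%:R^-1 by rewrite lt_min h10 invr_gt0 ltr0n.
  exists (Num.min h1 N.+1%:R^-1); split; last by rewrite ge_min lexx orbT.
  split=> //; first exact: modes_LN.
  by apply: H; rewrite hp ge_min lexx.
have run N := (Hh N).1; have hN N := (Hh N).2.
have [U [UU Ufree]] := exists_free_ultrafilter.
have [M M0 HM] := @wiener_bound R d K d0 d1 tail.
exists (usol run UU HM), (psi run UU M0 HM), K, M.
split.
- split.
  + exact: usol_continuous.
  + exact: usol_periodic.
  + exact: normr_usol_le.
  + exact: usol_time_modulus.
- by move=> t i n; rewrite fourier_usol.
- by split; [exact: psi_initial|exact: psi0].
- exact: energy_psi.
- exact: psi_derivative.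
Qed.

End GalerkinLimit.

(** * Powers of the frequency and Sobolev norms *)

Section PowerWeight.
Context {R : realType}.
Implicit Types n k l : Z2.
Variable delta : R.
Hypotheses (del0 : 0 < delta) (del1 : delta <= 1).

Definition wgt n : R := freq n `^ delta.

Lemma wgt_ge0 n : 0 <= wgt n. Proof. exact: powR_ge0. Qed.

Lemma wgt_ge1 n : n != 0 -> 1 <= wgt n.
Proof.
move=> n0; rewrite -(powRr0 (freq n)) /wgt; apply: ler_powR; first exact: freq_ge1.
exact: ltW.
Qed.

Lemma wgt_sqr_le n : n != 0 -> wgt n ^+ 2 <= freq2 n.
Proof.
move=> n0; rewrite -freq_sqr; have h : wgt n <= freq n by rewrite ler1_powR // freq_ge1.
by rewrite ler_sqr // nnegrE ?wgt_ge0 ?freq_ge0.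
Qed.

Lemma freq_add_le k l : freq (k + l) <= freq k + freq l :> R.
Proof.
have s0 : 0 <= freq k + freq l :> R by rewrite addr_ge0 ?freq_ge0.
rewrite -[leRHS]ger0_norm // -sqrtr_sqr; apply: ler_wsqrtr.
have := normr_dt_le k l (R := R); rewrite ler_norml => /andP[_ h].
have -> : (freq k + freq l) ^+ 2 = freq k ^+ 2 + freq l ^+ 2 + 2 * (freq k * freq l) :> R by ring.
rewrite !freq_sqr; have -> : freq2 (k + l) = freq2 k + freq2 l + 2 * dt k l :> R.
  by rewrite /freq2 /dt /= !mulrzDr; ring.
by rewrite lerD2l ler_pM2l.
Qed.

(** For [|k| <= |l|] one has [|k + l| <= 2 |l|], and [2^delta <= 2]. *)
Lemma wgt_add_le k l : k != 0 -> l != 0 -> freq2 k <= freq2 l :> R ->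
  wgt (k + l) <= 2 * wgt l.
Proof.
move=> k0 l0 kl; have rkl : freq k <= freq l :> R by rewrite ler_wsqrtr.
have h1 : freq (k + l) <= 2 * freq l :> R by have := freq_add_le k l; lra.
apply: (@le_trans _ _ ((2 * freq l) `^ delta)).
  by apply: ge0_ler_powR => //; rewrite ?(ltW del0) // nnegrE ?freq_ge0 // mulr_ge0 ?freq_ge0.
rewrite powRM ?freq_ge0 //; apply: ler_wpM2r; first exact: powR_ge0.
by rewrite ler1_powR // ler1n.
Qed.

(* Uses [1 + delta ln (1 + 1/x) <= (1 + 1/x)^delta]. *)
Lemma powR_telescope (x : R) : 1 <= x ->
  x `^ (- (1 + delta)) <= 4 / delta * (x `^ (- delta) - (x + 1) `^ (- delta)).
Proof.
move=> x1; have x0 : 0 < x by lra.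
have y0 : 0 < x + 1 by lra.
have e1 : x `^ (- (1 + delta)) = x^-1 * x `^ (- delta).
  rewrite opprD powRD; last by rewrite (gt_eqF x0) implybT.
  by rewrite powR_inv1 // ltW.
have e2 : (x + 1) `^ (- delta) = x `^ (- delta) * ((x + 1) / x) `^ (- delta).
  rewrite -powRM ?divr_ge0 ?(ltW x0) ?(ltW y0) //; congr (_ `^ _).
  by field; rewrite gt_eqF.
have X0 : 0 < x `^ (- delta) by rewrite powR_gt0.
set q := ((x + 1) / x) `^ (- delta) in e2.
have lnq : (x + 1)^-1 <= ln ((x + 1) / x).
  have -> : (x + 1) / x = (x / (x + 1))^-1 by rewrite invfM invrK mulrC.
  have p0 : 0 < x / (x + 1) by rewrite divr_gt0.
  rewrite lnV ?posrE //; have -> : x / (x + 1) = 1 + (- (x + 1)^-1).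
    by field; rewrite gt_eqF.
  rewrite lerNr; apply: le_ln1Dx.
  by rewrite ltrN2 invf_lt1 //; lra.
have q0 : 0 < q by rewrite powR_gt0 // divr_gt0.
have qi : 1 + delta * (x + 1)^-1 <= q^-1.
  rewrite -powRN opprK /powR gt_eqF ?divr_gt0 //.
  apply: (le_trans _ (expR_ge1Dx _)); rewrite lerD2l.
  by rewrite ler_wpM2l // ltW.
have h1 : q * (1 + delta * (x + 1)^-1) <= 1.
  by rewrite -ler_pdivlMl // mulr1.
rewrite e1 e2.
have -> : 4 / delta * (x `^ (- delta) - x `^ (- delta) * q) = (4 / delta * (1 - q)) * x `^ (- delta) by ring.
rewrite ler_wpM2r ?(ltW X0) //.
have b0 : 0 < (x + 1)^-1 by rewrite invr_gt0.
have s0 : 0 <= delta * (x + 1)^-1 by rewrite mulr_ge0 // ltW.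
have b1 : delta * (x + 1)^-1 <= 1.
  by rewrite -[leRHS]mul1r; apply: ler_pM; rewrite ?(ltW del0) ?(ltW b0) // invf_le1 //; lra.
have q1 : q <= 1 by have := mulr_ge0 (ltW q0) s0; lra.
have h2 : delta * (x + 1)^-1 <= 2 * (1 - q).
  have q1' : 0 <= 1 - q by rewrite subr_ge0.
  by have := ler_wpM2l q1' b1; lra.
(* The constant 4 of the statement is made of two factors 2: this one, from [x >= 1], and the one in
   [h2]. *)
have h3 : x^-1 <= 2 * (x + 1)^-1.
  by rewrite -[2 * _]invrK lef_pV2 ?posrE ?invr_gt0 ?mulr_gt0 // invfM invrK; lra.
apply: (le_trans h3); apply: (@le_trans _ _ (2 * (delta * (x + 1)^-1) / delta)).
  by rewrite le_eqVlt; apply/orP; left; apply/eqP; field; rewrite !gt_eqF.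
rewrite (_ : 4 / delta * (1 - q) = 4 * (1 - q) / delta); last by ring.
by rewrite ler_wpM2r ?invr_ge0 ?(ltW del0) //; lra.
Qed.

(** The maximum with 1 gives a vanishing coordinate the weight 1 instead of a power of zero. *)
Definition natm (k : nat) : R := (maxn 1 k)%:R.

Lemma natm_ge1 (k : nat) : 1 <= natm k.
Proof. by rewrite /natm ler1n leq_maxl. Qed.

Lemma natm_le_freq n : n != 0 -> natm `|n.1| <= freq n /\ natm `|n.2| <= freq n.
Proof.
move=> n0; have H (m : int) : m%:~R ^+ 2 <= freq2 n :> R -> natm `|m| <= freq n.
  move=> mr; rewrite /natm; case: (leqP `|m|%N 1) => _.
    exact: freq_ge1.
  rewrite (_ : `|m|%:R = Num.sqrt (m%:~R ^+ 2)) ?ler_wsqrtr //.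
  by rewrite sqrtr_sqr -intr_norm -abszE.
by split; apply: H; rewrite /freq2 ?lerDl ?lerDr sqr_ge0.
Qed.

Definition zweight (i : int) : R := natm `|i| `^ (- (1 + delta)).

(** [|n|] dominates both [max(1, |n_1|)] and [max(1, |n_2|)], so half of the exponent
    [2 (1 + delta)] is spent on each coordinate, and the lattice sum factors into two convergent
    series. *)
Lemma wgt_inv_le n : (freq2 n * wgt n ^+ 2)^-1 <= zweight n.1 * zweight n.2.
Proof.
have z0 i : 0 <= zweight i by exact: powR_ge0.
have [->|n0] := eqVneq n 0.
  by rewrite /freq2 /= expr0n /= addr0 mul0r invr0 mulr_ge0.
have [m1 m2] := natm_le_freq n0; have r1 := freq_ge1 n0 (R := R).
have rn0 : 0 < freq n :> R by lra.
have E : freq2 n * wgt n ^+ 2 = freq n `^ (1 + delta) * freq n `^ (1 + delta).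
  rewrite powRD ?powRr1 ?(ltW rn0) //; first by rewrite -freq_sqr /wgt; ring.
  by rewrite (gt_eqF rn0) implybT.
rewrite E invfM -!powRN; apply: ler_pM; rewrite ?powR_ge0 //.
  rewrite /zweight !powRN lef_pV2 ?posrE ?powR_gt0 //.
    by apply: ge0_ler_powR; rewrite ?nnegrE ?(ltW rn0) ?(le_trans ler01 (natm_ge1 _)) // addr_ge0 ?ltW.
  by have := natm_ge1 `|n.1|; lra.
rewrite /zweight !powRN lef_pV2 ?posrE ?powR_gt0 //.
  by apply: ge0_ler_powR; rewrite ?nnegrE ?(ltW rn0) ?(le_trans ler01 (natm_ge1 _)) // addr_ge0 ?ltW.
by have := natm_ge1 `|n.2|; lra.
Qed.

Lemma sum_zweight_le K : \sum_(i <- zrange K) zweight i <= 1 + 2 * (4 / delta).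
Proof.
pose h (k : nat) : R := 4 / delta * k.+1%:R `^ (- delta).
have c0 : 0 <= 4 / delta by rewrite divr_ge0 // ltW.
have := @sum_zrange_telescope R (fun k : nat => natm k `^ (- (1 + delta))) h K.
have n0 : natm 0 = 1 by rewrite /natm maxn0.
rewrite /h n0 powR1 mulr1; apply => [k|k]; last first.
  by rewrite mulr_ge0 ?powR_ge0.
rewrite -mulrBr /natm (maxn_idPr _) // -[k.+2%:R]natr1.
by apply: powR_telescope; rewrite ler1n.
Qed.

Lemma wgt_tail (eps : R) : 0 < eps -> exists s0 : seq Z2,
  forall s : seq Z2, uniq s -> (forall n, n \in s -> n != 0 /\ n \notin s0) ->
  \sum_(n <- s) (freq2 n * wgt n ^+ 2)^-1 <= eps.
Proof.
move=> e0; pose C := 1 + 2 * (4 / delta).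
have w0 n : 0 <= (freq2 n * wgt n ^+ 2)^-1 by rewrite invr_ge0 mulr_ge0 ?freq2_ge0 ?sqr_ge0.
have [|K0 H] := @box_tail R (fun n => (freq2 n * wgt n ^+ 2)^-1) (C * C) w0 _ eps e0.
  move=> K; apply: (@le_trans _ _ (\sum_(n <- box K) zweight n.1 * zweight n.2)).
    by apply: ler_sum => n _; exact: wgt_inv_le.
  apply: sum_box_prod_le; try exact: sum_zweight_le; by move=> i; exact: powR_ge0.
by exists (box K0) => s us Hs; apply: H => // n /Hs[].
Qed.

End PowerWeight.

(** * Sobolev norms and stream coefficients of distributions *)

Section SobolevSums.
Context {R : realType}.
Implicit Types (n : Z2) (T : @vector_dist R) (i j : 'I_2).
Local Notation e_ := torus_basis.

Definition sqsum T n : R := \sum_(i < 2) normc (fourier_coeff T n i) ^+ 2.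

Lemma sqsum_ge0 T n : 0 <= sqsum T n.
Proof. by apply: sumr_ge0 => i _; exact: sqr_ge0. Qed.

(** The extended sum is the supremum of its finite subsums, and the a priori estimates see the norm
    only through these. *)
Lemma sobolev_norm_sum (s : R) T : (sobolev_norm s T < +oo)%E ->
  exists G : R, forall l : seq Z2, uniq l -> (forall n, n \in l -> n != 0) ->
  \sum_(n <- l) freq n `^ (2 * s) * sqsum T n <= G.
Proof.
rewrite /sobolev_norm; set E := esum _ _ => h.
have t0 n : (0 <= (freq n `^ (2 * s) * sqsum T n)%:E)%E.
  by rewrite lee_fin mulr_ge0 ?powR_ge0 ?sqsum_ge0.
have E0 : (0 <= E)%E by apply: esum_ge0 => n _; exact: t0.
have Efin : (E < +oo)%E.
  by apply: lty_poweRy h; rewrite invr_neq0.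
exists (fine E) => l ul l0.
rewrite -lee_fin fineK ?ge0_fin_numE //; apply: esum_ge.
exists [set` l]; first by split => //= n /l0.
by rewrite -fsbig_seq // sumEFin.
Qed.

Lemma sobolev_norm_le (s G : R) T : 0 <= G ->
  (forall l : seq Z2, uniq l -> (forall n, n \in l -> n != 0) ->
     \sum_(n <- l) freq n `^ (2 * s) * sqsum T n <= G) ->
  (sobolev_norm s T <= (G `^ 2^-1)%:E)%E.
Proof.
move=> G0 H; rewrite /sobolev_norm; set E := esum _ _.
have t0 n : (0 <= (freq n `^ (2 * s) * sqsum T n)%:E)%E.
  by rewrite lee_fin mulr_ge0 ?powR_ge0 ?sqsum_ge0.
have E0 : (0 <= E)%E by apply: esum_ge0 => n _; exact: t0.
have EG : (E <= G%:E)%E.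
  apply: ge_ereal_sup => _ [X [fX X0] <-].
  rewrite fsbig_finite //= sumEFin lee_fin; apply: H; first exact: finmap.fset_uniq.
  by move=> n; rewrite in_fset_set // inE => /X0.
by rewrite -poweR_EFin; apply: gt0_ler_poweR; rewrite ?in_itv /= ?leey ?andbT ?lee_fin.
Qed.

(** The component of the coefficient along [n^perp], that is, the stream coefficient of the Leray
    projection of [T]; the gradient part is dropped. The value at [n = 0] is 0, the inverse of 0
    being 0. *)
Definition stream T n : R[i] := (((freq2 n)^-1)%:C)%C *
  \sum_(i < 2) ((perp n i)%:C)%C * fourier_coeff T n i.

Lemma normc_nsq (z : R[i]) : normc z ^+ 2 = nsq z.
Proof. by rewrite normc_sqr. Qed.

Lemma nsq_stream_le T n : nsq (stream T n) <= (freq2 n)^-1 * sqsum T n.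
Proof.
have [->|n0] := eqVneq n 0.
  rewrite /stream {1}/freq2 /= expr0n /= addr0 invr0 nsqM /nsq /= expr0n /= addr0 mul0r.
  by rewrite mulr_ge0 ?sqsum_ge0 // invr_ge0 freq2_ge0.
have r0 := freq2_gt0 n0 (R := R).
rewrite /stream /sqsum !sum_ord2 !normc_nsq perp0E perp1E.
move: (fourier_coeff _ _ _) (fourier_coeff _ _ _) => [a' b'] [a b].
rewrite nsqM /nsq !cE /= expr0n /= addr0 expr2 -mulrA ler_pM2l ?invr_gt0 //.
rewrite ler_pdivrMl // /freq2.
set p := n.1%:~R; set q := n.2%:~R; have := sqr_ge0 (p * a + q * a').
have := sqr_ge0 (p * b + q * b'); lra.
Qed.

Lemma stream_hermitian T : (forall i, torus_distribution (T i)) ->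
  hermitian (stream T).
Proof.
move=> TD n.
have F i : fourier_coeff T (- n) i = conjc (fourier_coeff T n i).
  have [Tlin _] := TD i; have t0 := @test_cst R 0.
  have Ec : (fun x => cos (phase (- n) x)) = (fun x => cos (phase n x)) :> (R * R -> R).
    by apply/funext => x; rewrite phase_opp cosN.
  have Es : (fun x => sin (phase (- n) x)) = (fun x => -1 * sinn n x + 0) :> (R * R -> R).
    by apply/funext => x; rewrite phase_opp sinN addr0 mulN1r.
  rewrite /fourier_coeff Ec Es Tlin //; last exact: test_sinn.
  rewrite (dist0 Tlin) addr0 mulN1r; apply: complex_ext; rewrite !cE //=.
  by rewrite mulrN opprK.
rewrite /stream freq2N !sum_ord2 !perpN !F.
by apply: complex_ext; rewrite !cE /=; ring.
Qed.

Lemma fourier_coeff0 T i : T i (fun=> 1) = 0 -> torus_distribution (T i) ->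
  fourier_coeff T 0 i = 0.
Proof.
move=> T1 [Tlin _]; rewrite /fourier_coeff.
have -> : (fun x => cos (phase 0 x)) = (fun=> 1) :> (R * R -> R).
  by apply/funext => x; rewrite /phase /= !mul0r addr0 cos0.
have -> : (fun x => sin (phase 0 x)) = (fun=> 0) :> (R * R -> R).
  by apply/funext => x; rewrite /phase /= !mul0r addr0 sin0.
by rewrite T1 (dist0 Tlin) mulr0 oppr0.
Qed.

(** Testing the divergence against [cosn n] and [sinn n] gives [n . T_n = 0], so [T_n] is a multiple
    of [n^perp] and the projection loses nothing. *)
Lemma fourier_coeff_stream T n i : (forall i, torus_distribution (T i)) ->
  divergence_free T -> n != 0 ->
  fourier_coeff T n i = ((perp n i)%:C)%C * stream T n.
Proof.
move=> TD div n0; have r0 := freq2_gt0 n0 (R := R).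
have tc := @test_cosn R n; have ts := @test_sinn R n; have t0 := @test_cst R 0.
have Ds j : T j ('D_(e_ j) (cosn n)) = - phase n (e_ j) * T j (sinn n).
  have [Tlin _] := TD j.
  rewrite (_ : 'D_(e_ j) (cosn n) = fun x => - phase n (e_ j) * sinn n x + 0).
    by rewrite Tlin // (dist0 Tlin) addr0.
  by apply/funext => x; rewrite derive_cosn addr0.
have Dc j : T j ('D_(e_ j) (sinn n)) = phase n (e_ j) * T j (cosn n).
  have [Tlin _] := TD j.
  rewrite (_ : 'D_(e_ j) (sinn n) = fun x => phase n (e_ j) * cosn n x + 0).
    by rewrite Tlin // (dist0 Tlin) addr0.
  by apply/funext => x; rewrite derive_sinn addr0.
have := div _ tc; rewrite sum_ord2 !Ds !phase_basis => /= d1.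
have := div _ ts; rewrite sum_ord2 !Dc !phase_basis => /= d2.
rewrite /stream sum_ord2 perp0E perp1E /fourier_coeff -/(cosn n) -/(sinn n).
have rE : freq2 n = n.1%:~R ^+ 2 + n.2%:~R ^+ 2 :> R by [].
have p0 : (2 * pi) ^- 2 != 0 :> R by rewrite invr_neq0 // expf_neq0 // mulf_neq0 // gt_eqF // pi_gt0.
have alg (p q r a b : R) : r != 0 -> r = p ^+ 2 + q ^+ 2 -> p * a + q * b = 0 ->
    a = - q * (r^-1 * (- q * a + p * b)) /\ b = p * (r^-1 * (- q * a + p * b)).
  move=> rn0 rE' H; split; apply: (mulfI rn0).
    have -> : r * (- q * (r^-1 * (- q * a + p * b))) = - q * (- q * a + p * b) by field.
    by rewrite rE'; have := congr1 ( *%R p) H; rewrite mulr0; lra.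
  have -> : r * (p * (r^-1 * (- q * a + p * b))) = p * (- q * a + p * b) by field.
  by rewrite rE'; have := congr1 ( *%R q) H; rewrite mulr0; lra.
have [|c0 c1] := alg _ _ _ ((2 * pi) ^- 2 * T ord0 (cosn n)) ((2 * pi) ^- 2 * T ord_max (cosn n)) (lt0r_neq0 r0) rE.
  by have := congr1 ( *%R ((2 * pi) ^- 2)) d2; rewrite mulr0; lra.
have [|s0 s1] := alg _ _ _ (- ((2 * pi) ^- 2 * T ord0 (sinn n))) (- ((2 * pi) ^- 2 * T ord_max (sinn n))) (lt0r_neq0 r0) rE.
  by have := congr1 ( *%R ((2 * pi) ^- 2)) d1; rewrite mulr0; lra.
elim/ord2P: i; rewrite ?perp0E ?perp1E; apply: complex_ext; rewrite !cE /=.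
- by rewrite {1}c0; ring.
- by rewrite {1}s0; ring.
- by rewrite {1}c1; ring.
- by rewrite {1}s1; ring.
Qed.

End SobolevSums.

(** * Space-time test functions *)

Section SpacetimeTests.
Context {R : realType}.
Local Notation T2 := (R * R)%type.
Local Notation T3 := (R * (R * R))%type.
Local Notation e_ := (@torus_basis R).
Local Notation test := (@torus_test R).
Implicit Types (phi : T3 -> R) (a b t : R) (v : T2) (w : T3) (j : 'I_2).

Lemma derive_shift {V : normedModType R} (g : V -> R) (v w : V) :
  (forall x, g (x + w) = g x) -> forall x, 'D_v g (x + w) = 'D_v g x.
Proof.
move=> pg x; rewrite /derive; set F := (X in lim (X @ _) = _).
set G := (X in _ = lim (X @ _)); suff -> : F = G by [].
by apply/funext => h; congr (_ *: (_ - _)); rewrite /= ?addrA pg.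
Qed.

Lemma spacetime_derive a b phi w : spacetime_test a b phi ->
  spacetime_test a b ('D_w phi).
Proof.
move=> [sp pp zp]; split.
- exact: smooth_derive.
- move=> t j x.
  have H y : phi (y + (0, (2 * pi) *: e_ j)) = phi y.
    by case: y => s y; rewrite -[in RHS](pp s j y); congr (phi (_, _)); rewrite /= addr0.
  have E : (t, x + (2 * pi) *: e_ j) = (t, x) + (0, (2 * pi) *: e_ j).
    by congr (_, _); rewrite /= addr0.
  by rewrite E; exact: derive_shift.
- move=> t x tab; transitivity ('D_w (fun=> 0) (t, x) : R); last by rewrite derive_cst.
  apply: (@near_eq_derive _ _ _ phi (fun=> 0) (t, x) w).
  have : open [set y : T3 | ~ (a <= y.1 <= b)].
    rewrite (_ : [set y | _] = fst @^-1` ([set s | s < a] `|` [set s | b < s])).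
      apply: open_comp; first by move=> y _; exact: cvg_fst.
      by apply: openU; [exact: open_lt|exact: open_gt].
    apply/seteqP; split => [y /= /negP|y /= H]; first by rewrite negb_and -!ltNge => /orP.
    by apply/negP; rewrite negb_and -!ltNge; apply/orP.
  rewrite openE => /(_ (t, x) tab); apply: filterS => -[s y] /= sab.
  exact: zp.
Qed.

Lemma spacetime_bounded a b phi : spacetime_test a b phi ->
  exists2 M, 0 <= M & forall y, `|phi y| <= M.
Proof.
move=> [sp pp zp].
have cK : compact (`[a, b]%classic `*` (`[0, 2 * pi]%classic `*` `[0, 2 * pi]%classic) : set T3).
  by apply: compact_setX; [|apply: compact_setX]; exact: segment_compact.
have := continuous_compact (continuous_subspaceT (smooth_continuous sp)) cK.
move=> /compact_bounded[M [_ HM]]; exists (`|M| + 1) => [|[t x]].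
  by rewrite addr_ge0.
have [tab|tab] := pselect (a <= t <= b); last by rewrite zp // normr0 addr_ge0.
have [y [y1 y2] /(_ _ _ (pp t)) ->] := reduce_to_cell x.
apply: (HM (`|M| + 1)); first by have := ler_norm M; lra.
exists (t, y) => //; split; first by rewrite /= in_itv.
split.
  by move: y1; rewrite /= !in_itv /= => /andP[-> /ltW].
by move: y2; rewrite /= !in_itv /= => /andP[-> /ltW].
Qed.

Lemma slice_iter_derive phi t (s : seq T2) x :
  iter_derive s (fun y => phi (t, y)) x =
  iter_derive [seq (0, v) | v <- s] phi (t, x).
Proof.
elim: s x => //= v s IH x; rewrite (funext IH) /derive.
set F := (X in lim (X @ _) = _).
set G := (X in _ = lim (X @ _)); suff -> : F = G by [].
apply/funext => h; congr (_ *: (iter_derive _ phi (_, _) - _)).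
by rewrite /= scaler0 add0r.
Qed.

Lemma slice_test a b phi t : spacetime_test a b phi -> test (fun x => phi (t, x)).
Proof.
move=> [sp pp _]; split; last exact: pp.
move=> s x; rewrite (funext (slice_iter_derive phi t s)).
apply: (@differentiable_comp _ _ _ _ (fun y : T2 => (t, y)) (iter_derive [seq (0, v) | v <- s] phi)).
  by apply: differentiable_pair; [exact: differentiable_cst|exact: ex_diff].
exact: sp.
Qed.

(** The induction peels off the derivative applied first, because a space derivative of [phi] is
    again a test function with the same support interval. The bound is uniform in [t]. *)
Lemma slice_derivatives_le a b phi N : spacetime_test a b phi ->
  exists2 M, 0 <= M & forall t, derivatives_le (range e_) N M (fun x => phi (t, x)).
Proof.
elim: N phi => [|N IH] phi tp.
  have [M M0 HM] := spacetime_bounded tp; exists M => // t s.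
  by rewrite leqn0 size_eq0 => /eqP -> _ x; exact: HM.
have [M M0 HM] := spacetime_bounded tp.
have [M1 M10 H1] := IH _ (spacetime_derive (space_dir ord0) tp).
have [M2 M20 H2] := IH _ (spacetime_derive (space_dir ord_max) tp).
exists (M + M1 + M2); first by rewrite !addr_ge0.
move=> t s; elim/last_ind: s => [_ _ x|s v _].
  by apply: (le_trans (HM _)); rewrite -addrA lerDl addr_ge0.
rewrite size_rcons ltnS => sN sE x.
have sE' v' : v' \in s -> range e_ v' by move=> vs; apply: sE; rewrite mem_rcons inE vs orbT.
have [j _ jv] : range e_ v by apply: sE; rewrite mem_rcons inE eqxx.
rewrite slice_iter_derive map_rcons /iter_derive foldr_rcons.
have := sE; move: jv => <- _; elim/ord2P: j.
  have := H1 t s sN sE' x; rewrite (slice_iter_derive ('D_(space_dir ord0) phi)) => h; apply: (le_trans h); lra.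
have := H2 t s sN sE' x; rewrite (slice_iter_derive ('D_(space_dir ord_max) phi)) => h; apply: (le_trans h); lra.
Qed.

Lemma time_is_derive a b phi x t : spacetime_test a b phi ->
  is_derive t 1 (fun s : R => phi (s, x)) ('D_time_dir phi (t, x)).
Proof.
move=> [sp _ _]; have E s : (0, x) + s *: time_dir = (s, x) :> T3.
  by rewrite /time_dir; congr (_, _); rewrite /= ?scaler0 ?addr0 // add0r [_ *: 1]mulr1.
have := @smooth_is_derive R _ phi (0, x) time_dir t sp.
by rewrite E; under eq_fun do rewrite E.
Qed.

Lemma time_mvt a b phi x s t : spacetime_test a b phi -> s <= t ->
  exists2 c, s <= c <= t & phi (t, x) - phi (s, x) = 'D_time_dir phi (c, x) * (t - s).
Proof.
move=> tp st.
have [] := @MVT_segment R (fun r => phi (r, x)) (fun r => 'D_time_dir phi (r, x)) s t st.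
- by move=> r _; exact: time_is_derive tp.
- apply: continuous_subspaceT => r; apply: differentiable_continuous.
  by apply/derivable1_diffP; have [] := time_is_derive x r tp.
by move=> c; rewrite in_itv => cst ->; exists c.
Qed.

Lemma time_lipschitz a b phi : spacetime_test a b phi ->
  exists2 M, 0 <= M & forall s t x, `|phi (t, x) - phi (s, x)| <= M * `|t - s|.
Proof.
move=> tp; have [M M0 HM] := spacetime_bounded (spacetime_derive time_dir tp).
exists M => // s t x; wlog st : s t / s <= t => [H|].
  by have [/H //|/ltW/H] := leP s t; rewrite distrC [X in M * X]distrC.
have [c _ ->] := time_mvt x tp st.
by rewrite normrM ler_wpM2r.
Qed.

Lemma time_taylor a b phi : spacetime_test a b phi ->
  exists2 M, 0 <= M & forall s t x,
  `|phi (t, x) - phi (s, x) - (t - s) * 'D_time_dir phi (s, x)| <= M * `|t - s| ^+ 2.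
Proof.
move=> tp; have [M M0 HM] := time_lipschitz (spacetime_derive time_dir tp).
exists M => // s t x; have [st|/ltW ts] := leP s t.
  have [c /andP[sc ct] ->] := time_mvt x tp st.
  rewrite mulrC -mulrBr normrM mulrC expr2 mulrA ler_wpM2r //.
  apply: (le_trans (HM _ _ _)); rewrite ler_wpM2l // !ger0_norm ?subr_ge0 // lerD2r //.
have [c /andP[tc cs] E] := time_mvt x tp ts.
have -> : phi (t, x) - phi (s, x) - (t - s) * 'D_time_dir phi (s, x) =
    (t - s) * ('D_time_dir phi (c, x) - 'D_time_dir phi (s, x)).
  by move: E; set D := derive _ (c, x) _; lra.
rewrite normrM mulrC expr2 mulrA ler_wpM2r //.
apply: (le_trans (HM _ _ _)); rewrite ler_wpM2l // distrC [leRHS]distrC !ger0_norm ?subr_ge0 //.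
by rewrite lerD2l lerN2.
Qed.

End SpacetimeTests.

(** * Bounded curves of functions on the torus *)

Section Curves.
Context {R : realType}.
Local Notation T2 := (R * R)%type.
Local Notation A := (@cell_area R).
Implicit Types (F G : R -> T2 -> R) (n : Z2).

(** Continuity in time is uniform in space and in the base time. Test functions and static functions
    have these properties, which are stable under products, so pairings with a velocity of this
    class are continuous in time. *)
Definition bdd_curve G := [/\ forall t, measurable_fun setT (G t),
  exists2 M, 0 <= M & forall t x, `|G t x| <= M &
  forall eps : R, 0 < eps -> exists2 tau : R, 0 < tau &
    forall s t, `|t - s| <= tau -> forall x, `|G t x - G s x| <= eps].

Lemma bdd_curve_meas G t : bdd_curve G -> bdd_meas (G t).
Proof. by move=> [mG [M _ GM] _]; split => //; exists M => x; exact: GM. Qed.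

Lemma bdd_curveM F G : bdd_curve F -> bdd_curve G ->
  bdd_curve (fun t x => F t x * G t x).
Proof.
move=> [mF [M M0 FM] cF] [mG [N N0 GN] cG]; split.
- by move=> t; exact: measurable_funM.
- by exists (M * N) => [|t x]; rewrite ?mulr_ge0 // normrM ler_pM.
move=> e e0; have S0 : 0 < M + N + 1 by rewrite ltr_wpDl // addr_ge0.
have e2 : 0 < e / (M + N + 1) by rewrite divr_gt0.
have [t1 t10 H1] := cF _ e2; have [t2 t20 H2] := cG _ e2.
exists (Num.min t1 t2) => [|s t]; first by rewrite lt_min t10.
rewrite le_min => /andP[h1 h2] x.
have -> : F t x * G t x - F s x * G s x = (F t x - F s x) * G t x + F s x * (G t x - G s x) by ring.
apply: (le_trans (ler_normD _ _)); rewrite !normrM.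
apply: (@le_trans _ _ (e / (M + N + 1) * N + M * (e / (M + N + 1)))).
  by apply: lerD; apply: ler_pM => //; [exact: H1|exact: H2].
rewrite mulrC -mulrDl addrC mulrCA ler_piMr ?(ltW e0) //.
by rewrite ler_pdivrMr // mul1r lerDl.
Qed.

Lemma bdd_curve_static (g : T2 -> R) : bdd_meas g -> bdd_curve (fun=> g).
Proof.
move=> [mg [M gM]]; split => //.
  by exists M => //; exact: le_trans (normr_ge0 _) (gM 0).
by move=> e e0; exists 1 => // s t _ x; rewrite subrr normr0 ltW.
Qed.

Lemma bdd_curve_test a b phi : spacetime_test a b phi ->
  bdd_curve (fun t x => phi (t, x)).
Proof.
move=> tp; split.
- by move=> t; have [] := test_bdd_meas (slice_test t tp).
- by have [M M0 HM] := spacetime_bounded tp; exists M.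
move=> e e0; have [M M0 HM] := time_lipschitz tp.
have M1 : 0 < M + 1 by rewrite ltr_wpDl.
exists (e / (M + 1)) => [|s t ts x]; first by rewrite divr_gt0.
apply: (le_trans (HM _ _ _)); apply: (le_trans (ler_wpM2l M0 ts)).
by rewrite mulrCA ler_piMr ?(ltW e0) // ler_pdivrMr // mul1r lerDl.
Qed.

Lemma torus_int_continuous G : bdd_curve G -> continuous (fun t => torus_int (G t)).
Proof.
move=> bG; have [_ _ cG] := bG; move=> s; apply/cvgrPdist_le => e e0.
have A0 := @cell_area_gt0 R; have [tau t0 H] := cG _ (divr_gt0 e0 A0).
near=> t; rewrite distrC -torus_intB; try exact: bdd_curve_meas.
rewrite -(divfK (lt0r_neq0 A0) e); apply: normr_torus_int_le.
  by apply: bdd_measB; exact: bdd_curve_meas.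
apply: H; rewrite distrC; near: t.
by have := (@cvg_id _ (nbhs s)); move/cvgrPdist_le => /(_ _ t0).
Unshelve. all: by end_near. Qed.

End Curves.

(** * Integration in time *)

Section TimeIntegral.
Context {R : realType}.
Local Notation mu := (@lebesgue_measure R).
Implicit Types (h k F : R -> R) (a b c : R).

(** For [a > 0] the integral over positive times reduces to that of a continuous function over a
    compact interval, so integrability is settled once and for all. *)
Definition time_supported a b h := continuous h /\ forall t, ~ (a <= t <= b) -> h t = 0.

Lemma time_supported_widen a b a' b' h : a' <= a -> b <= b' ->
  time_supported a b h -> time_supported a' b' h.
Proof.
move=> aa bb [ch zh]; split => // t tab; apply: zh => /andP[at_ tb].
by apply: tab; rewrite (le_trans aa) // (le_trans tb).
Qed.

Lemma time_int_segment a b h : 0 < a -> time_supported a b h ->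
  time_int h = \int[mu]_(t in `[a, b]) h t.
Proof.
move=> a0 [ch zh]; rewrite /time_int /Rintegral integral_mkcond [in RHS]integral_mkcond.
congr fine; apply: eq_integral => t _; rewrite /patch.
have [tab|tab] := pselect (a <= t <= b); last by rewrite zh //; do 2 case: ifP => //.
rewrite !mem_set //= in_itv //= andbT.
by case/andP: tab => /(lt_le_trans a0).
Qed.

Lemma segment_integrable a b h : continuous h -> mu.-integrable `[a, b] (EFin \o h).
Proof.
move=> ch; apply: continuous_compact_integrable; first exact: segment_compact.
exact: continuous_subspaceT.
Qed.

Lemma time_supported_lin a b c h k : time_supported a b h -> time_supported a b k ->
  time_supported a b (fun t => c * h t + k t).
Proof.
move=> [ch zh] [ck zk]; split => t; last by move=> tab; rewrite zh // zk // mulr0 addr0.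
by apply: cvgD; [apply: cvgM; [exact: cvg_cst|exact: ch]|exact: ck].
Qed.

Lemma time_supported0 a b : time_supported a b (fun=> 0).
Proof. by split => // t; exact: cvg_cst. Qed.

Lemma time_supportedZ a b c h : time_supported a b h ->
  time_supported a b (fun t => c * h t).
Proof.
move=> /(time_supported_lin c) /(_ (time_supported0 a b)); congr time_supported.
by apply/funext => t; rewrite addr0.
Qed.

Lemma time_supportedD a b h k : time_supported a b h -> time_supported a b k ->
  time_supported a b (fun t => h t + k t).
Proof.
move=> sh sk; have := time_supported_lin 1 sh sk; congr time_supported.
by apply/funext => t; rewrite mul1r.
Qed.

Lemma time_supported_sum (I : Type) (s : seq I) a b (H : I -> R -> R) :
  (forall i, time_supported a b (H i)) ->
  time_supported a b (fun t => \sum_(i <- s) H i t).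
Proof.
move=> sH; elim: s => [|i s IH].
  by under eq_fun do rewrite big_nil; exact: time_supported0.
by under eq_fun do rewrite big_cons; exact: time_supportedD.
Qed.

Lemma time_int_lin a b c h k : 0 < a -> time_supported a b h -> time_supported a b k ->
  time_int (fun t => c * h t + k t) = c * time_int h + time_int k.
Proof.
move=> a0 sh sk; rewrite (time_int_segment a0 (time_supported_lin c sh sk)).
rewrite (time_int_segment a0 sh) (time_int_segment a0 sk).
rewrite RintegralD //; last first.
- by apply: segment_integrable; case: sk.
- by apply: segment_integrable; have [] := time_supportedZ c sh.
by rewrite RintegralZl //; apply: segment_integrable; case: sh.
Qed.

Lemma time_int0 : time_int (fun _ : R => 0) = 0 :> R.
Proof.
by have := time_int_lin 1 (ltr01 : 0 < 1 :> R) (time_supported0 1 1) (time_supported0 1 1);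
  under eq_fun do rewrite mulr0 addr0; lra.
Qed.

Lemma time_intZ a b c h : 0 < a -> time_supported a b h ->
  time_int (fun t => c * h t) = c * time_int h.
Proof.
move=> a0 sh; have := time_int_lin c a0 sh (time_supported0 a b).
by rewrite time_int0 addr0; under eq_fun do rewrite addr0.
Qed.

Lemma time_intD a b h k : 0 < a -> time_supported a b h -> time_supported a b k ->
  time_int (fun t => h t + k t) = time_int h + time_int k.
Proof.
move=> a0 sh sk; have := time_int_lin 1 a0 sh sk.
by rewrite mul1r; under eq_fun do rewrite mul1r.
Qed.

Lemma time_int_sum (I : Type) (s : seq I) a b (H : I -> R -> R) : 0 < a ->
  (forall i, time_supported a b (H i)) ->
  time_int (fun t => \sum_(i <- s) H i t) = \sum_(i <- s) time_int (H i).
Proof.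
move=> a0 sH; elim: s => [|i s IH].
  by rewrite big_nil -[RHS]time_int0; congr time_int; apply/funext => t; rewrite big_nil.
rewrite big_cons -IH -(time_intD a0 (sH i) (time_supported_sum s sH)).
by congr time_int; apply/funext => t; rewrite big_cons.
Qed.

Lemma normr_time_int_le a b h (B : R) : 0 < a -> time_supported a b h ->
  (forall t, `|h t| <= B) -> `|time_int h| <= B * `|b - a|.
Proof.
move=> a0 sh hB; rewrite (time_int_segment a0 sh); have [ch _] := sh.
have [ab|ba] := leP a b; last first.
  rewrite set_itv_ge ?Rintegral_set0 ?normr0 ?mulr_ge0 ?(le_trans (normr_ge0 _) (hB 0)) //.
  by rewrite bnd_simp -ltNge.
have mS : measurable (`[a, b]%classic : set R) by exact: measurable_itv.
have C c : mu.-integrable `[a, b] (EFin \o fun=> c) by apply: segment_integrable => t; exact: cvg_cst.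
have mE : mu `[a, b]%classic = (b - a)%:E.
  rewrite lebesgue_measure_itv /= lte_fin; case: ltP => // ba.
  by rewrite (_ : b = a) ?subrr //; apply/eqP; rewrite eq_le ba.
have I c : \int[mu]_(t in `[a, b]) c = c * (b - a) :> R.
  by rewrite Rintegral_cst //; exact: (congr1 (fun z => c * fine z) mE).
have -> : `|b - a| = b - a by rewrite ger0_norm // subr_ge0.
rewrite ler_norml -mulNr -!I; apply/andP; split; apply: le_Rintegral => //;
  try exact: segment_integrable.
- by move=> t _; have := hB t; rewrite ler_norml => /andP[].
- by move=> t _; have := hB t; rewrite ler_norml => /andP[].
Qed.

Lemma time_int_derive a b F h : 0 < a -> time_supported a b h ->
  (forall t, ~ (a <= t <= b) -> F t = 0) ->
  (forall t : R, 0 < t -> is_derive t 1 F (h t)) -> time_int h = 0.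
Proof.
move=> a0 sh zF dF; have [ch zh] := sh.
have [ba|ab] := ltP b a.
  rewrite -[RHS]time_int0; congr time_int; apply/funext => t; apply: zh => /andP[ta tb]; lra.
(* At [a / 2] and [b + 1] the function [F] vanishes, and the interval between them stays in the
   positive times, where [F] is differentiable. *)
have a2 : 0 < a / 2 by rewrite divr_gt0.
have ab' : a / 2 < b + 1 by lra.
have sh' : time_supported (a / 2) (b + 1) h by apply: time_supported_widen sh; lra.
rewrite (time_int_segment a2 sh') /Rintegral.
have cF (t : R) : 0 < t -> F s @[s --> t] --> F t.
  move=> t0; apply: differentiable_continuous.
  by apply/derivable1_diffP; have [] := dF t t0.
rewrite (@continuous_FTC2 _ h F) //.
- by rewrite !zF ?subee //= ?subrr //; lra.
- exact: continuous_subspaceT.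
- split.
  + by move=> t; rewrite in_itv /= => /andP[t1 _]; have [] := dF t (lt_trans a2 t1).
  + by apply: cvg_at_right_filter; exact: cF.
  + by apply: cvg_at_left_filter; apply: cF; lra.
- move=> t; rewrite in_itv /= => /andP[t1 _]; rewrite derive1E.
  by have [_] := dF t (lt_trans a2 t1).
Qed.

Lemma is_derive_small_o F (t l : R) :
  (forall eps : R, 0 < eps -> exists2 tau : R, 0 < tau &
     forall s, `|s - t| <= tau -> `|F s - F t - (s - t) * l| <= eps * `|s - t|) ->
  is_derive t 1 F l.
Proof.
move=> H; have C : h^-1 *: (F (h *: 1 + t) - F t) @[h --> (0 : R)^'] --> (l : R^o).
  apply/cvgrPdist_le => e e0; have [tau t0 Ht] := H e e0.
  near=> h.
  have h0 : h != 0 by near: h; exact: nbhs_dnbhs_neq.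
  have ht : `|h| <= tau.
    by near: h; exact: dnbhs0_le.
  have hE : h *: (1 : R) = h by exact: mulr1.
  have := Ht (h + t); rewrite addrK => /(_ ht) Hh.
  rewrite hE -normrN opprB.
  have -> : h^-1 *: (F (h + t) - F t) - l = h^-1 * (F (h + t) - F t - h * l).
    by rewrite /GRing.scale /=; field.
  by rewrite normrM normrV ?unitfE // ler_pdivrMl ?normr_gt0 // (mulrC `|h| e).
split; first by apply/cvg_ex; exists l.
exact: cvg_lim.
Unshelve. all: by end_near. Qed.

End TimeIntegral.

(** * Momentum equation and pressure *)

Section ComplexCurves.
Context {R : realType}.
Local Notation T2 := (R * R)%type.
Local Notation T3 := (R * (R * R))%type.
Local Notation A := (@cell_area R).
Local Notation e_ := (@torus_basis R).
Implicit Types (z w : R -> R[i]) (n : Z2) (j : 'I_2) (a b : R) (phi : T3 -> R).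

(** First-order expansion at [s], in the form that [galerkin_limit] delivers. *)
Definition cderivable z (s : R) (l : R[i]) := forall eps : R, 0 < eps ->
  exists2 tau : R, 0 < tau & forall t, `|t - s| <= tau ->
    normc (z t - z s - ((t - s)%:C)%C * l) <= eps * `|t - s|.

Lemma cderivable_Re z s l : cderivable z s l -> is_derive s 1 (fun t => Re (z t)) (Re l).
Proof.
move=> H; apply: is_derive_small_o => e /H[tau t0 Ht]; exists tau => // t ts.
have -> : Re (z t) - Re (z s) - (t - s) * Re l = Re (z t - z s - ((t - s)%:C)%C * l).
  by rewrite !cE /=; ring.
by apply: le_trans (Ht _ ts); exact: normr_Re_le.
Qed.

Lemma cderivable_Im z s l : cderivable z s l -> is_derive s 1 (fun t => Im (z t)) (Im l).
Proof.
move=> H; apply: is_derive_small_o => e /H[tau t0 Ht]; exists tau => // t ts.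
have -> : Im (z t) - Im (z s) - (t - s) * Im l = Im (z t - z s - ((t - s)%:C)%C * l).
  by rewrite !cE /=; ring.
by apply: le_trans (Ht _ ts); exact: normr_Im_le.
Qed.

Lemma cderivable_dotc z w s l m : cderivable z s l -> cderivable w s m ->
  is_derive s 1 (fun t => dotc (z t) (w t)) (dotc l (w s) + dotc (z s) m).
Proof.
move=> zl wm; have [d1 d2] := is_deriveD
  (is_deriveM (cderivable_Re zl) (cderivable_Re wm))
  (is_deriveM (cderivable_Im zl) (cderivable_Im wm)).
by split; [exact: d1|rewrite d2 /dotc /GRing.scale /=; ring].
Qed.

Lemma cderivableM z s l (c : R[i]) : cderivable z s l ->
  cderivable (fun t => c * z t) s (c * l).
Proof.
move=> H e e0; have c1 : 0 < normc c + 1 by rewrite ltr_wpDl // normc_ge0.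
have [tau t0 Ht] := H _ (divr_gt0 e0 c1); exists tau => // t ts.
have -> : c * z t - c * z s - ((t - s)%:C)%C * (c * l) =
  c * (z t - z s - ((t - s)%:C)%C * l) by ring.
rewrite ComplexField.Normc.normcM; apply: (le_trans (ler_wpM2l (normc_ge0 _) (Ht _ ts))).
rewrite mulrA ler_wpM2r // mulrCA ler_piMr ?(ltW e0) //.
by rewrite ler_pdivrMr // mul1r lerDl.
Qed.

Lemma cderivable_cst (c : R[i]) s : cderivable (fun=> c) s 0.
Proof.
move=> e e0; exists 1 => // t _; rewrite subrr mulr0 subr0 ComplexField.Normc.normc0.
by rewrite mulr_ge0 // ltW.
Qed.

Definition ccontinuous z := continuous (fun t => Re (z t)) /\ continuous (fun t => Im (z t)).

Lemma ccontinuous_cst (c : R[i]) : ccontinuous (fun=> c).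
Proof. by split => t; exact: cvg_cst. Qed.

Lemma ccontinuousD z w : ccontinuous z -> ccontinuous w -> ccontinuous (fun t => z t + w t).
Proof.
by move=> [z1 z2] [w1 w2]; split => t; under eq_fun do rewrite ?ReD ?ImD;
  rewrite ?ReD ?ImD; apply: cvgD; [exact: z1|exact: w1|exact: z2|exact: w2].
Qed.

Lemma ccontinuousM (c : R[i]) z : ccontinuous z -> ccontinuous (fun t => c * z t).
Proof.
move=> [z1 z2]; split.
  rewrite (_ : (fun t => _) = fun t => Re c * Re (z t) - Im c * Im (z t)); last first.
    by apply/funext => t; rewrite !cE.
  by move=> t; apply: cvgB; apply: cvgM; try exact: cvg_cst; [exact: z1|exact: z2].
rewrite (_ : (fun t => _) = fun t => Re c * Im (z t) + Im c * Re (z t)); last first.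
  by apply/funext => t; rewrite !cE.
by move=> t; apply: cvgD; apply: cvgM; try exact: cvg_cst; [exact: z2|exact: z1].
Qed.

Lemma ccontinuous_sum (I : Type) (r : seq I) (F : I -> R -> R[i]) :
  (forall i, ccontinuous (F i)) -> ccontinuous (fun t => \sum_(i <- r) F i t).
Proof.
move=> cF; elim: r => [|i r IH].
  by under eq_fun do rewrite big_nil; exact: ccontinuous_cst.
by under eq_fun do rewrite big_cons; exact: ccontinuousD.
Qed.

Lemma dotc_continuous z w : ccontinuous z -> ccontinuous w ->
  continuous (fun t => dotc (z t) (w t)).
Proof.
move=> [z1 z2] [w1 w2] t; apply: cvgD; apply: cvgM.
- exact: z1. - exact: w1. - exact: z2. - exact: w2.
Qed.

Lemma fourier_ccontinuous n (G : R -> T2 -> R) : bdd_curve G ->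
  ccontinuous (fun t => fourier n (G t)).
Proof.
move=> bG; split.
  apply: (@torus_int_continuous _ (fun t x => G t x * cosn n x)).
  by apply: bdd_curveM => //; apply: bdd_curve_static; exact: bdd_cosn.
have H : continuous (fun t => torus_int (fun x => G t x * sinn n x)).
  apply: (@torus_int_continuous _ (fun t x => G t x * sinn n x)).
  by apply: bdd_curveM => //; apply: bdd_curve_static; exact: bdd_sinn.
by move=> t; apply: cvgN; exact: H.
Qed.

Lemma fourier_slice_derive a b phi n j t : spacetime_test a b phi ->
  fourier n (fun x => 'D_(space_dir j) phi (t, x)) =
  'i%C * ((phase n (e_ j))%:C)%C * fourier n (fun x => phi (t, x)).
Proof.
move=> tp; rewrite -(fourier_derive _ _ (slice_test t tp)); congr fourier.
apply/funext => x; exact: esym (@slice_iter_derive R phi t [:: e_ j] x).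
Qed.

Lemma fourier_slice_supp a b phi n t : spacetime_test a b phi -> ~ (a <= t <= b) ->
  fourier n (fun x => phi (t, x)) = 0.
Proof.
move=> [_ _ zp] tab; rewrite -[RHS](fourier_cst0 n); congr fourier.
by apply/funext => x; rewrite zp.
Qed.

Lemma fourier_slice_cderivable a b phi n s : spacetime_test a b phi ->
  cderivable (fun t => fourier n (fun x => phi (t, x))) s
             (fourier n (fun x => 'D_time_dir phi (s, x))).
Proof.
move=> tp e e0; have [M M0 HM] := time_taylor tp.
have A0 := @cell_area_gt0 R; have C0 : 0 < 2 * A * (M + 1).
  by apply: mulr_gt0; [exact: mulr_gt0|exact: ltr_wpDl].
exists (e / (2 * A * (M + 1))) => [|t ts]; first by rewrite divr_gt0.
have b1 r : bdd_meas (fun x => phi (r, x)) by exact: test_bdd_meas (slice_test r tp).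
have b2 : bdd_meas (fun x => 'D_time_dir phi (s, x)).
  exact: test_bdd_meas (slice_test s (spacetime_derive time_dir tp)).
rewrite -fourierB // -fourierZ // -fourierB; [|exact: bdd_measB|exact: bdd_measZ].
have b3 : bdd_meas (fun x => phi (t, x) - phi (s, x) - (t - s) * 'D_time_dir phi (s, x)).
  by apply: bdd_measB; [exact: bdd_measB|exact: bdd_measZ].
apply: (le_trans (normc_fourier_le n b3 (HM s t))).
have -> : 2 * (M * `|t - s| ^+ 2 * A) = (2 * A * M * `|t - s|) * `|t - s| by ring.
rewrite ler_wpM2r //; apply: (@le_trans _ _ (2 * A * (M + 1) * `|t - s|)).
  by rewrite ler_wpM2r // ler_pM2l ?lerDl //; exact: mulr_gt0.
by rewrite mulrC -ler_pdivlMr.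
Qed.

Lemma dotc_time_supported a b phi n z : spacetime_test a b phi -> ccontinuous z ->
  time_supported a b (fun t => dotc (z t) (fourier n (fun x => phi (t, x)))).
Proof.
move=> tp cz; split; last first.
  by move=> t tab; rewrite (fourier_slice_supp _ tp tab) /dotc /= !mulr0 addr0.
apply: dotc_continuous => //; apply: fourier_ccontinuous; exact: bdd_curve_test tp.
Qed.

Lemma torus_int_time_supported a b phi (F : R -> T2 -> R) : spacetime_test a b phi ->
  bdd_curve F -> time_supported a b (fun t => torus_int (fun x => F t x * phi (t, x))).
Proof.
move=> tp bF; split.
  apply: (@torus_int_continuous _ (fun t x => F t x * phi (t, x))).
  by apply: bdd_curveM => //; exact: bdd_curve_test tp.
move=> t tab; have [_ _ zp] := tp.
rewrite (_ : (fun x => _) = fun=> 0) ?torus_int_cst ?mul0r //.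
by apply/funext => x; rewrite zp // mulr0.
Qed.

(** Parseval's identity slice by slice, uniform in time since [fsum_cvg] sees a slice only through
    derivative bounds common to all of them. *)
Lemma torus_int_fourier_unif a b phi (F : R -> T2 -> R) (eps : R) : spacetime_test a b phi ->
  bdd_curve F -> 0 < eps -> exists K0, forall K, (K0 <= K)%N -> forall t,
  `|torus_int (fun x => F t x * phi (t, x)) -
    A^-1 * \sum_(n <- box K) dotc (fourier n (F t)) (fourier n (fun x => phi (t, x)))| <= eps.
Proof.
move=> tp bF e0; have [_ [M M0 FM] _] := bF; have A0 := @cell_area_gt0 R.
have [M' M'0 HM'] := slice_derivatives_le 4 tp.
have m1 : 0 < M + 1 by exact: ltr_wpDl.
have m2 : 0 < M' + 1 by exact: ltr_wpDl.
have C0 : 0 < (M + 1) * (M' + 1) * A by apply: mulr_gt0 => //; exact: mulr_gt0.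
have [K0 HK0] := @fsum_cvg R _ (divr_gt0 e0 C0).
exists K0 => K K0K t; have tt := slice_test t tp.
have bt := test_bdd_meas tt; have bFt := bdd_curve_meas t bF.
pose g x := phi (t, x).
have TD := @bdd_meas_dist R (F t) bFt.
have := dist_fsum g K TD; under eq_bigr do rewrite dist_fourier_bdd.
move=> <-; have bs := test_bdd_meas (test_fsum g K).
rewrite -torus_intB; [|exact: bdd_measM..].
rewrite -[eps](divfK (lt0r_neq0 A0)); apply: normr_torus_int_le.
  by apply: bdd_measB; exact: bdd_measM.
move=> x; rewrite -mulrBr normrM.
have h := HK0 _ K0K g M' tt (HM' t) x.
apply: (le_trans (ler_pM _ _ (FM t x) h)) => //.
rewrite ler_pdivlMr //.
have -> : M * (eps / ((M + 1) * (M' + 1) * A) * M') * A =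
  eps * (M * M' / ((M + 1) * (M' + 1))).
  by field; rewrite !gt_eqF.
rewrite ler_piMr ?(ltW e0) // ler_pdivrMr ?(mulr_gt0 m1 m2) // mul1r.
by apply: ler_pM => //; rewrite lerDl.
Qed.

Lemma dist_fourier_unif a b phi T (eps : R) : spacetime_test a b phi ->
  torus_distribution T -> 0 < eps -> exists K0, forall K, (K0 <= K)%N -> forall t,
  `|T (fun x => phi (t, x)) -
    A^-1 * \sum_(n <- box K) dotc (dist_fourier T n) (fourier n (fun x => phi (t, x)))| <= eps.
Proof.
move=> tp TD e0; have [N HN] := dist_fsum_cvg TD.
have [M M0 HM] := slice_derivatives_le N tp.
have M1 : 0 < M + 1 by rewrite ltr_wpDl.
have [K0 HK0] := HN _ (divr_gt0 e0 M1); exists K0 => K K0K t.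
rewrite -dist_fsum //; apply: (le_trans (HK0 _ K0K _ M (slice_test t tp) (HM t))).
by rewrite mulrAC ler_pdivrMr // ler_wpM2l ?(ltW e0) // lerDl.
Qed.

(** Continuity in time holds because the pairing is a uniform limit of finite sums of continuous
    functions. *)
Lemma dist_time_supported a b phi T : spacetime_test a b phi ->
  torus_distribution T -> time_supported a b (fun t => T (fun x => phi (t, x))).
Proof.
move=> tp TD; split; last first.
  move=> t tab; have [_ _ zp] := tp; rewrite -[RHS](dist0 TD.1); congr T.
  by apply/funext => x; rewrite zp.
apply: continuous_uniform_approx => e e0; have [K HK] := dist_fourier_unif tp TD e0.
exists (fun t => A^-1 * \sum_(n <- box K) dotc (dist_fourier T n) (fourier n (fun x => phi (t, x)))).
split; last by move=> t; exact: HK.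
have [c _] : time_supported a b (fun t => A^-1 * \sum_(n <- box K) dotc (dist_fourier T n) (fourier n (fun x => phi (t, x)))).
  apply: time_supportedZ; apply: time_supported_sum => n.
  by apply: dotc_time_supported => //; exact: ccontinuous_cst.
exact: c.
Qed.

End ComplexCurves.

(** [n] and [n^perp] are orthogonal, both of squared length [|n|^2]. *)
Lemma orthogonal_split {R : realType} (n : Z2) (Z : 'I_2 -> R[i]) i : n != 0 ->
  Z i = ((phase n (torus_basis i) * (freq2 n)^-1)%:C)%C *
          (\sum_(k < 2) ((phase n (torus_basis k))%:C)%C * Z k) +
        ((perp n i * (freq2 n)^-1)%:C)%C * (\sum_(k < 2) ((perp n k)%:C)%C * Z k).
Proof.
move=> n0; have r0 := freq2_gt0 n0 (R := R); have rE : freq2 n = n.1%:~R ^+ 2 + n.2%:~R ^+ 2 :> R by [].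
rewrite !sum_ord2 !phase_basis perp0E perp1E.
have r1 : freq2 n != 0 :> R by exact: lt0r_neq0.
have alg (p q r : R) (z w : R[i]) : r != 0 -> r = p ^+ 2 + q ^+ 2 ->
    (z = ((p * r^-1)%:C)%C * ((p%:C)%C * z + (q%:C)%C * w) +
        ((- q * r^-1)%:C)%C * (((- q)%:C)%C * z + (p%:C)%C * w)) /\
    (w = ((q * r^-1)%:C)%C * ((p%:C)%C * z + (q%:C)%C * w) +
        ((p * r^-1)%:C)%C * (((- q)%:C)%C * z + (p%:C)%C * w)).
  move=> rn0 rE'; case: z w => [a b] [a' b'].
  rewrite rE' in rn0 *.
  by split; apply: complex_ext; rewrite !cE /=; field.
have [h0 h1] := alg n.1%:~R n.2%:~R (freq2 n) (Z ord0) (Z ord_max) r1 rE.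
by elim/ord2P: i; rewrite ?phase_basis ?perp0E ?perp1E /=.
Qed.

Lemma fourier_coeff_dist_fourier {R : realType} (f : @vector_dist R) n i :
  fourier_coeff f n i = ((cell_area^-1)%:C)%C * dist_fourier (f i) n.
Proof. by apply: complex_ext; rewrite !cE /= !mul0r ?addr0 ?subr0 // -mulrN. Qed.

Lemma velocity_algebra {R : rcfType} (A P nr ri : R) (p n : 'I_2 -> R) (F : 'I_2 -> R[i])
  (N : 'I_2 -> 'I_2 -> R[i]) (z : R[i]) : A != 0 ->
  (A%:C)%C * ((P%:C)%C * (((- nr)%:C)%C * z + ((- ri)%:C)%C * ('i%C *
    \sum_(i < 2) \sum_(j < 2) ((p i * n j)%:C)%C * ((A^-1%:C)%C * N i j)) +
    (ri%:C)%C * \sum_(i < 2) (p i)%:C%C * ((A^-1%:C)%C * F i))) =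
  ((- nr)%:C)%C * ((A%:C)%C * ((P%:C)%C * z)) +
  ((P * ri)%:C)%C * \sum_(k < 2) ((p k)%:C)%C *
    (F k - 'i%C * \sum_(j < 2) ((n j)%:C)%C * N k j).
Proof.
move=> A0; have hA : (A%:C)%C * (A^-1%:C)%C = 1 :> R[i].
  by rewrite -rmorphM /= mulfV.
rewrite !sum_ord2 !rmorphM !rmorphN /=.
set a := (A%:C)%C in hA *; set a' := (_^-1%:C)%C in hA *.
ring: hA.
Qed.

(** The identity behind [mode_balance] at one time and one mode. [S] and [T] are the components of
    the residual along [n] and [n^perp]: the pressure cancels [S], and [T] drives the velocity. What
    remains is minus the time derivative of the pairing of the velocity mode [U] with the test mode
    [c]. *)
Lemma mode_algebra {R : rcfType} (nu r ri X q0 q1 qi pi y z v : R) (U c N0 N1 S T F : R[i]) :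
  F = ((qi * ri)%:C)%C * S + ((pi * ri)%:C)%C * T +
      'i%C * ((q0%:C)%C * N0 + (q1%:C)%C * N1) ->
  r = q0 ^+ 2 + q1 ^+ 2 ->
  y = dotc N0 ('i%C * (q0%:C)%C * c) + dotc N1 ('i%C * (q1%:C)%C * c) ->
  z = dotc U ('i%C * (q0%:C)%C * ('i%C * (q0%:C)%C * c)) +
      dotc U ('i%C * (q1%:C)%C * ('i%C * (q1%:C)%C * c)) ->
  v = dotc ((- 'i%C * (ri%:C)%C) * S) ('i%C * (qi%:C)%C * c) ->
  - X - y - nu * z - dotc F c - v =
  -1 * (dotc (((- (nu * r))%:C)%C * U + ((pi * ri)%:C)%C * T) c + X).
Proof.
have dotcDl Y Z V : dotc (Y + Z) V = dotc Y V + dotc Z V by rewrite /dotc !cE; ring.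
have scale x Y Z : dotc ((x%:C)%C * Y) Z = x * dotc Y Z by rewrite /dotc !cE /=; ring.
have dotci x Y Z : dotc Y ('i%C * (x%:C)%C * Z) = - (x * dotc ('i%C * Y) Z).
  by rewrite /dotc !cE /=; ring.
have dotcii x Y Z : dotc Y ('i%C * (x%:C)%C * ('i%C * (x%:C)%C * Z)) = - (x ^+ 2 * dotc Y Z).
  by rewrite /dotc !cE /=; ring.
have iS : 'i%C * ((- 'i%C * (ri%:C)%C) * S) = (ri%:C)%C * S.
  by apply: complex_ext; rewrite !cE /=; ring.
have iN x Y : 'i%C * ((x%:C)%C * Y) = (x%:C)%C * ('i%C * Y) by ring.
have iD Y Z : 'i%C * (Y + Z) = 'i%C * Y + 'i%C * Z by ring.
by move=> -> rE -> -> ->; rewrite !dotcii !dotci iS iD !iN !dotcDl !scale rE; ring.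
Qed.

(** * The balance of a single Fourier mode *)

Section Momentum.
Context {R : realType}.
Local Notation T2 := (R * R)%type.
Local Notation T3 := (R * (R * R))%type.
Local Notation A := (@cell_area R).
Local Notation e_ := (@torus_basis R).
Implicit Types (n : Z2) (i j k : 'I_2) (a b t : R) (phi : T3 -> R).
Variables (nu : R) (u : R -> @vector_field R) (psi : R -> Z2 -> R[i])
  (f : @vector_dist R) (Cf : R).
Hypothesis uC : forall i, bdd_curve (fun t y => u t y i).
Hypothesis fcu : forall t i n,
  fourier n (fun y => u t y i) = (A%:C)%C * (((perp n i)%:C)%C * psi t n).
Hypothesis psi0 : forall t, psi t 0 = 0.
Hypothesis fD : forall i, torus_distribution (f i).
Hypothesis f0 : forall i, dist_fourier (f i) 0 = 0.
Hypothesis fCf : forall i n, n != 0 -> normc (dist_fourier (f i) n) <= Cf * freq n.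
Hypothesis Cf0 : 0 <= Cf.
Hypothesis dpsi : forall n s, n != 0 -> 0 < s -> cderivable (fun t => psi t n) s
  (((- (nu * freq2 n))%:C)%C * psi s n +
   ((- (freq2 n)^-1)%:C)%C * ('i%C * \sum_(i < 2) \sum_(j < 2)
      ((perp n i * phase n (e_ j))%:C)%C *
      ((A^-1%:C)%C * fourier n (fun y => u s y j * u s y i))) + stream f n).

Let prod i j t (y : T2) : R := u t y j * u t y i.
Let prodC i j : bdd_curve (prod i j).
Proof. exact: bdd_curveM. Qed.

(* [(2 pi)^2] times the Fourier coefficients of [f - div (u x u)], and of the pressure it generates. *)
Definition residual i n t : R[i] :=
  dist_fourier (f i) n - 'i%C * \sum_(j < 2) ((phase n (e_ j))%:C)%C * fourier n (prod i j t).

Definition pressure_coef n t : R[i] :=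
  (- 'i%C * ((freq2 n)^-1%:C)%C) * \sum_(i < 2) ((phase n (e_ i))%:C)%C * residual i n t.

Lemma residual_ccontinuous i n : ccontinuous (residual i n).
Proof.
have -> : residual i n = fun t => dist_fourier (f i) n + (- 'i%C) *
    \sum_(j < 2) ((phase n (e_ j))%:C)%C * fourier n (prod i j t).
  by apply/funext => t; rewrite mulNr.
apply: ccontinuousD; first exact: ccontinuous_cst.
apply: ccontinuousM; apply: ccontinuous_sum => j; apply: ccontinuousM.
by apply: fourier_ccontinuous; exact: prodC.
Qed.

Lemma pressure_coef_ccontinuous n : ccontinuous (pressure_coef n).
Proof.
apply: ccontinuousM; apply: ccontinuous_sum => j; apply: ccontinuousM.
exact: residual_ccontinuous.
Qed.

Lemma normr_phase_le n j : `|phase n (e_ j)| <= freq n :> R.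
Proof.
rewrite -sqrtr_sqr ler_wsqrtr // /freq2 phase_basis; elim/ord2P: j => /=.
  by rewrite lerDl sqr_ge0.
by rewrite lerDr sqr_ge0.
Qed.

(** The residual grows at most like [|n|]: the force by [fCf], the divergence of a bounded tensor by
    its one derivative. The pressure operator gains a factor [|n|^-1]. *)
Lemma pressure_coef_bounded : exists2 P, 0 <= P & forall n t, normc (pressure_coef n t) <= P.
Proof.
have /choice[B HB] : forall ij : 'I_2 * 'I_2, exists B, 0 <= B /\
    forall t x, `|prod ij.1 ij.2 t x| <= B.
  by move=> [i j]; have [_ [B B0 HB] _] := prodC i j; exists B.
pose C i : R := Cf + \sum_(j < 2) 2 * (B (i, j) * A).
have A0 : 0 <= A by exact/ltW/cell_area_gt0.
have S0 i : 0 <= \sum_(j < 2) 2 * (B (i, j) * A).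
  by apply: sumr_ge0 => j _; apply: mulr_ge0 => //; apply: mulr_ge0 => //; have [] := HB (i, j).
have C0 i : 0 <= C i by rewrite addr_ge0.
exists (\sum_(i < 2) C i); first by apply: sumr_ge0.
move=> n t; have [->|n0] := eqVneq n 0.
  rewrite /pressure_coef (_ : freq2 0 = 0); last by rewrite /freq2 /= expr0n /= addr0.
  rewrite invr0 mulr0 mul0r ComplexField.Normc.normc0; exact: sumr_ge0.
have r0 := freq2_gt0 n0 (R := R); have r1 := freq_ge1 n0 (R := R).
have ZC i : normc (residual i n t) <= freq n * C i.
  apply: (le_trans (le_normcD _ _)); rewrite normcN mulrDr.
  apply: lerD; first by rewrite mulrC; exact: fCf.
  rewrite ComplexField.Normc.normcM normc_i mul1r mulr_sumr.
  apply: (le_trans (normc_sum_le _ _ _)); apply: ler_sum => j _.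
  rewrite ComplexField.Normc.normcM normc_real; apply: ler_pM; rewrite ?normc_ge0 //.
    exact: normr_phase_le.
  by apply: normc_fourier_le; [exact: bdd_curve_meas|exact: (HB (i, j)).2].
rewrite ComplexField.Normc.normcM ComplexField.Normc.normcM normcN normc_i mul1r normc_real.
rewrite ger0_norm ?invr_ge0 ?(ltW r0) // ler_pdivrMl //.
apply: (le_trans (normc_sum_le _ _ _)); rewrite mulr_sumr; apply: ler_sum => i _.
rewrite ComplexField.Normc.normcM normc_real -freq_sqr expr2 -mulrA.
by apply: ler_pM; rewrite ?normc_ge0 // normr_phase_le.
Qed.

(* The Leray projection of the residual drives the velocity. *)
Lemma velocity_cderivable i n s : 0 < s ->
  cderivable (fun t => fourier n (fun y => u t y i)) s
    (((- (nu * freq2 n))%:C)%C * fourier n (fun y => u s y i) +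
     ((perp n i * (freq2 n)^-1)%:C)%C * \sum_(k < 2) ((perp n k)%:C)%C * residual k n s).
Proof.
move=> s0; have A0 : A != 0 by rewrite gt_eqF // cell_area_gt0.
have [->|n0] := eqVneq n 0.
  have E t : fourier 0 (fun y => u t y i) = 0 by rewrite fcu psi0 !mulr0.
  rewrite E (funext E) (_ : perp 0 i = 0 :> R).
    by rewrite mul0r mul0r mulr0 addr0; exact: cderivable_cst.
  by elim/ord2P: i {E}; rewrite ?perp0E ?perp1E //= oppr0.
have := cderivableM (A%:C)%C (cderivableM ((perp n i)%:C)%C (dpsi n0 s0)).
rewrite -(funext (fun t => fcu t i n)); congr cderivable; rewrite fcu.
have -> : stream f n = (((freq2 n)^-1)%:C)%C *
    \sum_(k < 2) ((perp n k)%:C)%C * ((A^-1%:C)%C * dist_fourier (f k) n).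
  by congr (_ * _); apply: eq_bigr => k _; rewrite fourier_coeff_dist_fourier.
exact: velocity_algebra.
Qed.

Lemma residual_split i n t : dist_fourier (f i) n =
  ((phase n (e_ i) * (freq2 n)^-1)%:C)%C *
    (\sum_(k < 2) ((phase n (e_ k))%:C)%C * residual k n t) +
  ((perp n i * (freq2 n)^-1)%:C)%C * (\sum_(k < 2) ((perp n k)%:C)%C * residual k n t) +
  'i%C * \sum_(j < 2) ((phase n (e_ j))%:C)%C * fourier n (prod i j t).
Proof.
have [->|n0] := eqVneq n 0; last first.
  by rewrite -(orthogonal_split (fun k => residual k n t) i n0) /residual subrK.
(* At [n = 0] all symbols vanish, and so does the mean of the force. *)
have q0 k : phase 0 (e_ k) = 0 :> R by rewrite /phase /= !mul0r addr0.
have p0 : perp 0 i = 0 :> R by elim/ord2P: i; rewrite ?perp0E ?perp1E //= oppr0.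
rewrite f0 p0 q0 !mul0r !add0r (_ : \sum_(j < 2) _ = 0) ?mulr0 //.
by rewrite big1 // => j _; rewrite q0 mul0r.
Qed.

(** By [mode_algebra] the integrand is minus the time derivative of the pairing of the velocity mode
    with the test mode, which vanishes outside [[a, b]]. *)
Lemma mode_balance a b phi i n : 0 < a -> spacetime_test a b phi ->
  time_int (fun t =>
    - dotc (fourier n (fun y => u t y i)) (fourier n (fun x => 'D_time_dir phi (t, x))) -
    \sum_(j < 2) dotc (fourier n (prod i j t)) (fourier n (fun x => 'D_(space_dir j) phi (t, x))) -
    nu * \sum_(j < 2) dotc (fourier n (fun y => u t y i))
      (fourier n (fun x => 'D_(space_dir j) ('D_(space_dir j) phi) (t, x))) -
    dotc (dist_fourier (f i) n) (fourier n (fun x => phi (t, x))) -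
    dotc (pressure_coef n t) (fourier n (fun x => 'D_(space_dir i) phi (t, x)))) = 0.
Proof.
move=> a0 tp; pose c t := fourier n (fun x => phi (t, x)).
pose dc t := fourier n (fun x => 'D_time_dir phi (t, x)).
pose U t := fourier n (fun y => u t y i).
pose dU t := ((- (nu * freq2 n))%:C)%C * U t +
  ((perp n i * (freq2 n)^-1)%:C)%C * \sum_(k < 2) ((perp n k)%:C)%C * residual k n t.
have cU : ccontinuous U by exact: fourier_ccontinuous (uC i).
have cdU : ccontinuous dU.
  apply: ccontinuousD; apply: ccontinuousM => //.
  by apply: ccontinuous_sum => k; apply: ccontinuousM; exact: residual_ccontinuous.
have s1 : time_supported a b (fun t => dotc (dU t) (c t)) by exact: dotc_time_supported.
have s2 : time_supported a b (fun t => dotc (U t) (dc t)).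
  exact: dotc_time_supported (spacetime_derive time_dir tp) cU.
have s12 := time_supportedD s1 s2.
have I0 : time_int (fun t => dotc (dU t) (c t) + dotc (U t) (dc t)) = 0.
  apply: (@time_int_derive _ a b (fun t => dotc (U t) (c t))) => //.
    by have [_] : time_supported a b (fun t => dotc (U t) (c t)) by exact: dotc_time_supported.
  move=> t t0; apply: cderivable_dotc; first exact: velocity_cderivable.
  exact: fourier_slice_cderivable tp.
transitivity (time_int (fun t => -1 * (dotc (dU t) (c t) + dotc (U t) (dc t)))); last first.
  by rewrite (time_intZ (-1) a0 s12) I0 mulr0.
congr time_int.
apply/funext => t.
have dj j : fourier n (fun x => 'D_(space_dir j) phi (t, x)) = 'i%C * ((phase n (e_ j))%:C)%C * c t :=
  fourier_slice_derive n j t tp.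
have ddj j : fourier n (fun x => 'D_(space_dir j) ('D_(space_dir j) phi) (t, x)) =
    'i%C * ((phase n (e_ j))%:C)%C * ('i%C * ((phase n (e_ j))%:C)%C * c t).
  by rewrite -dj; exact: fourier_slice_derive n j t (spacetime_derive (space_dir j) tp).
have E1 : \sum_(j < 2) dotc (fourier n (prod i j t)) (fourier n (fun x => 'D_(space_dir j) phi (t, x))) =
    dotc (fourier n (prod i ord0 t)) ('i%C * ((phase n (e_ ord0))%:C)%C * c t) +
    dotc (fourier n (prod i ord_max t)) ('i%C * ((phase n (e_ ord_max))%:C)%C * c t).
  by etransitivity; [exact: sum_ord2|congr (dotc _ _ + dotc _ _); exact: dj].
have E2 : \sum_(j < 2) dotc (U t) (fourier n (fun x => 'D_(space_dir j) ('D_(space_dir j) phi) (t, x))) =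
    dotc (U t) ('i%C * ((phase n (e_ ord0))%:C)%C * ('i%C * ((phase n (e_ ord0))%:C)%C * c t)) +
    dotc (U t) ('i%C * ((phase n (e_ ord_max))%:C)%C * ('i%C * ((phase n (e_ ord_max))%:C)%C * c t)).
  by etransitivity; [exact: sum_ord2|congr (dotc _ _ + dotc _ _); exact: ddj].
have rE : freq2 n = phase n (e_ ord0) ^+ 2 + phase n (e_ ord_max) ^+ 2 :> R.
  by rewrite !phase_basis.
have F : dist_fourier (f i) n = ((phase n (e_ i) * (freq2 n)^-1)%:C)%C *
    (\sum_(k < 2) ((phase n (e_ k))%:C)%C * residual k n t) +
  ((perp n i * (freq2 n)^-1)%:C)%C * (\sum_(k < 2) ((perp n k)%:C)%C * residual k n t) +
  'i%C * (((phase n (e_ ord0))%:C)%C * fourier n (prod i ord0 t) +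
          ((phase n (e_ ord_max))%:C)%C * fourier n (prod i ord_max t)).
  rewrite [LHS](residual_split i n t); congr (_ + 'i%C * _); exact: sum_ord2.
have E3 : dotc (pressure_coef n t) (fourier n (fun x => 'D_(space_dir i) phi (t, x))) =
  dotc (pressure_coef n t) ('i%C * ((phase n (e_ i))%:C)%C * c t) := congr1 (dotc _) (dj i).
exact: (mode_algebra nu (dotc (U t) (dc t)) F rE E1 E2 E3).
Qed.

End Momentum.

(** * Summation over the modes and the pressure *)

Section Pressure.
Context {R : realType}.
Local Notation T2 := (R * R)%type.
Local Notation T3 := (R * (R * R))%type.
Local Notation A := (@cell_area R).
Local Notation e_ := (@torus_basis R).
Implicit Types (n : Z2) (i j k : 'I_2) (a b t c : R) (phi : T3 -> R) (h : R -> R).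

Lemma time_intN a b h : 0 < a -> time_supported a b h ->
  time_int (fun t => - h t) = - time_int h.
Proof.
move=> a0 sh; rewrite -mulN1r -(time_intZ (-1) a0 sh).
by congr time_int; apply/funext => t; rewrite mulN1r.
Qed.

Lemma time_supportedN a b h : time_supported a b h -> time_supported a b (fun t => - h t).
Proof.
move=> sh; have := time_supportedZ (-1) sh; congr time_supported.
by apply/funext => t; rewrite mulN1r.
Qed.

Lemma time_intB a b h h' : 0 < a -> time_supported a b h -> time_supported a b h' ->
  time_int (fun t => h t - h' t) = time_int h - time_int h'.
Proof.
move=> a0 sh sh'; rewrite -(time_intN a0 sh'); apply: (time_intD a0 sh).
exact: time_supportedN.
Qed.

Lemma time_supportedB a b h h' : time_supported a b h -> time_supported a b h' ->
  time_supported a b (fun t => h t - h' t).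
Proof. by move=> sh sh'; apply: time_supportedD => //; exact: time_supportedN. Qed.

Lemma time_int_balance a b c (x : R -> R) (y z : 'I_2 -> R -> R) : 0 < a ->
  time_supported a b x -> (forall j, time_supported a b (y j)) ->
  (forall j, time_supported a b (z j)) ->
  time_int (fun t => - x t - \sum_(j < 2) y j t - c * \sum_(j < 2) z j t) =
  - time_int x - \sum_(j < 2) time_int (y j) - c * \sum_(j < 2) time_int (z j) /\
  time_supported a b (fun t => - x t - \sum_(j < 2) y j t - c * \sum_(j < 2) z j t).
Proof.
move=> a0 sx sy sz; have Sy := time_supported_sum (index_enum 'I_2) sy.
have Sz := time_supported_sum (index_enum 'I_2) sz.
have s1 := time_supportedB (time_supportedN sx) Sy.
have s2 := time_supportedZ c Sz.
split; last exact: time_supportedB s1 s2.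
rewrite (time_intB a0 s1 s2) (time_intB a0 (time_supportedN sx) Sy) (time_intN a0 sx).
by rewrite (time_intZ c a0 Sz) (time_int_sum _ a0 sy) (time_int_sum _ a0 sz).
Qed.

Lemma spacetime_widen a b a' b' phi : a' <= a -> b <= b' ->
  spacetime_test a b phi -> spacetime_test a' b' phi.
Proof.
move=> aa bb [sp pp zp]; split => // t x tab; apply: zp => /andP[at_ tb].
by apply: tab; rewrite (le_trans aa) // (le_trans tb).
Qed.

Lemma spacetime_lin a b c phi phi' : spacetime_test a b phi ->
  spacetime_test a b phi' -> spacetime_test a b (fun x => c * phi x + phi' x).
Proof.
move=> [sp pp zp] [sq pq zq]; split; first exact: smooth_lin.
  by move=> t j x; rewrite pp pq.
by move=> t x tab; rewrite zp // zq // mulr0 addr0.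
Qed.

Lemma slice_derivatives a b phi (M : R) N t : spacetime_test a b phi ->
  derivatives_le (time_dir |` range space_dir) N M phi ->
  derivatives_le (range e_) N M (fun x => phi (t, x)).
Proof.
move=> tp H s sN sE x; rewrite slice_iter_derive; apply: H.
  by rewrite size_map.
by move=> _ /mapP[v vs ->]; right; have [j _ <-] := sE v vs; exists j.
Qed.

Lemma fourier_slice_lin a b c n t phi phi' : spacetime_test a b phi -> spacetime_test a b phi' ->
  fourier n (fun x => c * phi (t, x) + phi' (t, x)) =
  (c%:C)%C * fourier n (fun x => phi (t, x)) + fourier n (fun x => phi' (t, x)).
Proof.
move=> tp tq; have bp := test_bdd_meas (slice_test t tp).
have bq := test_bdd_meas (slice_test t tq).
by rewrite fourierD ?fourierZ //; exact: bdd_measZ.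
Qed.

Definition mode_pairing (z : R -> R[i]) n phi : R :=
  time_int (fun t => dotc (z t) (fourier n (fun x => phi (t, x)))).

Lemma mode_pairing_lin z n a b c phi phi' : 0 < a -> ccontinuous z ->
  spacetime_test a b phi -> spacetime_test a b phi' ->
  mode_pairing z n (fun x => c * phi x + phi' x) =
  c * mode_pairing z n phi + mode_pairing z n phi'.
Proof.
move=> a0 cz tp tq; rewrite /mode_pairing -(time_int_lin c a0 (dotc_time_supported n tp cz) (dotc_time_supported n tq cz)).
congr time_int; apply/funext => t; rewrite (fourier_slice_lin c n t tp tq).
by rewrite dotcDr dotc_scaler.
Qed.

Lemma sum_modes_split (s : seq Z2) (c nu : R) (m1 m4 : Z2 -> R) (m2 m3 : Z2 -> 'I_2 -> R) :
  c * \sum_(n <- s) (- m1 n - \sum_(j < 2) m2 n j - nu * \sum_(j < 2) m3 n j - m4 n) =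
  - (c * \sum_(n <- s) m1 n) - \sum_(j < 2) c * \sum_(n <- s) m2 n j -
  nu * \sum_(j < 2) c * \sum_(n <- s) m3 n j - c * \sum_(n <- s) m4 n.
Proof.
rewrite !sumrB sumrN -mulr_sumr.
rewrite [\sum_(i <- s) \sum_(j < 2) m2 i j]exchange_big.
rewrite [\sum_(i <- s) \sum_(j < 2) m3 i j]exchange_big /=.
by rewrite -!mulr_sumr; ring.
Qed.

Section Limits.
Variables (U : set_system nat) (UU : UltraFilter U).
Hypothesis Ufree : forall P : nat -> Prop, (exists N0, forall N, (N0 <= N)%N -> P N) ->
  \forall N \near U, P N.
Let UP : ProperFilter U := ultra_proper.

Lemma time_int_ulim a b h (H : nat -> R -> R) : 0 < a -> time_supported a b h ->
  (forall K, time_supported a b (H K)) ->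
  (forall eps : R, 0 < eps -> exists K0, forall K, (K0 <= K)%N ->
     forall t, `|h t - H K t| <= eps) ->
  time_int (H K) @[K --> U] --> time_int h.
Proof.
move=> a0 sh sH Hh; apply: ulim_dist => e e0.
have B0 : 0 < `|b - a| + 1 by rewrite ltr_wpDl.
have [K0 HK0] := Hh _ (divr_gt0 e0 B0); apply: Ufree; exists K0 => K K0K.
rewrite distrC -(time_intB a0 sh (sH K)).
apply: (le_trans (normr_time_int_le a0 (time_supportedB sh (sH K)) (HK0 K K0K))).
by rewrite mulrAC ler_pdivrMr // ler_wpM2l ?(ltW e0) // lerDl.
Qed.

Lemma torus_int_ulim a b phi (F : R -> T2 -> R) : 0 < a -> spacetime_test a b phi ->
  bdd_curve F ->
  A^-1 * \sum_(n <- box K) mode_pairing (fun t => fourier n (F t)) n phi @[K --> U] -->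
  time_int (fun t => torus_int (fun x => F t x * phi (t, x))).
Proof.
move=> a0 tp bF; have cF n := fourier_ccontinuous n bF.
have s n := dotc_time_supported n tp (cF n).
have sS K := time_supportedZ A^-1 (time_supported_sum (box K) s).
have E K : A^-1 * \sum_(n <- box K) mode_pairing (fun t => fourier n (F t)) n phi =
    time_int (fun t => A^-1 * \sum_(n <- box K) dotc (fourier n (F t)) (fourier n (fun x => phi (t, x)))).
  by rewrite (time_intZ _ a0 (time_supported_sum (box K) s)) (time_int_sum (box K) a0 s).
rewrite (funext E); apply: (time_int_ulim a0 (torus_int_time_supported tp bF) sS).
by move=> e e0; exact: torus_int_fourier_unif tp bF e0.
Qed.

Lemma dist_ulim a b phi T : 0 < a -> spacetime_test a b phi -> torus_distribution T ->
  A^-1 * \sum_(n <- box K) mode_pairing (fun=> dist_fourier T n) n phi @[K --> U] -->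
  time_int (fun t => T (fun x => phi (t, x))).
Proof.
move=> a0 tp TD; have cF n := ccontinuous_cst (dist_fourier T n).
have s n := dotc_time_supported n tp (cF n).
have sS K := time_supportedZ A^-1 (time_supported_sum (box K) s).
have E K : A^-1 * \sum_(n <- box K) mode_pairing (fun=> dist_fourier T n) n phi =
    time_int (fun t => A^-1 * \sum_(n <- box K) dotc (dist_fourier T n) (fourier n (fun x => phi (t, x)))).
  by rewrite (time_intZ _ a0 (time_supported_sum (box K) s)) (time_int_sum (box K) a0 s).
rewrite (funext E); apply: (time_int_ulim a0 (dist_time_supported tp TD) sS).
by move=> e e0; exact: dist_fourier_unif tp TD e0.
Qed.

Variables (q : Z2 -> R -> R[i]) (P : R).
Hypotheses (qC : forall n, ccontinuous (q n)) (qP : forall n t, normc (q n t) <= P).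

Definition partial_pressure K phi : R := A^-1 * \sum_(n <- box K) mode_pairing (q n) n phi.

(** Bounded pressure coefficients meet test coefficients of size [8 * A * M * decay n]; with
    [sum_decay_le] this gives [200 = 8 * 25]. *)
Lemma partial_pressure_le a b phi (M : R) K : 0 < a -> spacetime_test a b phi ->
  (forall t, derivatives_le (range e_) 4 M (fun x => phi (t, x))) ->
  `|partial_pressure K phi| <= (P * 200 * `|b - a|) * M.
Proof.
move=> a0 tp HM; have A0 := @cell_area_gt0 R.
have P0 : 0 <= P := le_trans (normc_ge0 _) (qP 0 0).
have M0 := derivatives_le_ge0 (HM 0).
have bn n : `|mode_pairing (q n) n phi| <= P * (8 * A * M) * `|b - a| * decay n.
  rewrite [leRHS]mulrAC; apply: (normr_time_int_le a0 (dotc_time_supported n tp (qC n))) => t.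
  apply: (le_trans (normr_dotc_le _ _)).
  rewrite -(mulrA P (8 * A * M) (decay n)).
  by apply: ler_pM; [exact: normc_ge0|exact: normc_ge0|exact: qP|exact: fourier_decay (slice_test t tp) (HM t)].
rewrite normrM ger0_norm ?invr_ge0 ?(ltW A0) // ler_pdivrMl //.
apply: (le_trans (ler_norm_sum _ _ _)).
apply: (le_trans (ler_sum _ (fun n _ => bn n))); rewrite -mulr_sumr.
apply: (@le_trans _ _ (P * (8 * A * M) * `|b - a| * 25)).
  apply: ler_wpM2l; last exact: sum_decay_le.
  apply: mulr_ge0 => //; apply: mulr_ge0 => //; apply: mulr_ge0 => //.
  by apply: mulr_ge0 => //; exact: ltW.
by rewrite le_eqVlt; apply/orP; left; apply/eqP; ring.
Qed.

(** On each test function the partial sums are bounded, so they converge along [U]; linearity and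
    the order-4 bound pass to the limit. *)
Definition pressure phi : R := lim (partial_pressure K phi @[K --> U]).

Lemma pressure_cvg phi : positive_time_test phi ->
  partial_pressure K phi @[K --> U] --> pressure phi.
Proof.
move=> [a [b [a0 tp]]]; have [M _ HM] := slice_derivatives_le 4 tp.
have [l Hl] := ultra_bounded_cvg UU (fun K => partial_pressure_le K a0 tp HM).
by rewrite /pressure (cvg_lim (@Rhausdorff R) Hl).
Qed.

Lemma pressure_distribution : spacetime_distribution pressure.
Proof.
split.
  move=> c phi phi' tp tq; have [a [b [a0 tp']]] := tp; have [a' [b' [a'0 tq']]] := tq.
  (* A common support interval for the two test functions, still at positive times. *)
  pose a2 := Num.min a a'; pose b2 := Num.max b b'.
  have a20 : 0 < a2 by rewrite lt_min a0.
  have t1 : spacetime_test a2 b2 phi.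
    by apply: spacetime_widen tp'; rewrite /a2 /b2 ?ge_min ?le_max lexx.
  have t2 : spacetime_test a2 b2 phi'.
    by apply: spacetime_widen tq'; rewrite /a2 /b2 ?ge_min ?le_max lexx orbT.
  have t3 : positive_time_test (fun x => c * phi x + phi' x).
    by exists a2, b2; split => //; exact: spacetime_lin.
  apply: (ulim_unique UU (pressure_cvg t3)).
  have E K : partial_pressure K (fun x => c * phi x + phi' x) =
      c * partial_pressure K phi + partial_pressure K phi'.
    rewrite /partial_pressure mulrCA -mulrDr [c * _]mulr_sumr -big_split; congr (_ * _).
    by apply: eq_bigr => n _; rewrite (mode_pairing_lin n c a20 (qC n) t1 t2).
  rewrite (funext E); apply: cvgD; last exact: pressure_cvg.
  by apply: cvgM; [exact: cvg_cst|exact: pressure_cvg].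
move=> a b a0; exists 4%N, (P * 200 * `|b - a|) => phi M tp HM.
have tp' : positive_time_test phi by exists a, b.
apply: (ulim_norm_le UU (pressure_cvg tp')); apply: filterE => K.
by apply: (partial_pressure_le K a0 tp) => t; exact: slice_derivatives tp HM.
Qed.

Variables (nu : R) (u : R -> @vector_field R) (f : @vector_dist R).
Hypothesis uC : forall i, bdd_curve (fun t y => u t y i).
Hypothesis fD : forall i, torus_distribution (f i).
Hypothesis balance : forall a b phi i n, 0 < a -> spacetime_test a b phi ->
  time_int (fun t =>
    - dotc (fourier n (fun y => u t y i)) (fourier n (fun x => 'D_time_dir phi (t, x))) -
    \sum_(j < 2) dotc (fourier n (fun y => u t y j * u t y i)) (fourier n (fun x => 'D_(space_dir j) phi (t, x))) -
    nu * \sum_(j < 2) dotc (fourier n (fun y => u t y i))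
      (fourier n (fun x => 'D_(space_dir j) ('D_(space_dir j) phi) (t, x))) -
    dotc (dist_fourier (f i) n) (fourier n (fun x => phi (t, x))) -
    dotc (q n t) (fourier n (fun x => 'D_(space_dir i) phi (t, x)))) = 0.

(** By Parseval each term of the equation is the limit of its sums over modes, and [balance]
    expresses the sums for the pressure through the others; limits along [U] are unique. *)
Lemma momentum_from_balance : momentum_equation nu f u pressure.
Proof.
move=> i phi [a [b [a0 tp]]].
have tt := spacetime_derive time_dir tp.
have tj j := spacetime_derive (space_dir j) tp.
have tjj j := spacetime_derive (space_dir j) (tj j).
have prodC j : bdd_curve (fun t y => u t y j * u t y i) by exact: bdd_curveM.
pose x t := torus_int (fun y => u t y i * 'D_time_dir phi (t, y)).
pose y j t := torus_int (fun y => u t y j * u t y i * 'D_(space_dir j) phi (t, y)).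
pose z j t := torus_int (fun y => u t y i * 'D_(space_dir j) ('D_(space_dir j) phi) (t, y)).
have sx : time_supported a b x := torus_int_time_supported tt (uC i).
have sy j : time_supported a b (y j) := torus_int_time_supported (tj j) (prodC j).
have sz j : time_supported a b (z j) := torus_int_time_supported (tjj j) (uC i).
have [EI _] := time_int_balance nu a0 sx sy sz.
pose m1 n := mode_pairing (fun t => fourier n (fun y => u t y i)) n ('D_time_dir phi).
pose m2 n j := mode_pairing (fun t => fourier n (fun y => u t y j * u t y i)) n ('D_(space_dir j) phi).
pose m3 n j := mode_pairing (fun t => fourier n (fun y => u t y i)) n ('D_(space_dir j) ('D_(space_dir j) phi)).
pose m4 n := mode_pairing (fun=> dist_fourier (f i) n) n phi.
pose m5 n := mode_pairing (q n) n ('D_(space_dir i) phi).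
have mode n : m5 n = - m1 n - \sum_(j < 2) m2 n j - nu * \sum_(j < 2) m3 n j - m4 n.
  have cu := fourier_ccontinuous n (uC i).
  have s1 := dotc_time_supported n tt cu.
  have s2 j := dotc_time_supported n (tj j) (fourier_ccontinuous n (prodC j)).
  have s3 j := dotc_time_supported n (tjj j) cu.
  have s4 := dotc_time_supported n tp (ccontinuous_cst (dist_fourier (f i) n)).
  have s5 := dotc_time_supported n (tj i) (qC n).
  have [E S] := time_int_balance nu a0 s1 s2 s3.
  have := balance i n a0 tp.
  rewrite (time_intB a0 (time_supportedB S s4) s5) (time_intB a0 S s4) E => H.
  by apply/esym/eqP; rewrite -subr_eq0; apply/eqP.
have c1 : A^-1 * \sum_(n <- box K) m1 n @[K --> U] --> time_int x := torus_int_ulim a0 tt (uC i).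
have c2 j : A^-1 * \sum_(n <- box K) m2 n j @[K --> U] --> time_int (y j) :=
  torus_int_ulim a0 (tj j) (prodC j).
have c3 j : A^-1 * \sum_(n <- box K) m3 n j @[K --> U] --> time_int (z j) :=
  torus_int_ulim a0 (tjj j) (uC i).
have c4 : A^-1 * \sum_(n <- box K) m4 n @[K --> U] --> time_int (fun t => f i (fun x => phi (t, x))) :=
  dist_ulim a0 tp (fD i).
have c5 : partial_pressure K ('D_(space_dir i) phi) @[K --> U] -->
    - time_int x - \sum_(j < 2) time_int (y j) - nu * \sum_(j < 2) time_int (z j) -
    time_int (fun t => f i (fun x => phi (t, x))).
  have E K : partial_pressure K ('D_(space_dir i) phi) =
      - (A^-1 * \sum_(n <- box K) m1 n) - \sum_(j < 2) A^-1 * \sum_(n <- box K) m2 n j -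
      nu * \sum_(j < 2) A^-1 * \sum_(n <- box K) m3 n j - A^-1 * \sum_(n <- box K) m4 n.
    rewrite -sum_modes_split; congr (_ * _); apply: eq_bigr => n _; exact: mode.
  have c2' := @ulim_sum _ _ UU _ (index_enum 'I_2) _ _ c2.
  have c3' := @ulim_sum _ _ UU _ (index_enum 'I_2) _ _ c3.
  have c3'' := cvgM (cvg_cst nu) c3'.
  rewrite (funext E); apply: cvgB; last exact: c4.
  apply: cvgB; last exact: c3''.
  apply: cvgB; last exact: c2'.
  apply: cvgN; exact: c1.
have pt : positive_time_test ('D_(space_dir i) phi).
  by exists a, b; split; [exact: a0|exact: tj].
rewrite (ulim_unique UU (pressure_cvg pt) c5).
suff -> : time_int (fun t => torus_int (fun x =>
      - (u t x i * 'D_time_dir phi (t, x))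
      - \sum_(j < 2) u t x j * u t x i * 'D_(space_dir j) phi (t, x)
      - nu * (u t x i *
          \sum_(j < 2) 'D_(space_dir j) ('D_(space_dir j) phi) (t, x)))) =
    - time_int x - \sum_(j < 2) time_int (y j) - nu * \sum_(j < 2) time_int (z j).
  by rewrite opprB addrC subrK.
rewrite -EI; congr time_int; apply/funext => t.
have bu k : bdd_meas (fun y => u t y k) := bdd_curve_meas t (uC k).
have bs w (tw : spacetime_test a b w) : bdd_meas (fun y => w (t, y)) := test_bdd_meas (slice_test t tw).
have b1 := bdd_measM (bu i) (bs _ tt).
have b2 j := bdd_measM (bdd_measM (bu j) (bu i)) (bs _ (tj j)).
have b3 j := bdd_measM (bu i) (bs _ (tjj j)).
have S2 := bdd_meas_sum (index_enum 'I_2) b2.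
have S3 := bdd_meas_sum (index_enum 'I_2) b3.
transitivity (torus_int (fun x =>
      - (u t x i * 'D_time_dir phi (t, x))
      - \sum_(j < 2) u t x j * u t x i * 'D_(space_dir j) phi (t, x)
      - nu * \sum_(j < 2) u t x i * 'D_(space_dir j) ('D_(space_dir j) phi) (t, x))).
  by congr torus_int; apply/funext => r; rewrite mulr_sumr.
rewrite (torus_intB (bdd_measB (bdd_measN b1) S2) (bdd_measZ nu S3)).
rewrite (torus_intB (bdd_measN b1) S2) (torus_intN b1) (torus_intZ nu S3).
by rewrite (torus_int_sum _ b2) (torus_int_sum _ b3).
Qed.

End Limits.
End Pressure.

(** * Regularity of the solution *)

Section Norms.
Context {R : realType}.
Local Notation T2 := (R * R)%type.
Local Notation A := (@cell_area R).
Local Notation e_ := (@torus_basis R).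
Local Notation test := (@torus_test R).
Implicit Types (n : Z2) (i j k : 'I_2) (g : T2 -> R) (v : @vector_field R).

(* Unlike [ge0_le_integral], measurability is not assumed. *)
Lemma ge0_le_integral_nm d (X : measurableType d) (mu : {measure set X -> \bar R})
    (D : set X) (F G : X -> \bar R) :
  (forall x, (0 <= F x)%E) -> (forall x, (F x <= G x)%E) ->
  (\int[mu]_(x in D) F x <= \int[mu]_(x in D) G x)%E.
Proof.
move=> F0 FG; rewrite integral_mkcond [leRHS]integral_mkcond.
have F0' x : (0 <= (F \_ D) x)%E by rewrite /patch; case: ifP.
have FG' x : ((F \_ D) x <= (G \_ D) x)%E by rewrite /patch; case: ifP.
rewrite !ge0_integralTE //; last by move=> x; exact: le_trans (FG' x).
by apply: ereal_sup_le => _ [h hF <-]; exists h => // x; exact: le_trans (FG' x).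
Qed.

Lemma L2_norm_le v (e : R) : 0 <= e -> (forall x i, `|v x i| <= e) ->
  (forall i, measurable_fun [set: T2] (fun x => v x i)) ->
  (L2_norm v <= (e * Num.sqrt (2 * A))%:E)%E.
Proof.
move=> e0 ve mv; have A0 := @cell_area_gt0 R.
have H : (\int[lebesgue2]_(x in cell) (\sum_(i < 2) v x i ^+ 2)%:E <= (e ^+ 2 * (2 * A))%:E)%E.
  apply: (@le_trans _ _ (\int[lebesgue2]_(x in cell) (cst (2 * e ^+ 2)%:E) x)%E).
    apply: ge0_le_integral_nm => x; first by rewrite lee_fin; apply: sumr_ge0 => i _; exact: sqr_ge0.
    rewrite lee_fin sum_ord2 mulr2n mulrDl mul1r; apply: lerD; rewrite -real_normK ?num_real //.
      by rewrite ler_sqr ?nnegrE.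
    by rewrite ler_sqr ?nnegrE.
  rewrite integral_cst; last exact: measurable_cell.
  apply: (@le_trans _ _ ((2 * e ^+ 2)%:E * A%:E)%E).
    by rewrite le_eqVlt; apply/orP; left; apply/eqP; congr (_ * _)%E; exact: lebesgue2_cell.
  by rewrite -EFinM lee_fin le_eqVlt; apply/orP; left; apply/eqP; ring.
apply: (@le_trans _ _ ((e ^+ 2 * (2 * A))%:E `^ 2^-1)%E).
  apply: gt0_ler_poweR => //; rewrite in_itv /= leey andbT.
    by apply: integral_ge0 => x _; rewrite lee_fin; apply: sumr_ge0 => i _; exact: sqr_ge0.
  by rewrite lee_fin mulr_ge0 ?sqr_ge0 // mulr_ge0 // ltW.
have p2 : 0 <= 2 * A by rewrite mulr_ge0 // ltW.
rewrite poweR_EFin powR12_sqrt; last by rewrite mulr_ge0 ?sqr_ge0.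
by rewrite sqrtrM ?sqr_ge0 // sqrtr_sqr ger0_norm.
Qed.

Lemma L2_norm_ge0 v : (0 <= L2_norm v)%E.
Proof. exact: poweR_ge0. Qed.

Lemma fourier_coeff_dist_of v n i : fourier_coeff (dist_of v) n i =
  ((A^-1)%:C)%C * fourier n (fun x => v x i).
Proof. by rewrite fourier_coeff_dist_fourier; congr (_ * _); exact: dist_fourier_bdd. Qed.

Lemma test_derivatives_bounded g N : test g ->
  exists2 M, 0 <= M & derivatives_le (range e_) N M g.
Proof.
elim: N g => [|N IH] g tg; have [_ [M gM]] := test_bdd_meas tg;
  have M0 : 0 <= M := le_trans (normr_ge0 _) (gM 0).
  by exists M => // s; rewrite leqn0 size_eq0 => /eqP -> _ x; exact: gM.
have [M1 M10 H1] := IH _ (test_derive (e_ ord0) tg).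
have [M2 M20 H2] := IH _ (test_derive (e_ ord_max) tg).
exists (M + M1 + M2); first by rewrite !addr_ge0.
move=> s; elim/last_ind: s => [_ _ x|s v _].
  by apply: (le_trans (gM _)); rewrite -addrA lerDl addr_ge0.
rewrite size_rcons ltnS => sN sE x.
have sE' (v' : T2) : v' \in s -> range e_ v' by move=> vs; apply: sE; rewrite mem_rcons inE vs orbT.
have [j _ jv] : range e_ v by apply: sE; rewrite mem_rcons inE eqxx.
rewrite /iter_derive foldr_rcons; move: jv => <-; elim/ord2P: j.
  have h := H1 s sN sE' x; apply: (le_trans h); lra.
have h := H2 s sN sE' x; apply: (le_trans h); lra.
Qed.

Section Limits.
Variables (U : set_system nat) (UU : UltraFilter U).
Hypothesis Ufree : forall P : nat -> Prop, (exists N0, forall N, (N0 <= N)%N -> P N) ->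
  \forall N \near U, P N.
Let UP : ProperFilter U := ultra_proper.

Lemma dist_parseval T g : torus_distribution T -> test g ->
  A^-1 * \sum_(n <- box K) dotc (dist_fourier T n) (fourier n g) @[K --> U] --> T g.
Proof.
move=> TD tg; have [N HN] := dist_fsum_cvg TD.
have [M M0 HM] := test_derivatives_bounded N tg.
apply: ulim_dist => e e0; have M1 : 0 < M + 1 by rewrite ltr_wpDl.
have [K0 HK0] := HN _ (divr_gt0 e0 M1); apply: Ufree; exists K0 => K K0K.
rewrite -dist_fsum // distrC; apply: (le_trans (HK0 _ K0K _ M tg HM)).
by rewrite mulrAC ler_pdivrMr // ler_wpM2l ?(ltW e0) // lerDl.
Qed.

(** By Parseval the value on a test function is a limit of sums that involve only the Fourier
    coefficients. *)
Lemma dist_eq_dist_fourier T T' g : torus_distribution T -> torus_distribution T' ->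
  (forall n, dist_fourier T n = dist_fourier T' n) -> test g -> T g = T' g.
Proof.
move=> TD TD' TT tg; apply: (ulim_unique UU (dist_parseval TD tg)).
by under eq_fun do under eq_bigr do rewrite TT; exact: dist_parseval.
Qed.

(** Every term of the Parseval sum vanishes because [n . n^perp = 0]. *)
Lemma div_free_from_fourier v (z : Z2 -> R[i]) :
  (forall i, bdd_meas (fun x => v x i)) ->
  (forall i n, fourier n (fun x => v x i) = (A%:C)%C * (((perp n i)%:C)%C * z n)) ->
  divergence_free (dist_of v).
Proof.
move=> bv vz g tg.
have c j := dist_parseval (bdd_meas_dist (bv j)) (test_derive (e_ j) tg).
have := @ulim_sum _ _ UU _ (index_enum 'I_2) _ _ c.
move=> H; apply: (ulim_cst_eq UU H); apply: filterE => K.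
rewrite -mulr_sumr exchange_big /= big1 ?mulr0 // => n _.
rewrite sum_ord2 !dist_fourier_bdd !fourier_derive // !vz.
rewrite !phase_basis perp0E perp1E.
by move: (fourier n g) (z n) => [? ?] [? ?]; rewrite /dotc !cE /=; ring.
Qed.

End Limits.
End Norms.

(** * From weighted energies to Sobolev norms *)

Section SobolevWeights.
Context {R : realType}.
Local Notation A := (@cell_area R).
Implicit Types (n : Z2) (i j : 'I_2) (T : @vector_dist R) (alpha s : R).

Lemma wgt_sqr alpha n : wgt alpha n ^+ 2 = freq n `^ (2 * alpha).
Proof. by rewrite /wgt -powR_mulrn ?powR_ge0 // -powRrM mulrC. Qed.

Lemma freq_powR_shift alpha n : n != 0 ->
  freq n `^ (2 * (alpha + 1)) = freq2 n * freq n `^ (2 * alpha).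
Proof.
move=> n0; have r0 : 0 < freq n :> R by apply: lt_le_trans (freq_ge1 n0).
rewrite mulrDr mulr1 powRD; last by rewrite (gt_eqF r0) implybT.
by rewrite powR_mulrn ?(ltW r0) // freq_sqr mulrC.
Qed.

Lemma energy_stream_le alpha T : (sobolev_norm alpha T < +oo)%E ->
  exists G : R, forall l : seq Z2, uniq l -> (forall n, n \in l -> n != 0) ->
  energy (fun n => wgt (alpha + 1) n ^+ 2) l (stream T) <= G.
Proof.
move=> /sobolev_norm_sum[G HG]; exists G => l ul l0; apply: le_trans (HG l ul l0).
apply: ler_sum_mem => n nl; have n0 := l0 n nl; have r0 := freq2_gt0 n0 (R := R).
rewrite wgt_sqr freq_powR_shift // mulrC mulrA.
have h : nsq (stream T n) * freq2 n <= sqsum T n.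
  by rewrite mulrC -ler_pdivlMl //; exact: nsq_stream_le.
by rewrite mulrC; apply: ler_wpM2l => //; exact: powR_ge0.
Qed.

Lemma energy_stream_le2 alpha T : (sobolev_norm (alpha + 2) T < +oo)%E ->
  exists G : R, forall l : seq Z2, uniq l -> (forall n, n \in l -> n != 0) ->
  energy (wd (wgt (alpha + 1))) l (stream T) <= G.
Proof.
move=> /sobolev_norm_sum[G HG]; exists G => l ul l0; apply: le_trans (HG l ul l0).
apply: ler_sum_mem => n nl; have n0 := l0 n nl; have r0 := freq2_gt0 n0 (R := R).
have -> : alpha + 2 = alpha + 1 + 1 by ring.
rewrite /wd wgt_sqr (freq_powR_shift (alpha + 1) n0).
have h : freq2 n * nsq (stream T n) <= sqsum T n.
  by rewrite -ler_pdivlMl //; exact: nsq_stream_le.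
have -> : freq2 n ^+ 2 * freq n `^ (2 * (alpha + 1)) * nsq (stream T n) =
  freq2 n * freq n `^ (2 * (alpha + 1)) * (freq2 n * nsq (stream T n)) by ring.
by apply: ler_wpM2l => //; rewrite mulr_ge0 ?powR_ge0 // ltW.
Qed.

Lemma dist_fourier_fourier_coeff T n i : dist_fourier (T i) n = (A%:C)%C * fourier_coeff T n i.
Proof.
rewrite fourier_coeff_dist_fourier mulrA -rmorphM /= mulfV ?mul1r //.
by rewrite gt_eqF // cell_area_gt0.
Qed.

(** A single term of the Sobolev sum gives [|n|^(2 alpha) |T_n|^2 <= G], and
    [|n|^-2 <= |n|^(2 alpha)] since [alpha >= -1]. *)
Lemma dist_fourier_growth alpha T : -1 <= alpha -> (sobolev_norm alpha T < +oo)%E ->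
  exists2 C : R, 0 <= C & forall i n, n != 0 -> normc (dist_fourier (T i) n) <= C * freq n.
Proof.
move=> a1 /sobolev_norm_sum[G HG]; have A0 := @cell_area_gt0 R.
exists (A * Num.sqrt G); first by rewrite mulr_ge0 ?sqrtr_ge0 // ltW.
move=> i n n0; have r1 := freq_ge1 n0 (R := R).
rewrite dist_fourier_fourier_coeff ComplexField.Normc.normcM normc_real ger0_norm ?(ltW A0) //.
rewrite -mulrA ler_pM2l // -[leLHS]ger0_norm ?normc_ge0 // -sqrtr_sqr.
rewrite -[freq n](ger0_norm (freq_ge0 n)) -(sqrtr_sqr (freq n)).
have G0 : 0 <= G by have := HG [::] isT (fun n nL => ltac:(by [])); rewrite big_nil.
rewrite -sqrtrM // ler_wsqrtr //.
have := HG [:: n] isT (fun m => ltac:(by rewrite inE => /eqP ->)); rewrite big_seq1 => h.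
have le1 : normc (fourier_coeff T n i) ^+ 2 <= sqsum T n.
  rewrite /sqsum sum_ord2; elim/ord2P: i; by rewrite ?lerDl ?lerDr sqr_ge0.
apply: (le_trans le1); have p0 : 0 < freq n `^ (2 * alpha) by rewrite powR_gt0; lra.
have : freq n `^ (- 2) <= freq n `^ (2 * alpha) by apply: ler_powR => //; lra.
rewrite powR_invn ?freq_ge0 // => h2; have r2 : 0 < freq n ^+ 2 :> R by rewrite exprn_gt0 //; lra.
rewrite -ler_pdivrMr //; apply: le_trans h; rewrite mulrC.
by apply: ler_wpM2r => //; exact: sqsum_ge0.
Qed.

Lemma sqsum_velocity (v : @vector_field R) (z : Z2 -> R[i]) n :
  (forall i, fourier n (fun x => v x i) = (A%:C)%C * (((perp n i)%:C)%C * z n)) ->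
  sqsum (dist_of v) n = freq2 n * nsq (z n).
Proof.
move=> vz; have A0 : A != 0 by rewrite gt_eqF // cell_area_gt0.
have E i : fourier_coeff (dist_of v) n i = ((perp n i)%:C)%C * z n.
  by rewrite fourier_coeff_dist_of vz mulrA -rmorphM /= mulVf ?mul1r.
rewrite /sqsum sum_ord2 !normc_nsq !E perp0E perp1E.
by case: (z n) => a b; rewrite !nsqM /nsq /freq2 /=; ring.
Qed.

(** [wd] is [|n|^(2 (alpha + 2))] times the factor [|n|^2] of [|v_n|^2 = |n|^2 |z_n|^2], so the
    energy bound is a bound in [H^(alpha+2)], and in every lower norm because [|n| >= 1]. *)
Lemma sobolev_velocity alpha s K (v : @vector_field R) (z : Z2 -> R[i]) :
  s <= alpha + 2 ->
  (forall i, bdd_meas (fun x => v x i)) ->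
  (forall n i, fourier n (fun x => v x i) = (A%:C)%C * (((perp n i)%:C)%C * z n)) ->
  (forall l : seq Z2, uniq l -> (forall n, n \in l -> n != 0) ->
     energy (wd (wgt (alpha + 1))) l z <= K) -> z 0 = 0 ->
  sobolev s (dist_of v) /\ (sobolev_norm s (dist_of v) <= (K `^ 2^-1)%:E)%E.
Proof.
move=> sa bv vz zK z0.
have K0 : 0 <= K by have := zK [::] isT (fun n nL => ltac:(by [])); rewrite /energy big_nil.
have N : (sobolev_norm s (dist_of v) <= (K `^ 2^-1)%:E)%E.
  apply: sobolev_norm_le => // l ul l0; apply: le_trans (zK l ul l0).
  apply: ler_sum_mem => n nl; have n0 := l0 n nl; have r0 := freq2_gt0 n0 (R := R).
  have r1 := freq_ge1 n0 (R := R); rewrite (sqsum_velocity (vz n)) mulrA.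
  apply: ler_wpM2r; first exact: nsq_ge0.
  rewrite /wd wgt_sqr.
  apply: (@le_trans _ _ (freq n `^ (2 * (alpha + 1 + 1)) * freq2 n)).
    by rewrite ler_wpM2r ?(ltW r0) //; apply: ler_powR => //; lra.
  by rewrite (freq_powR_shift (alpha + 1) n0) le_eqVlt; apply/orP; left; apply/eqP; ring.
split=> //; split.
- by move=> i; exact: bdd_meas_dist.
- move=> i; have := congr1 (@complex.Re R) (vz 0 i); rewrite z0 !mulr0 /= => h; rewrite -[RHS]h.
  congr torus_int; apply/funext => x; congr (_ * _).
  by rewrite /cosn /phase /= !mul0r addr0 cos0.
- by apply: (le_lt_trans N); rewrite ltry.
Qed.

End SobolevWeights.

Section Regularity.
Context {R : realType}.
Local Notation T2 := (R * R)%type.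
Local Notation A := (@cell_area R).
Local Notation test := (@torus_test R).
Implicit Types (i j : 'I_2) (u : R -> @vector_field R).

Lemma measurable_curve_bdd (I : set R) u : measurable I ->
  (forall i, bdd_curve (fun t y => u t y i)) ->
  measurable_curve I (fun t => dist_of (u t)).
Proof.
move=> mI uC i g tg; apply: measurable_funTS; apply: continuous_measurable_fun.
apply: (@torus_int_continuous R (fun t x => u t x i * g x)).
by apply: bdd_curveM => //; exact/bdd_curve_static/test_bdd_meas.
Qed.

Lemma continuous_L2_bdd (I : set R) u :
  (forall i, bdd_curve (fun t y => u t y i)) ->
  (forall t i, torus_periodic (fun y => u t y i)) ->
  (forall t i, torus_int (fun y => u t y i) = 0) ->
  continuous_L2 I u.
Proof.
move=> uC up u0; have A0 := @cell_area_gt0 R.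
have mu t i : measurable_fun [set: T2] (fun y => u t y i) := (bdd_curve_meas t (uC i)).1.
split=> [t It|t0 It0].
  split=> //.
  - by move=> j x; apply/funext => i; exact: up.
  - have /choice[B HB] : forall i, exists B, forall x, `|u t x i| <= B.
      by move=> i; have [_ [B HB]] := bdd_curve_meas t (uC i); exists B.
    have B0 : 0 <= B ord0 + B ord_max.
      by rewrite addr_ge0 // (le_trans (normr_ge0 _) (HB _ 0)).
    apply: (le_lt_trans (L2_norm_le B0 _ (mu t))); last by rewrite ltry.
    move=> x; elim/ord2P; apply: (le_trans (HB _ x)).
      by rewrite lerDl (le_trans (normr_ge0 _) (HB _ 0)).
    by rewrite lerDr (le_trans (normr_ge0 _) (HB _ 0)).
pose D t : @vector_field R := fun x i => u t x i - u t0 x i.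
have small (e : R) : 0 < e -> exists2 tau : R, 0 < tau & forall t, `|t - t0| <= tau ->
    (L2_norm (D t) <= (e * Num.sqrt (2 * A))%:E)%E.
  move=> e0; have [_ _ /(_ _ e0)[t1 t10 H1]] := uC ord0.
  have [_ _ /(_ _ e0)[t2 t20 H2]] := uC ord_max.
  exists (Num.min t1 t2) => [|t]; first by rewrite lt_min t10.
  rewrite le_min => /andP[h1 h2]; apply: L2_norm_le; first exact: ltW.
    by move=> x; elim/ord2P; [exact: H1|exact: H2].
  by move=> i; apply: measurable_funB.
have near_t0 (tau : R) : 0 < tau -> \forall t \near within I (nbhs t0), `|t - t0| <= tau.
  move=> tau0; apply: cvg_within; apply/nbhs_ballP; exists tau => //= t.
  by rewrite /ball /= distrC => /ltW.
apply/fine_cvgP; split.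
  have [tau tau0 H] := small 1 ltr01.
  apply: filterS (near_t0 _ tau0) => t /H h.
  rewrite ge0_fin_numE ?L2_norm_ge0 //; apply: le_lt_trans h _; exact: ltry.
apply/cvgrPdist_le => e e0.
have S0 : 0 < Num.sqrt (2 * A) by rewrite sqrtr_gt0 mulr_gt0.
have [tau tau0 H] := small _ (divr_gt0 e0 S0).
apply: filterS (near_t0 _ tau0) => t /H; rewrite divfK ?(lt0r_neq0 S0) // => h.
rewrite sub0r normrN /=.
have L0 := L2_norm_ge0 (D t).
rewrite ger0_norm ?fine_ge0 // -lee_fin fineK //.
by rewrite ge0_fin_numE //; apply: le_lt_trans h _; exact: ltry.
Qed.

End Regularity.

Theorem theorem1p2 (R : realType) (nu alpha : R) (f u0 : @vector_dist R) :
  0 < nu -> -1 < alpha -> alpha < 0 ->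
  sobolev alpha f ->
  sobolev (alpha + 2) u0 -> divergence_free u0 ->
  exists u : R -> @vector_field R,
    leray_solution nu f u0 u /\
    Linfty_sobolev `[0, +oo[ (alpha + 2) (fun t => dist_of (u t)).
Proof.
move=> nu0 a1 a0 [fD f1 fS] [u0D u01 u0S] u0div.
(* The exponent of [d n]: positive for the lattice sum to converge, at most 1 for [d n <= |n|]. *)
have del0 : 0 < alpha + 1 by lra.
have del1 : alpha + 1 <= 1 by lra.
have [G HG] := energy_stream_le fS; have [G0 HG0] := energy_stream_le2 u0S.
have [ul [p [K [M [[ulc ulp ulM ulmod] ulfc [p_init p0] pK pder]]]]] :=
  galerkin_limit nu0 (wgt_ge0 (alpha + 1)) (wgt_ge1 del0) (wgt_sqr_le del1)
    (wgt_add_le del0 del1) (wgt_tail del0 del1) (stream_hermitian fD) (stream_hermitian u0D) HG HG0.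
(* Freezing [u] for [t < 0] makes its modulus of continuity valid on the whole line. *)
pose tt (t : R) := Num.max t 0; pose u t := ul (tt t); pose psi t := p (tt t).
have tt0 t : 0 <= tt t by rewrite le_max lexx orbT.
have ttE t : 0 <= t -> tt t = t by move=> t0; rewrite /tt; exact: max_l.
have ttd s t : `|tt t - tt s| <= `|t - s|.
  rewrite /tt; case: (leP t 0) => ht; case: (leP s 0) => hs.
  - by rewrite subrr normr0.
  - by rewrite sub0r normrN gtr0_norm // distrC ger0_norm ?subr_ge0; lra.
  - by rewrite subr0 gtr0_norm // ger0_norm ?subr_ge0; lra.
  - by [].
have uC i : bdd_curve (fun t y => u t y i).
  split.
  - by move=> t; apply: continuous_measurable2; exact: ulc.
  - exists M; first exact: le_trans (normr_ge0 _) (ulM 0 0 i).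
    by move=> t x; exact: ulM.
  move=> e e0; have [tau tau0 H] := ulmod e e0; exists tau => // s t ts x.
  by apply: H => //; exact: le_trans ts.
have bu t i : bdd_meas (fun y => u t y i) := bdd_curve_meas t (uC i).
have ufc t i n : fourier n (fun y => u t y i) = (cell_area%:C)%C * (((perp n i)%:C)%C * psi t n).
  exact: ulfc.
have psi0 t : psi t 0 = 0 by exact: p0.
have sob s t : s <= alpha + 2 -> sobolev s (dist_of (u t)) /\
    (sobolev_norm s (dist_of (u t)) <= (K `^ 2^-1)%:E)%E.
  move=> sa; apply: (@sobolev_velocity R alpha s K (u t) (psi t)) => //.
  exact: pK.
have uint t i : torus_int (fun y => u t y i) = 0.
  have [[_ h _] _] := sob (alpha + 2) t (lexx _).
  by rewrite -[RHS](h i); congr torus_int; apply/funext => x; rewrite mulr1.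
(* This ultrafilter only sums series over the modes; it is chosen independently of the one behind
   [galerkin_limit]. *)
have [U [UU Ufree]] := exists_free_ultrafilter.
have f0 i : dist_fourier (f i) 0 = 0 by rewrite dist_fourier_fourier_coeff fourier_coeff0 // mulr0.
have [Cf Cf0 fCf] := dist_fourier_growth (ltW a1) fS.
exists u; split; last first.
  split; first exact: measurable_curve_bdd.
  exists (K `^ 2^-1); apply: aeW => t _; exact: sob.
split.
- move=> tau tau0; split; first by apply: continuous_L2_bdd => // t i; exact: ulp.
  (* The uniform bound in [H^(alpha+2)] contains one in [H^1], which makes the norm square
     integrable on bounded time intervals. *)
  have s1 : (1 : R) <= alpha + 2 by lra.
  split; first exact: measurable_curve_bdd.
    by apply: aeW => t _; have [] := sob 1 t s1.
  apply: (@le_lt_trans _ _ (\int[@lebesgue_measure R]_(t in `[0%R, tau]) (cst (((K `^ 2^-1)%:E) `^ 2)) t)%E).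
    apply: ge0_le_integral_nm => t; first exact: poweR_ge0.
    have [_ h] := sob 1 t s1; apply: gt0_ler_poweR => //.
      by rewrite in_itv /= leey andbT poweR_ge0.
    by rewrite in_itv /= leey andbT lee_fin powR_ge0.
  rewrite integral_cst; last exact: measurable_itv.
  have mI : (@lebesgue_measure R) `[0, tau]%classic = tau%:E.
    by rewrite lebesgue_measure_itv /= lte_fin tau0 -EFinD subr0.
  have -> : (((K `^ 2^-1)%:E `^ 2) * (@lebesgue_measure R) `[0%R, tau]%classic =
    ((K `^ 2^-1) `^ 2 * tau)%:E)%E by rewrite poweR_EFin EFinM; congr (_ * _)%E.
  exact: ltry.
- move=> t _; apply: (div_free_from_fourier UU Ufree (bu t) (z := psi t)) => i n; exact: ufc.
- move=> i g tg; apply: (dist_eq_dist_fourier UU Ufree _ (u0D i) _ tg); first exact: bdd_meas_dist.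
  move=> n; have -> : dist_fourier (dist_of (u 0) i) n = fourier n (fun x => u 0 x i) by exact: dist_fourier_bdd.
  rewrite ufc dist_fourier_fourier_coeff; congr (_ * _); have [->|n0] := eqVneq n 0.
    by rewrite psi0 mulr0 fourier_coeff0.
  by rewrite (fourier_coeff_stream i u0D u0div n0) /psi ttE // p_init.
have dpsi n s : n != 0 -> 0 < s -> cderivable (fun t => psi t n) s
  (((- (nu * freq2 n))%:C)%C * psi s n +
   ((- (freq2 n)^-1)%:C)%C * ('i%C * \sum_(i < 2) \sum_(j < 2)
      ((perp n i * phase n (torus_basis j))%:C)%C *
      ((cell_area^-1%:C)%C * fourier n (fun y => u s y j * u s y i))) + stream f n).
  move=> n0 s0 e e0; have [tau tau0 H] := pder n e n0 e0.
  (* A radius of at most [s] keeps [t] non-negative, where [u] is not frozen and the expansion is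
     available. *)
  exists (Num.min tau s); first by rewrite lt_min tau0.
  move=> t; rewrite le_min => /andP[ts t_s].
  have t0 : 0 <= t by move: t_s; rewrite ler_norml => /andP[h _]; lra.
  rewrite /psi /u (ttE t t0) (ttE s (ltW s0)).
  exact: (H s t (ltW s0) t0 ts).
have [P P0 HP] := pressure_coef_bounded uC fCf Cf0.
exists (pressure U (pressure_coef u f)); split.
  by apply: (pressure_distribution UU _ HP) => n; exact: pressure_coef_ccontinuous.
apply: (momentum_from_balance UU Ufree _ HP uC fD).
  by move=> n; exact: pressure_coef_ccontinuous.
move=> a b phi i n apos tp.
exact: (mode_balance uC ufc psi0 f0 dpsi i n apos tp).
Qed.
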